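(* For a separable infinite dimensional Fréchet space $X$ over $\mathbb{K}$, let $\nu(X)$ be the number of isomorphism classes (as topological vector spaces) of dense linear subspaces of $X$ of infinite countable algebraic dimension (each with the topology inherited from $X$). Then $\nu(X)=1$ if $X\in\mathcal{F}_0\cup\mathcal{F}_1$, $\nu(X)=3$ if $X\in\mathcal{F}_2$, and $\nu(X)$ is uncountable if $X\in\mathcal{F}_3$.
   Context: $\mathbb{K}$ is either $\mathbb{R}$ or $\mathbb{C}$; all topological spaces are Hausdorff; $\mathbb{N}=\{1,2,\dots\}$. A Fréchet space is a complete metrizable locally convex space. For a seminorm $p$, $\ker p=\{x:p(x)=0\}$. For $j\in\{0,1,2,3\}$, a separable infinite dimensional Fréchet space $X$ belongs to $\mathcal{F}_j$ if for some increasing sequence $\{p_n\}_{n\in\mathbb{N}}$ of seminorms on $X$ defining the topology of $X$ the following condition $(A_j)$ holds: $(A_0)$ $X/\ker p_1$ is finite dimensional and $\ker p_n/\ker p_{n+1}$ is finite dimensional for each $n\in\mathbb{N}$; $(A_1)$ there is $n\in\mathbb{N}$ such that $\ker p_n=\{0\}$; $(A_2)$ $X/\ker p_1$ is infinite dimensional, and $\ker p_n/\ker p_{n+1}$ is finite dimensional for each $n\in\mathbb{N}$ and is non-zero for infinitely many $n\in\mathbb{N}$; $(A_3)$ $\ker p_n/\ker p_{n+1}$ is infinite dimensional for infinitely many $n\in\mathbb{N}$. The classes $\mathcal{F}_0,\dots,\mathcal{F}_3$ partition the class of separable infinite dimensional Fréchet spaces. *)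

(* Defs.v *)
From mathcomp Require Import all_boot all_order all_algebra.
From mathcomp Require Import boolp classical_sets functions cardinality.
From mathcomp Require Import reals topology tvs.
From mathcomp Require Import complex.

Set Implicit Arguments.
Unset Strict Implicit.
Unset Printing Implicit Defensive.

Import Order.TTheory GRing.Theory Num.Theory.
Local Open Scope classical_set_scope.
Local Open Scope ring_scope.

Variant RorC (R : realType) : numFieldType -> Prop :=
| RorC_real : RorC R R
| RorC_complex : RorC R (complex R).

(* Metrics and seminorms take values in K, as norms and [metricType K] do in
   the library; for complex scalars, 0 <= z forces z to be a real number. *)

Section Frechet.
Variables (K : numFieldType) (X : tvsType K).

Definition metrizable : Prop :=
  exists d : X -> X -> K,
    [/\ forall x y, 0 <= d x y,
        forall x y, d x y = 0 <-> x = y,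
        forall x y, d x y = d y x,
        forall x y z, d x z <= d x y + d y z &
        forall (x : X) (U : set X),
          nbhs x U <-> exists2 e : K, 0 < e & [set y | d x y < e] `<=` U].

(* [tvsType] does not relate its uniformity to the vector space structure, so
   Cauchy filters are taken with respect to neighbourhoods of 0 and not with
   respect to [entourage]. *)
Definition tvs_cauchy (F : set_system X) : Prop :=
  forall U : set X, nbhs (0 : X) U ->
    exists2 A, F A & forall x y, A x -> A y -> U (x - y).

Definition tvs_complete : Prop :=
  forall F : set_system X, ProperFilter F -> tvs_cauchy F ->
    exists x : X, F --> x.

(* Local convexity is part of [tvsType]. *)
Definition frechet : Prop := metrizable /\ tvs_complete.

Definition separable : Prop := exists2 D : set X, countable D & dense D.

(* U / V is finite dimensional: it is spanned by the classes of finitely many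
   elements of U. Only used for subspaces V of U. *)
Definition findim_quotient (U V : set X) : Prop :=
  exists (n : nat) (v : 'I_n -> X), (forall i, U (v i)) /\
    forall x, U x -> exists c : 'I_n -> K, V (x - \sum_(i < n) c i *: v i).

Definition finite_dimensional : Prop := findim_quotient setT [set 0].

Definition separable_infdim_frechet : Prop :=
  [/\ frechet, separable & ~ finite_dimensional].

Definition seminorm (p : X -> K) : Prop :=
  [/\ forall x, 0 <= p x,
      forall x y, p (x + y) <= p x + p y &
      forall a x, p (a *: x) = `|a| * p x].

Definition ker (p : X -> K) : set X := [set x | p x = 0].

Definition defines_topology (p : nat -> X -> K) : Prop :=
  forall (x : X) (U : set X), nbhs x U <->
    exists (N : nat) (e : K), 0 < e /\
      [set y | forall n, (n <= N)%N -> p n (y - x) < e] `<=` U.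

(* Seminorm sequences are indexed from 0. *)
Definition defining_sequence (p : nat -> X -> K) : Prop :=
  [/\ forall n, seminorm (p n),
      forall n x, p n x <= p n.+1 x &
      defines_topology p].

Definition findim_step (p : nat -> X -> K) (n : nat) : Prop :=
  findim_quotient (ker (p n)) (ker (p n.+1)).

Definition infinitely_many (P : nat -> Prop) : Prop :=
  forall N, exists2 n, (N <= n)%N & P n.

Definition condA0 (p : nat -> X -> K) : Prop :=
  findim_quotient setT (ker (p 0%N)) /\ forall n, findim_step p n.

Definition condA1 (p : nat -> X -> K) : Prop :=
  exists n, ker (p n) = [set 0].

(* For subspaces V of U, U / V is non-zero iff U is not contained in V. *)
Definition condA2 (p : nat -> X -> K) : Prop :=
  [/\ ~ findim_quotient setT (ker (p 0%N)),
      forall n, findim_step p n &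
      infinitely_many (fun n => ~ (ker (p n) `<=` ker (p n.+1)))].

Definition condA3 (p : nat -> X -> K) : Prop :=
  infinitely_many (fun n => ~ findim_step p n).

(* To be used for separable infinite dimensional Frechet spaces X. *)
Definition classF (A : (nat -> X -> K) -> Prop) : Prop :=
  exists2 p, defining_sequence p & A p.

Definition F0 := classF condA0.
Definition F1 := classF condA1.
Definition F2 := classF condA2.
Definition F3 := classF condA3.

Definition linear_subspace (E : set X) : Prop :=
  E 0 /\ forall (a : K) x y, E x -> E y -> E (a *: x + y).

Definition linearly_independent (e : nat -> X) : Prop :=
  forall (n : nat) (c : nat -> K), \sum_(i < n) c i *: e i = 0 ->
    forall i, (i < n)%N -> c i = 0.

Definition countably_infinite_dimensional (E : set X) : Prop :=
  exists e : nat -> X, linearly_independent e /\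
    E = [set x | exists (n : nat) (c : nat -> K),
                   x = \sum_(i < n) c i *: e i].

Definition dense_countable_subspace (E : set X) : Prop :=
  [/\ linear_subspace E, dense E & countably_infinite_dimensional E].

Definition linear_on (E : set X) (f : X -> X) : Prop :=
  forall (a : K) x y, E x -> E y -> f (a *: x + y) = a *: f x + f y.

(* f restricts to a linear homeomorphism from E onto F with inverse the
   restriction of g, for the topologies inherited from X. *)
Definition subspace_isomorphic (E F : set X) : Prop :=
  exists f g : X -> X,
    [/\ linear_on E f,
        (forall x, E x -> F (f x) /\ g (f x) = x),
        (forall y, F y -> E (g y) /\ f (g y) = y),
        {within E, continuous f} &
        {within F, continuous g}].

(* The set whose cardinality is nu(X). *)
Definition isomorphism_classes : set (set (set X)) :=
  [set C | exists2 E, dense_countable_subspace E &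
     C = [set F | dense_countable_subspace F /\ subspace_isomorphic E F]].

End Frechet.

Arguments isomorphism_classes {K} X.

(* Main.v *)
(* An isomorphism between dense subspaces is bounded for the seminorms p_n, so
   everything can be read off the traces of E on the kernels N_n of p_n.

   If E and F have the same trace on N_n, a back-and-forth construction gives an
   operator T = I + sum_i f_i (x) x_i with T(E) = F, where the functionals f_i
   are bounded by p_n (Hahn-Banach) and the x_i are tiny (density). This settles
   every pair of subspaces having a continuous norm, hence F1. When all N_0 / N_n
   are finite dimensional, N_0 is a product of lines, and a Mackey-type
   alternation finds coordinates of N_0 adapted to the trace of E. Matching the
   coordinates adapted to E and F by an automorphism of X reduces to the case of
   equal traces. So E is determined by the alternative: E meets some N_n
   trivially; the trace of E on N_n is dense in N_n for large n; neither. All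
   three occur for F2, only the second one for F0 (with p_0 replaced by 0).

   For F3 the traces can be made arbitrarily thin: for every sequence a there is
   an E such that, for some n and all k, the Bernstein widths of E on N_n with
   respect to some p_l and p_k are O(1 / a_i), while p_k has infinite rank on
   each trace for suitable k. Both properties are isomorphism invariants, and a
   diagonal choice of a defeats any countable list of such subspaces. *)

Require Import Defs.
From mathcomp Require Import all_boot all_order all_algebra.
From mathcomp Require Import boolp classical_sets functions cardinality.
From mathcomp Require Import reals topology tvs.
From mathcomp Require Import complex ring lra.

Set Implicit Arguments.
Unset Strict Implicit.
Unset Printing Implicit Defensive.
Import Order.TTheory GRing.Theory Num.Theory.
Local Open Scope classical_set_scope.
Local Open Scope ring_scope.

(** The obstacle is to carry E exactly onto F by an invertible operator. Each f_i is bounded by p,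
    so T fixes the kernel of p pointwise, which is why the traces must agree there beforehand. Off
    the kernel, the p-sizes of the x_i add up to at most 1/2, so p(Tz) >= p(z)/2. Each f_n kills the
    vectors treated before it, so on any vector of E the series for T stops after finitely many
    terms.

    The adapted coordinates of a kernel are functionals on all of X. They make the kernel
    complemented, so that any change of coordinates on it extends to an automorphism of X.

    Thin traces are spanned by series with rapidly growing coefficients whose l-th term lies in the
    l-th of a decreasing chain of kernels. A given seminorm sees only finitely many terms, so the
    next coefficient can be chosen to dominate it. A later seminorm detects that coefficient, and
    the ratio of the two seminorms is as small as desired. *)

(** Dependent choice where each entry may refer to all earlier ones. A partial history is a total
    function whose later values do not matter; the first hypothesis expresses this. *)
Lemma history_choice (Q : Type) (q0 : Q) (good : nat -> (nat -> Q) -> Prop) :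
  (forall n h h', (forall i, (i <= n)%N -> h i = h' i) ->
     good n h -> good n h') ->
  (forall n h, (forall i, (i < n)%N -> good i h) ->
     exists q, good n (fun i => if i == n then q else h i)) ->
  exists h, forall n, good n h.
Proof.
move=> loc ext.
pose upd (h : nat -> Q) n q := fun i => if i == n then q else h i.
have /choice [next nextP] : forall nh : nat * (nat -> Q), exists q,
    (forall i, (i < nh.1)%N -> good i nh.2) -> good nh.1 (upd nh.2 nh.1 q).
  move=> [n h] /=; have [H|H] := pselect (forall i, (i < n)%N -> good i h).
    by have [q Hq] := ext n h H; exists q.
  by exists q0.
(* In [H n] the entries below [n] are final, so the sequence sought is the diagonal [H i.+1 i]. *)
pose H := fix H n := if n is m.+1 then upd (H m) m (next (m, H m))
                     else fun=> q0.
have Hst m n i : (i < m)%N -> (m <= n)%N -> H n i = H m i.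
  move=> im; elim: n => [|n IH]; first by rewrite leqn0 => /eqP m0; rewrite m0 in im.
  rewrite leq_eqVlt => /orP[/eqP->//|]; rewrite ltnS => mn /=.
  rewrite /upd ifF ?IH//; apply/negbTE; rewrite neq_ltn.
  by rewrite (leq_trans im mn).
have Hgood n : forall i, (i < n)%N -> good i (H n).
  elim: n => // n IH i; rewrite ltnS leq_eqVlt => /orP[/eqP->|ilt].
    exact: (nextP (n, H n)).
  apply: loc (IH _ ilt) => j ji.
  by rewrite (Hst n n.+1)// (leq_ltn_trans ji).
exists (fun i => H i.+1 i) => n.
by apply: loc (Hgood n.+1 n (ltnSn n)) => i ile; rewrite (Hst i.+1 n.+1).
Qed.

(** * The Hahn-Banach theorem over the real and complex numbers *)

Section RealHahnBanach.
Variables (R : realType) (K : numFieldType) (emb : {rmorphism R -> K}).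
Variable X : lmodType K.
Local Notation "r *~: x" := (emb r *: x) (at level 40).

Definition sublinear (s : X -> R) : Prop :=
  (forall x y, s (x + y) <= s x + s y) /\
  (forall r x, 0 <= r -> s (r *~: x) = r * s x).

Lemma sublinear0 s : sublinear s -> s 0 = 0.
Proof. by move=> [_ /(_ 0 0 (lexx _))]; rewrite mul0r scaler0. Qed.

Lemma sublinear_oppr s x : sublinear s -> - s (- x) <= s x.
Proof.
by move=> ss; have := ss.1 x (- x); rewrite subrr sublinear0//; lra.
Qed.

(* Lowering [s] along [e]: a sublinear functional below [s] whose value at
   [- e] is at most [- s e]. *)
Definition tilt (s : X -> R) (e x : X) : R :=
  inf [set s (x + t *~: e) - t * s e | t in [set t | 0 <= t]].

Lemma tilt_lb s e x : sublinear s ->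
  has_inf [set s (x + t *~: e) - t * s e | t in [set t | 0 <= t]].
Proof.
move=> ss; split.
  by exists (s (x + 0 *~: e) - 0 * s e); exists 0 => //=.
exists (- s (- x)) => _ [t /= t0 <-].
have := ss.1 (- x) (x + t *~: e); rewrite addKr (ss.2 t e t0); lra.
Qed.

Lemma tilt_le s e x t : sublinear s -> 0 <= t ->
  tilt s e x <= s (x + t *~: e) - t * s e.
Proof.
move=> ss t0; apply: ge_inf; first by have [] := tilt_lb e x ss.
by exists t.
Qed.

Lemma tilt_le_self s e x : sublinear s -> tilt s e x <= s x.
Proof.
move=> ss; have := tilt_le e x ss (lexx 0).
by rewrite rmorph0 scale0r addr0 mul0r subr0.
Qed.

Lemma le_tilt s e x b : sublinear s ->
  (forall t, 0 <= t -> b <= s (x + t *~: e) - t * s e) -> b <= tilt s e x.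
Proof.
move=> ss H; apply: lb_le_inf; first by have [] := tilt_lb e x ss.
by move=> _ [t /= t0 <-]; exact: H.
Qed.

Lemma tilt_sublinear s e : sublinear s -> sublinear (tilt s e).
Proof.
move=> ss; split=> [x y|r x].
  suff H t t' : 0 <= t -> 0 <= t' ->
    tilt s e (x + y) <= (s (x + t *~: e) - t * s e) +
                        (s (y + t' *~: e) - t' * s e).
    rewrite -lerBlDr; apply: le_tilt => // t t0.
    rewrite lerBlDl -lerBlDr; apply: le_tilt => // t' t'0.
    by rewrite lerBlDl; exact: H.
  move=> t0 t'0; apply: (le_trans (tilt_le e _ ss (addr_ge0 t0 t'0))).
  have := ss.1 (x + t *~: e) (y + t' *~: e).
  by rewrite rmorphD scalerDl addrACA; lra.
rewrite le_eqVlt => /orP[/eqP <-|r0].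
  rewrite rmorph0 scale0r mul0r; apply/le_anti/andP; split.
    by have := tilt_le_self e 0 ss; rewrite (sublinear0 ss).
  by apply: (le_tilt (x := 0) ss) => t t0; rewrite add0r ss.2// subrr.
(* One inequality suffices: the other is this one for [r^-1] and [r *~: x]. *)
have half r' x' : 0 < r' -> r' * tilt s e x' <= tilt s e (r' *~: x').
  move=> r'0; apply: le_tilt => // t t0.
  have tr : 0 <= t / r' by rewrite divr_ge0// ltW.
  have := tilt_le e x' ss tr; rewrite -(ler_pM2l r'0) => /le_trans; apply.
  rewrite mulrBr -(ss.2 _ _ (ltW r'0)) scalerDr scalerA -rmorphM.
  by rewrite mulrCA divff ?gt_eqF// mulr1 mulrA mulrCA divff ?gt_eqF// mulr1.
apply/le_anti/andP; split; last exact: half.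
have rV : 0 < r^-1 by rewrite invr_gt0.
have := half r^-1 (r *~: x) rV.
rewrite scalerA -rmorphM mulVf ?gt_eqF// rmorph1 scale1r.
by rewrite ler_pdivrMl.
Qed.

(** Zorn's lemma for the reversed pointwise order. Along a chain the values at [x] stay above
    [- q (- x)], so the pointwise infimum is finite; it is subadditive because the chain is totally
    ordered. *)
Lemma minimal_sublinear (q : X -> R) : sublinear q ->
  exists s, [/\ sublinear s, (forall x, s x <= q x) &
    forall s', sublinear s' -> (forall x, s' x <= s x) -> s' = s].
Proof.
move=> qs.
pose T := {s : X -> R | sublinear s /\ forall x, s x <= q x}.
pose rel (a b : T) := `[< forall x, sval b x <= sval a x >].
have lbT (t : T) x : - q (- x) <= sval t x.
  case: t => t [ts tq] /=; have := sublinear_oppr x ts.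
  by have := tq (- x); lra.
have [||||t tmax] := @Zorn T rel.
- by move=> t; apply/asboolP.
- move=> r s t /asboolP rs /asboolP st; apply/asboolP => x.
  exact: le_trans (st x) (rs x).
- move=> [s Hs] [t Ht] /asboolP /= st /asboolP /= ts.
  by apply/eq_exist/funext => x; apply/le_anti; rewrite st ts.
- move=> A tot.
  have [[a0 Aa0]|nA] := pselect (A !=set0); last first.
    exists (exist _ q (conj qs (fun=> lexx _))) => s As.
    by case: nA; exists s.
  pose m x := inf [set sval a x | a in A].
  have hi x : has_inf [set sval a x | a in A].
    by split; [exists (sval a0 x), a0|exists (- q (- x)) => _ [a _ <-]].
  have mle a x : A a -> m x <= sval a x.
    by move=> Aa; apply: ge_inf; [have [] := hi x|exists a].
  have lem x b : (forall a, A a -> b <= sval a x) -> b <= m x.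
    move=> H; apply: lb_le_inf; first by have [] := hi x.
    by move=> _ [a Aa <-]; exact: H.
  have ms : sublinear m.
    split=> [x y|r x].
      suff H a b : A a -> A b -> m (x + y) <= sval a x + sval b y.
        rewrite -lerBlDr; apply: (lem x) => a Aa.
        rewrite lerBlDl -lerBlDr; apply: (lem y) => b Ab.
        by rewrite lerBlDl; exact: H.
      move=> Aa Ab; have [/asboolP ab|/asboolP ba] := tot a b Aa Ab.
        apply: (le_trans (mle b _ Ab)).
        by have := (svalP b).1.1 x y; have := ab x; lra.
      apply: (le_trans (mle a _ Aa)).
      by have := (svalP a).1.1 x y; have := ba y; lra.
    move=> r0; apply/le_anti/andP; split; last first.
      apply: (lem (r *~: x)) => a Aa; rewrite (svalP a).1.2//.
      by rewrite ler_wpM2l// mle.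
    have [r0'|r0'] := ltP 0 r; last first.
      have -> : r = 0 by apply/le_anti; rewrite r0 r0'.
      rewrite mul0r; apply: (le_trans (mle a0 _ Aa0)).
      by rewrite (svalP a0).1.2// mul0r.
    rewrite -ler_pdivrMl//; apply: (lem x) => a Aa.
    by rewrite ler_pdivrMl// -(svalP a).1.2// mle.
  exists (exist _ m (conj ms (fun x => le_trans (mle a0 x Aa0) ((svalP a0).2 x)))).
  by move=> s As; apply/asboolP => x /=; exact: mle.
case: t tmax => s [ss sq] smax; exists s; split=> // s' s's s'le.
have s'q x : s' x <= q x by exact: le_trans (sq x).
have := smax (exist _ s' (conj s's s'q)).
by move=> /(_ (asboolT s'le)) [].
Qed.

(** A minimal functional equals each of its tilts, whence s(x) + s(y) <= s(x + y). Minimising below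
    [tilt q e] instead of [q] forces the value [q e] at [e], since the tilt is at most [- q e] at
    [- e]. *)
Lemma real_hahn_banach (q : X -> R) (e : X) : sublinear q ->
  exists f : X -> R, [/\ forall x y, f (x + y) = f x + f y,
    forall r x, f (r *~: x) = r * f x, forall x, f x <= q x & f e = q e].
Proof.
move=> qs; have [s [ss sq smin]] := minimal_sublinear (tilt_sublinear e qs).
have sD x y : s (x + y) = s x + s y.
  apply/le_anti/andP; split; first exact: ss.1.
  rewrite -lerBrDr.
  have sy : tilt s y = s.
    apply: smin => [|z]; [exact: tilt_sublinear|exact: tilt_le_self].
  by have := tilt_le y x ss ler01; rewrite sy rmorph1 scale1r mul1r; lra.
have sN x : s (- x) = - s x.
  by have := sD x (- x); rewrite subrr (sublinear0 ss); lra.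
exists s; split=> // [r x|x|].
- have [r0|r0] := leP 0 r; first exact: ss.2.
  rewrite -[r]opprK rmorphN scaleNr sN ss.2 ?mulNr//; lra.
- exact: le_trans (sq x) (tilt_le_self _ _ qs).
- apply/le_anti/andP; split.
    exact: le_trans (sq e) (tilt_le_self _ _ qs).
  have := le_trans (sq (- e)) (tilt_le e (- e) qs ler01).
  by rewrite sN rmorph1 scale1r mul1r addNr (sublinear0 qs); lra.
Qed.

End RealHahnBanach.

Definition real_seminorm (R : realType) (K : numFieldType) (abs : K -> R)
    (X : lmodType K) (q : X -> R) : Prop :=
  (forall x y, q (x + y) <= q x + q y) /\ (forall a x, q (a *: x) = abs a * q x).

Definition linear_map (K : numFieldType) (V W : lmodType K) (f : V -> W) : Prop :=
  forall a x y, f (a *: x + y) = a *: f x + f y.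

(* The absolute value of [K] with values in [R], together with the Hahn-Banach
   theorem, which is all that is used of the alternative [K = R] or
   [K = complex R]. *)
Record valuation (R : realType) (K : numFieldType) := Valuation {
  emb : {rmorphism R -> K};
  abs : K -> R;
  ler_emb : forall r s, (emb r <= emb s) = (r <= s);
  emb_abs : forall a, emb (abs a) = `|a|;
  emb_real : forall a : K, 0 <= a -> exists r, a = emb r;
  hahn_banach : forall (X : lmodType K) (q : X -> R) (e : X),
    real_seminorm abs q -> q e != 0 ->
    exists f : X -> K^o,
      [/\ linear_map f, forall x, abs (f x) <= q x & f e != 0] }.

Section Instances.
Variable R : realType.

Lemma seminorm_sublinear (K : numFieldType) (em : {rmorphism R -> K})
    (ab : K -> R) (X : lmodType K) (q : X -> R) :
  (forall r, 0 <= r -> ab (em r) = r) -> real_seminorm ab q -> sublinear em q.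
Proof. by move=> abE [qD qZ]; split=> // r x r0; rewrite qZ abE. Qed.

Lemma real_valuation_exists : inhabited (valuation R R).
Proof.
have HB (X : lmodType R) (q : X -> R) (e : X) :
    real_seminorm Num.norm q -> q e != 0 -> exists f : X -> R^o,
    [/\ linear_map f, forall x, `|f x| <= q x & f e != 0].
  move=> qs qe.
  have sq : sublinear (@idfun R) q.
    by apply: (seminorm_sublinear (em := idfun) _ qs) => r r0; exact: ger0_norm.
  have [f [fD fZ fq fe]] := real_hahn_banach e sq.
  exists f; split=> [a x y|x|]; rewrite ?fe//.
    by rewrite fD fZ.
  rewrite ler_norml fq andbT lerNl.
  have -> : - f x = f (- x) by rewrite -scaleN1r fZ mulN1r.
  by rewrite (le_trans (fq _))// -scaleN1r qs.2 normrN1 mul1r.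
constructor; apply: (@Valuation R R idfun Num.norm) => //.
by move=> a _; exists a.
Qed.

Lemma complex_valuation_exists : inhabited (valuation R (complex R)).
Proof.
pose C := complex R; pose em : {rmorphism R -> C} := real_complex R.
pose ab (z : C) : R := complex.Re `|z|.
have abE (z : C) : em (ab z) = `|z|.
  by rewrite /em/= /ab; exact/RRe_real/normr_real.
have emle r s : (em r <= em s) = (r <= s) by rewrite /em/= lecR.
have abem r : 0 <= r -> ab (em r) = r.
  move=> r0; apply: (fmorph_inj em); rewrite abE ger0_norm//.
  by rewrite -[0](rmorph0 em) emle.
have HB (X : lmodType C) (q : X -> R) (e : X) :
    real_seminorm ab q -> q e != 0 -> exists f : X -> C^o,
    [/\ linear_map f, forall x, ab (f x) <= q x & f e != 0].
  move=> qs qe.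
  have [f [fD fZ fq fe]] := real_hahn_banach e (seminorm_sublinear abem qs).
  (* The complex linear functional with real part [f]. *)
  pose F (x : X) : C^o := em (f x) - 'i%C * em (f ('i%C *: x)).
  have f0 : f 0 = 0 by have := fD 0 0; rewrite addr0; lra.
  have FD x y : F (x + y) = F x + F y.
    by rewrite /F scalerDr !fD !rmorphD/=; ring.
  have i2 : 'i%C * 'i%C = -1 :> C by rewrite -expr2 sqr_i.
  have Fi x : F ('i%C *: x) = 'i%C * F x.
    rewrite /F scalerA i2 scaleN1r.
    have -> : f (- x) = - f x.
      by apply/eqP; rewrite -subr_eq0 opprK -fD addNr f0.
    rewrite mulrBr mulrA i2 rmorphN; ring.
  have FR r x : F (em r *: x) = em r * F x.
    rewrite /F scalerA [_ * em r]mulrC -scalerA !fZ !rmorphM/=; ring.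
  have FZ a x : F (a *: x) = a * F x.
    have aE : a = em (complex.Re a) + 'i%C * em (complex.Im a) by exact: complexE.
    rewrite {1}aE scalerDl FD FR -scalerA Fi FR {3}aE; ring.
  have ReF x : complex.Re (F x) = f x.
    rewrite /F; move: (f x) (f _) => b c.
    by rewrite /em /= !(mul0r, mulr0, subrr, oppr0, addr0, subr0).
  exists F; split=> [a x y|x|]; first by rewrite FD FZ.
  - have [->|Fx0] := eqVneq (F x) 0.
      have qN : q (- x) = q x by rewrite -scaleN1r qs.2 /ab normrN1 mul1r.
      have q0 : q 0 = 0 by rewrite -(scale0r 0) qs.2 /ab normr0 mul0r.
      by rewrite /ab normr0/=; have := qs.1 x (- x); rewrite subrr q0 qN; lra.
    (* A rotation making the value real, so that it is a value of [f], which [q] bounds. *)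
    pose th := `|F x| / F x.
    have thx : F (th *: x) = `|F x| by rewrite FZ /th divfK.
    have nth : ab th = 1.
      by rewrite /ab normrM normfV normr_id divff ?normr_eq0.
    rewrite -[ab _]/(complex.Re `|F x|) -thx ReF (le_trans (fq _))//.
    by rewrite qs.2 nth mul1r.
  - apply/eqP => Fe; have := ReF e; rewrite Fe fe /= => q0.
    by rewrite -q0 eqxx in qe.
constructor; apply: (@Valuation R C em ab) => // a a0.
by exists (complex.Re a); rewrite /em/= RRe_real// realE a0.
Qed.

Lemma valuation_RorC (K : numFieldType) : RorC R K -> inhabited (valuation R K).
Proof.
by case; [exact: real_valuation_exists|exact: complex_valuation_exists].
Qed.

End Instances.

(** * Seminorms, linear combinations and bounded functionals *)

Section Valuation.
Variables (R : realType) (K : numFieldType) (V : valuation R K).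
Implicit Types a b : K.

Lemma emb_inj : injective (emb V).
Proof. exact: fmorph_inj. Qed.

Lemma absM a b : abs V (a * b) = abs V a * abs V b.
Proof. by apply: emb_inj; rewrite rmorphM !emb_abs normrM. Qed.

Lemma absD a b : abs V (a + b) <= abs V a + abs V b.
Proof. by rewrite -(ler_emb V) rmorphD !emb_abs ler_normD. Qed.

Lemma abs_ge0 a : 0 <= abs V a.
Proof. by rewrite -(ler_emb V) rmorph0 emb_abs normr_ge0. Qed.

Lemma abs_eq0 a : (abs V a == 0) = (a == 0).
Proof. by rewrite -(inj_eq emb_inj) rmorph0 emb_abs normr_eq0. Qed.

Lemma abs0 : abs V 0 = 0.
Proof. by apply/eqP; rewrite abs_eq0. Qed.

Lemma abs1 : abs V 1 = 1.
Proof. by apply: emb_inj; rewrite emb_abs rmorph1 normr1. Qed.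

Lemma absN a : abs V (- a) = abs V a.
Proof. by apply: emb_inj; rewrite !emb_abs normrN. Qed.

Lemma absV a : abs V a^-1 = (abs V a)^-1.
Proof. by apply: emb_inj; rewrite fmorphV !emb_abs normfV. Qed.

Lemma abs_gt0 a : a != 0 -> 0 < abs V a.
Proof. by move=> a0; rewrite lt_neqAle abs_ge0 andbT eq_sym abs_eq0. Qed.

Lemma abs_emb r : 0 <= r -> abs V (emb V r) = r.
Proof.
by move=> r0; apply: emb_inj; rewrite emb_abs ger0_norm// -(rmorph0 (emb V)) ler_emb.
Qed.

End Valuation.

Section Seminorm.
Variables (R : realType) (K : numFieldType) (V : valuation R K).
Variables (X : lmodType K) (q : X -> R).
Hypothesis qs : real_seminorm (abs V) q.

Lemma sn0 : q 0 = 0.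
Proof. by rewrite -(scale0r 0) qs.2 abs0 mul0r. Qed.

Lemma snN x : q (- x) = q x.
Proof. by rewrite -scaleN1r qs.2 absN abs1 mul1r. Qed.

Lemma sn_ge0 x : 0 <= q x.
Proof. by have := qs.1 x (- x); rewrite subrr snN sn0; lra. Qed.

Lemma snC x y : q (x - y) = q (y - x).
Proof. by rewrite -snN opprB. Qed.

Lemma sn_dist y x z : q (x - z) <= q (x - y) + q (y - z).
Proof. by have := qs.1 (x - y) (y - z); rewrite addrA subrK. Qed.

Lemma sn_sum n (F : nat -> X) : q (\sum_(i < n) F i) <= \sum_(i < n) q (F i).
Proof.
elim: n => [|n IH]; first by rewrite !big_ord0 sn0.
by rewrite !big_ord_recr/=; apply: (le_trans (qs.1 _ _)); rewrite lerD2r.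
Qed.

Lemma sn_kerD x y : q y = 0 -> q (x + y) = q x.
Proof.
move=> y0; apply/le_anti; have := qs.1 x y; have := qs.1 (x + y) (- y).
by rewrite addrK snN y0; lra.
Qed.

Lemma sn_kerB x y : q y = 0 -> q (x - y) = q x.
Proof. by move=> y0; rewrite sn_kerD// snN. Qed.

Lemma sn_kerZ a x : q x = 0 -> q (a *: x) = 0.
Proof. by move=> x0; rewrite qs.2 x0 mulr0. Qed.

Lemma sn_ker_sum n (F : nat -> X) : (forall i, (i < n)%N -> q (F i) = 0) ->
  q (\sum_(i < n) F i) = 0.
Proof.
elim: n => [|n IH] H; first by rewrite big_ord0 sn0.
by rewrite big_ord_recr/= sn_kerD ?H// IH// => i ilt; rewrite H// ltnW.
Qed.

End Seminorm.

Section LinearMap.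
Variables (K : numFieldType) (X Y : lmodType K) (f : X -> Y).
Hypothesis lf : linear_map f.

Lemma lm0 : f 0 = 0.
Proof. by have := lf (-1) 0 0; rewrite scaler0 addr0 scaleN1r addNr. Qed.

Lemma lmD x y : f (x + y) = f x + f y.
Proof. by have := lf 1 x y; rewrite !scale1r. Qed.

Lemma lmZ a x : f (a *: x) = a *: f x.
Proof. by have := lf a x 0; rewrite lm0 !addr0. Qed.

Lemma lmN x : f (- x) = - f x.
Proof. by rewrite -scaleN1r lmZ scaleN1r. Qed.

Lemma lmB x y : f (x - y) = f x - f y.
Proof. by rewrite lmD lmN. Qed.

Lemma lm_sum n (F : nat -> X) : f (\sum_(i < n) F i) = \sum_(i < n) f (F i).
Proof.
elim: n => [|n IH]; first by rewrite !big_ord0 lm0.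
by rewrite !big_ord_recr/= lmD IH.
Qed.

End LinearMap.

Section Comb.
Variables (K : numFieldType) (X : lmodType K).

Definition comb (u : nat -> X) (n : nat) (c : nat -> K) : X :=
  \sum_(i < n) c i *: u i.

Definition upd (T : Type) (h : nat -> T) (n : nat) (t : T) : nat -> T :=
  fun i => if i == n then t else h i.

Lemma updE T (h : nat -> T) n t : upd h n t n = t.
Proof. by rewrite /upd eqxx. Qed.

Lemma upd_lt T (h : nat -> T) n t i : (i < n)%N -> upd h n t i = h i.
Proof. by move=> ilt; rewrite /upd ltn_eqF. Qed.

Lemma combS u n c : comb u n.+1 c = comb u n c + c n *: u n.
Proof. by rewrite /comb big_ord_recr. Qed.

Lemma comb0 u c : comb u 0 c = 0.
Proof. by rewrite /comb big_ord0. Qed.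

Lemma eq_comb u u' n c c' : (forall i, (i < n)%N -> c i *: u i = c' i *: u' i) ->
  comb u n c = comb u' n c'.
Proof. by move=> H; apply: eq_bigr => i _; exact: H. Qed.

Lemma comb_upd u n c b : comb u n.+1 (upd c n b) = comb u n c + b *: u n.
Proof.
by rewrite combS updE; congr (_ + _); apply: eq_comb => i ilt; rewrite upd_lt.
Qed.

Lemma combP u n a c c' :
  comb u n (fun i => a * c i + c' i) = a *: comb u n c + comb u n c'.
Proof.
rewrite /comb scaler_sumr -big_split/=; apply: eq_bigr => i _.
by rewrite scalerDl scalerA.
Qed.

Lemma comb_single u n i : (i < n)%N -> comb u n (fun j => (j == i)%:R) = u i.
Proof.
move=> ilt; rewrite /comb (bigD1 (Ordinal ilt))//= eqxx scale1r big1 ?addr0//.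
by move=> j /negbTE ji; rewrite -val_eqE/= in ji; rewrite ji scale0r.
Qed.

Lemma comb_widen u n m c : (n <= m)%N ->
  comb u m (fun i => if (i < n)%N then c i else 0) = comb u n c.
Proof.
move=> nm; elim: m nm => [|m IH]; first by rewrite leqn0 => /eqP->; rewrite !comb0.
rewrite leq_eqVlt => /orP[/eqP<-|].
  by apply: eq_comb => i ->.
by rewrite ltnS => nm; rewrite combS IH// ltnNge nm/= scale0r addr0.
Qed.

Lemma lm_comb (Y : lmodType K) (f : X -> Y) u n c : linear_map f ->
  f (comb u n c) = \sum_(i < n) c i *: f (u i).
Proof.
by move=> lf; rewrite /comb (lm_sum lf n (fun i => c i *: u i)); apply: eq_bigr => i _; rewrite lmZ.
Qed.

Definition vsubspace (U : set X) : Prop :=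
  U 0 /\ forall a x y, U x -> U y -> U (a *: x + y).

Lemma vsubspaceD U x y : vsubspace U -> U x -> U y -> U (x + y).
Proof. by move=> [_ H] Ux Uy; rewrite -[x]scale1r; exact: H. Qed.

Lemma vsubspaceZ U a x : vsubspace U -> U x -> U (a *: x).
Proof. by move=> [U0 H] Ux; rewrite -[_ *: _]addr0; exact: H. Qed.

Lemma vsubspaceN U x : vsubspace U -> U x -> U (- x).
Proof. by move=> sU Ux; rewrite -scaleN1r; exact: vsubspaceZ. Qed.

Lemma vsubspaceB U x y : vsubspace U -> U x -> U y -> U (x - y).
Proof. by move=> sU Ux Uy; apply: vsubspaceD => //; exact: vsubspaceN. Qed.

Lemma vsubspace_comb U u n c : vsubspace U -> (forall i, (i < n)%N -> U (u i)) ->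
  U (comb u n c).
Proof.
move=> sU; elim: n => [|n IH] H; first by rewrite comb0; case: sU.
rewrite combS; apply: vsubspaceD => //.
  by apply: IH => i ilt; apply: H; rewrite ltnW.
by apply: vsubspaceZ => //; exact: H.
Qed.

Lemma vsubspaceI U W : vsubspace U -> vsubspace W -> vsubspace (U `&` W).
Proof. by move=> [? HU] [? HW]; split=> // a x y [? ?] [? ?]; split; auto. Qed.

Lemma vsubspaceT : vsubspace setT.
Proof. by []. Qed.

Definition spanned (u : nat -> X) : set X :=
  [set x | exists n c, x = comb u n c].

Lemma spanned_subspace u : vsubspace (spanned u).
Proof.
split; first by exists 0%N, (fun=> 0); rewrite comb0.
move=> a _ _ [n [c ->]] [m [d ->]].
rewrite -(comb_widen u c (leq_maxl n m)) -(comb_widen u d (leq_maxr n m)) -combP.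
by eexists _, _.
Qed.

Lemma spanned_mem u i : spanned u (u i).
Proof. by exists i.+1, (fun j => (j == i)%:R); rewrite comb_single. Qed.

Lemma spanned_min u U : vsubspace U -> (forall i, U (u i)) -> spanned u `<=` U.
Proof. by move=> sU H _ [n [c ->]]; exact: vsubspace_comb. Qed.

(* No finite subset of [U] spans [U] modulo [W]. *)
Definition infdim (U W : set X) : Prop :=
  forall n w, (forall i, (i < n)%N -> U (w i)) ->
    exists2 x, U x & forall c, ~ W (x - comb w n c).

Definition sumspan (W : set X) (w : nat -> X) (n : nat) : set X :=
  [set x | exists c, W (x - comb w n c)].

Lemma sumspan_subspace W w n : vsubspace W -> vsubspace (sumspan W w n).
Proof.
move=> sW; split; first by exists (fun=> 0); rewrite /comb big1 ?subrr; [case: sW|move=> *; rewrite scale0r].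
move=> a x y [c Wx] [d Wy]; exists (fun i => a * c i + d i).
by rewrite combP opprD addrACA -scalerBr; exact: sW.2.
Qed.

(** If some [u0] in [U] is congruent to [w] modulo [W], it is added to the given family. Otherwise
    no nonzero multiple of [w] is congruent to a vector of [U], and the new line has no effect on
    [U]. *)
Lemma infdim_add1 U W w : vsubspace U -> vsubspace W -> infdim U W ->
  infdim U [set x | exists b, W (x - b *: w)].
Proof.
move=> sU sW inf n u Uu.
have [[u0 Uu0 Wu0]|nw] := pselect (exists2 u0, U u0 & W (w - u0)).
  have [|x Ux Hx] := inf n.+1 (upd u n u0).
    move=> i; rewrite ltnS leq_eqVlt => /orP[/eqP->|ilt]; first by rewrite updE.
    by rewrite upd_lt//; exact: Uu.
  exists x => // c [b Hb]; apply: (Hx (upd c n b)).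
  rewrite comb_upd updE (@eq_comb _ u _ _ c); last by move=> i ilt; rewrite upd_lt.
  have -> : x - (comb u n c + b *: u0) = b *: (w - u0) + (x - comb u n c - b *: w).
    by rewrite scalerBr [RHS]addrC [RHS]addrA subrK opprD addrA.
  exact: sW.2.
have [x Ux Hx] := inf n u Uu; exists x => // c [b Hb].
have [b0|b0] := eqVneq b 0; first by apply: (Hx c); rewrite b0 scale0r subr0 in Hb.
apply: nw; exists (b^-1 *: (x - comb u n c)).
  by apply: vsubspaceZ => //; apply: vsubspaceB => //; exact: vsubspace_comb.
rewrite -[w in w - _](scalerK b0) -scalerBr; apply: vsubspaceZ => //.
by rewrite -opprB; exact: vsubspaceN.
Qed.

Lemma infdim_sumspan U W w n : vsubspace U -> vsubspace W -> infdim U W ->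
  infdim U (sumspan W w n).
Proof.
move=> sU sW inf; elim: n => [|n IH].
  move=> n u Uu; have [x Ux Hx] := inf n u Uu; exists x => // c [d].
  by rewrite comb0 subr0; exact: Hx.
move=> m u Uu; have [x Ux Hx] := infdim_add1 (w n) sU (sumspan_subspace w n sW) IH Uu.
exists x => // c [d Hd]; apply: (Hx c); exists (d n), d.
by rewrite -addrA -opprD [d n *: _ + _]addrC -combS.
Qed.

(** The family lies in [U'] and perhaps not in [U], so it is moved into the denominator. *)
Lemma infdim_sub U U' W : vsubspace U -> vsubspace W -> U `<=` U' ->
  infdim U W -> infdim U' W.
Proof.
move=> sU sW UU' inf n w Uw.
have [|x Ux Hx] := infdim_sumspan w n sU sW inf (n := 0%N) (w := fun=> 0) => //.
exists x; first exact: UU'.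
by move=> c Wc; apply: (Hx (fun=> 0)); exists c; rewrite comb0 subr0.
Qed.

(** If a vector [x] outside [sumspan W w n] has [f x] nonzero, a second vector, outside that space
    enlarged by [x], is corrected by a multiple of [x]. *)
Lemma infdim_ker U W (f : X -> K^o) : vsubspace U -> vsubspace W ->
  linear_map f -> infdim U W -> infdim (U `&` [set x | f x = 0]) W.
Proof.
move=> sU sW lf inf n w Uw.
have inf' := infdim_sumspan w n sU sW inf.
have sW' := sumspan_subspace w n sW.
have [|x Ux Hx] := inf' 0%N (fun=> 0) => //.
have {}Hx : ~ sumspan W w n x by move=> H; apply: (Hx (fun=> 0)); rewrite comb0 subr0.
have [fx|fx] := eqVneq (f x) 0.
  by exists x => // c Hc; apply: Hx; exists c.
have [|y Uy Hy] := inf' 1%N (fun=> x) => //.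
exists (y - (f y / f x) *: x).
  split; first by apply: vsubspaceB => //; exact: vsubspaceZ.
  by rewrite /= lmB// lmZ// -[_ *: f x]/(_ * f x) divfK// subrr.
move=> c Hc; apply: (Hy (fun=> f y / f x)).
by rewrite combS comb0 add0r; exists c.
Qed.

Lemma infdim_kers U W n (f : nat -> X -> K^o) : vsubspace U -> vsubspace W ->
  (forall i, (i < n)%N -> linear_map (f i)) -> infdim U W ->
  infdim (U `&` [set x | forall i, (i < n)%N -> f i x = 0]) W.
Proof.
move=> sU sW; elim: n => [|n IH] lf inf.
  have -> : [set x : X | forall i, (i < 0)%N -> f i x = 0] = setT.
    by apply/seteqP; split.
  by rewrite setIT.
have sk : vsubspace [set x : X | forall i, (i < n)%N -> f i x = 0].
  split=> [i ilt|a x y Hx Hy i ilt] /=; first by rewrite lm0//; apply: lf; rewrite ltnW.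
  by rewrite (lf i (ltnW ilt)) Hx// Hy// scaler0 addr0.
have := infdim_ker (vsubspaceI sU sk) sW (lf n (ltnSn n))
  (IH (fun i ilt => lf i (ltnW ilt)) inf).
congr infdim; rewrite -setIA; congr (_ `&` _); apply/seteqP; split.
  move=> x [H fn] i; rewrite ltnS leq_eqVlt => /orP[/eqP->//|]; exact: H.
by move=> x H; split=> [i ilt|]; apply: H => //; rewrite ltnW.
Qed.

Lemma kernel_vector n (M : nat -> nat -> K) :
  exists c : nat -> K, (exists2 i, (i <= n)%N & c i != 0) /\
    forall j, (j < n)%N -> \sum_(i < n.+1) c i * M i j = 0.
Proof.
pose A : 'M[K]_(n.+1, n) := \matrix_(i, j) M i j.
have : kermx A != 0.
  rewrite kermx_eq0 /row_free; apply/eqP => rk.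
  by have := rank_leq_col A; rewrite rk ltnn.
case/rowV0Pn => v /sub_kermxP vA /rV0Pn [i vi].
exists (fun k => v 0 (inord k)); split.
  by exists i; [rewrite -ltnS|rewrite inord_val].
move=> j jn; have /rowP/(_ (Ordinal jn)) := vA; rewrite !mxE => vj.
by rewrite -[RHS]vj; apply: eq_bigr => k _; rewrite !mxE inord_val.
Qed.

End Comb.

Section Functionals.
Variables (R : realType) (K : numFieldType) (V : valuation R K).
Variables (X : lmodType K).
Implicit Types (p q : X -> R) (f g : X -> K^o).

Definition bounded_by q f : Prop :=
  linear_map f /\ exists C, forall x, abs V (f x) <= C * q x.

Lemma bounded_by_ker q f x : bounded_by q f -> q x = 0 -> f x = 0.
Proof.
move=> [_ [C H]] x0; have := H x; rewrite x0 mulr0 => H'.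
by apply/eqP; rewrite -(abs_eq0 V); apply/eqP/le_anti; rewrite H' abs_ge0.
Qed.

Lemma bounded_by_combP q a f g : bounded_by q f -> bounded_by q g ->
  bounded_by q (fun x => a * f x + g x).
Proof.
move=> [lf [C HC]] [lg [D HD]]; split.
  move=> b x y; rewrite lf lg; rewrite -![_ *: _]/(_ * _); ring.
exists (abs V a * C + D) => x; apply: (le_trans (absD _ _ _)).
rewrite absM mulrDl lerD// -mulrA ler_wpM2l ?abs_ge0//.
Qed.

Lemma bounded_by0 q : bounded_by q (fun=> 0).
Proof.
split; first by move=> a x y; rewrite scaler0 addr0.
by exists 0 => x; rewrite abs0 mul0r.
Qed.

Lemma bounded_by_sum q n (c : nat -> K) (f : nat -> X -> K^o) :
  (forall i, (i < n)%N -> bounded_by q (f i)) ->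
  bounded_by q (fun x => \sum_(i < n) c i * f i x).
Proof.
elim: n => [|n IH] H.
  by rewrite (_ : (fun x => _) = fun=> 0) ?funeqE => [|x];
    [exact: bounded_by0|rewrite big_ord0].
rewrite (_ : (fun x => _) = fun x => c n * f n x + \sum_(i < n) c i * f i x).
  by apply: bounded_by_combP; [exact: H|apply: IH => i ilt; exact/H/ltnW].
by rewrite funeqE => x; rewrite big_ord_recr/= addrC.
Qed.

Lemma bounded_by_le q q' f : real_seminorm (abs V) q -> (forall x, q x <= q' x) ->
  bounded_by q f -> bounded_by q' f.
Proof.
move=> qs qq' [lf [C H]]; split=> //; exists `|C| => x.
apply: (le_trans (H x)); apply: (@le_trans _ _ (`|C| * q x)).
  by apply: ler_wpM2r; [exact: sn_ge0 qs _|exact: ler_norm].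
by rewrite ler_wpM2l.
Qed.

(** The induction reduces to the Hahn-Banach theorem for a single vector. If [u n] is a combination
    of the earlier vectors modulo the kernel of [q], a bounded functional that kills those kills
    [u n] as well. *)
Lemma separation q n (u : nat -> X) e : real_seminorm (abs V) q ->
  (forall c, q (e - comb u n c) != 0) ->
  exists f, [/\ bounded_by q f, forall i, (i < n)%N -> f (u i) = 0 & f e = 1].
Proof.
move=> qs; elim: n e => [|n IH] e He.
  have qe : q e != 0 by have := He (fun=> 0); rewrite comb0 subr0.
  have [f [lf fq fe]] := hahn_banach qs qe.
  exists (fun x => (f e)^-1 * f x); split=> //; last by rewrite mulVf.
  rewrite (_ : (fun x => _) = fun x => (f e)^-1 * f x + 0); last first.
    by rewrite funeqE => x; rewrite addr0.
  apply: bounded_by_combP; last exact: bounded_by0.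
  by split=> //; exists 1 => x; rewrite mul1r.
have [[c Hc]|H] := pselect (exists c, q (u n - comb u n c) = 0).
  have [c'|f [bf fu fe]] := IH e.
    by have := He (upd c' n 0); rewrite comb_upd scale0r addr0.
  exists f; split=> // i; rewrite ltnS leq_eqVlt => /orP[/eqP->|]; last exact: fu.
  rewrite -[u n](subrK (comb u n c)) lmD ?(bounded_by_ker bf Hc) ?add0r; last exact: bf.1.
  by rewrite lm_comb; [rewrite big1// => j _; rewrite fu// scaler0|exact: bf.1].
have [c|f1 [bf1 f1u f1e]] := IH (u n).
  by apply/eqP => Hc; apply: H; exists c.
have [c|f2 [bf2 f2u f2e]] := IH (e - f1 e *: u n).
  by have := He (upd c n (f1 e)); rewrite comb_upd opprD addrA addrAC.
(* As [f1 (u n) = 1], this kills [u n]; its value at [e] is that of [f2] at [e - f1 e *: u n]. *)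
exists (fun x => - f2 (u n) * f1 x + f2 x); split.
- exact: bounded_by_combP.
- move=> i; rewrite ltnS leq_eqVlt => /orP[/eqP->|ilt].
    by rewrite f1e mulr1 addNr.
  by rewrite (f1u i ilt) (f2u i ilt) mulr0 addr0.
- rewrite -f2e (lmB bf2.1) (lmZ bf2.1).
  by rewrite -[_ *: f2 _]/(_ * _); ring.
Qed.

Definition independent_mod q (w : nat -> X) (n : nat) : Prop :=
  forall c, q (comb w n c) = 0 -> forall i, (i < n)%N -> c i = 0.

(** [w j] is separated from the family in which it is replaced by [0], which keeps the indices in
    place. *)
Lemma biorthogonal q w n : real_seminorm (abs V) q -> independent_mod q w n ->
  forall j, (j < n)%N -> exists2 f, bounded_by q f &
    forall i, (i < n)%N -> f (w i) = (i == j)%:R.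
Proof.
move=> qs ind j jn; have [c|f [bf fu fe]] := separation (n := n) (u := upd w j 0) (e := w j) qs.
  apply/eqP => H.
  have E : w j - comb (upd w j 0) n c = comb w n (upd (fun i => - c i) j 1).
    rewrite -{1}(comb_single w jn) /comb -sumrB; apply: eq_bigr => i _.
    by rewrite /upd; case: eqP => [->|_];
      rewrite ?scaler0 ?subr0// scale0r sub0r scaleNr.
  have := ind (upd (fun i => - c i) j 1); rewrite -E => /(_ H j jn)/eqP.
  by rewrite updE oner_eq0.
exists f => // i ilt; have [->//|ij] := eqVneq i j.
by have := fu i ilt; rewrite /upd (negbTE ij).
Qed.

End Functionals.

(** * Perturbations of the identity exchanging dense subspaces *)

Section Graded.
Variables (R : realType) (K : numFieldType) (V : valuation R K).
Variables (X : lmodType K) (P : nat -> X -> R).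

Record graded : Prop := Graded {
  graded_sn : forall n, real_seminorm (abs V) (P n);
  graded_leS : forall n x, P n x <= P n.+1 x;
  graded_sep : forall x, (forall n, P n x = 0) -> x = 0;
  graded_complete : forall s : nat -> X,
    (forall n e, 0 < e -> exists N, forall i j, (N <= i)%N -> (N <= j)%N ->
       P n (s i - s j) < e) ->
    exists x, forall n e, 0 < e -> exists N, forall i, (N <= i)%N ->
       P n (s i - x) < e }.

Definition adherent (E : set X) : set X :=
  [set x | forall n e, 0 < e -> exists2 y, E y & P n (x - y) < e].

Definition bounded_on (E : set X) (T : X -> X) : Prop :=
  forall n, exists k C, forall x, E x -> P n (T x) <= C * P k x.

Definition lin_on (E : set X) (T : X -> X) : Prop :=
  forall a x y, E x -> E y -> T (a *: x + y) = a *: T x + T y.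

Definition isomorphic (E F : set X) : Prop :=
  exists T S : X -> X,
    [/\ lin_on E T,
        forall x, E x -> F (T x) /\ S (T x) = x,
        forall y, F y -> E (S y) /\ T (S y) = y,
        bounded_on E T & bounded_on F S].

Hypothesis GP : graded.

Lemma graded_le n m x : (n <= m)%N -> P n x <= P m x.
Proof.
move=> /subnK <-; elim: (m - n)%N => // k IH.
exact: le_trans IH (graded_leS GP _ _).
Qed.

Lemma graded_ker n m x : (n <= m)%N -> P m x = 0 -> P n x = 0.
Proof.
move=> nm x0; apply/le_anti; rewrite (sn_ge0 (graded_sn GP n)) andbT -x0.
exact: graded_le.
Qed.

Lemma isomorphic_sym E F : vsubspace E -> isomorphic E F -> isomorphic F E.
Proof.
move=> sE [T [S [lT TS ST bT bS]]]; exists S, T; split=> // a x y Fx Fy.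
have [Ex Tx] := ST _ Fx; have [Ey Ty] := ST _ Fy.
have Exy := sE.2 a _ _ Ex Ey.
by have [_ <-] := TS _ Exy; rewrite lT// Tx Ty.
Qed.

Lemma isomorphic_trans E F G : isomorphic E F -> isomorphic F G -> isomorphic E G.
Proof.
move=> [T [S [lT TS ST bT bS]]] [T' [S' [lT' TS' ST' bT' bS']]].
have bc (A B : set X) U W : (forall x, A x -> B (U x)) -> bounded_on A U ->
    bounded_on B W -> bounded_on A (W \o U).
  move=> AB bU bW n; have [k [C HC]] := bW n; have [l [D HD]] := bU k.
  exists l, (`|C| * D) => x Ax /=; apply: (le_trans (HC _ (AB _ Ax))).
  apply: (@le_trans _ _ (`|C| * P k (U x))).
    by apply: ler_wpM2r; [exact: sn_ge0 (graded_sn GP k) _|exact: ler_norm].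
  by rewrite -mulrA ler_wpM2l// HD.
exists (T' \o T), (S \o S'); split.
- move=> a x y Ex Ey /=; rewrite lT// lT'//; first by have [] := TS x Ex.
  by have [] := TS y Ey.
- move=> x Ex /=; have [Fx xE] := TS x Ex; have [Gx ->] := TS' _ Fx.
  by split.
- move=> x Gx /=; have [Fx xE] := ST' x Gx; have [Ex ->] := ST _ Fx.
  by split.
- by apply: bc bT' => // x /TS[].
- by apply: bc bS => // x /ST'[].
Qed.

End Graded.

Lemma ler_sum_widen (R : realType) (F : nat -> R) n m :
  (forall i, 0 <= F i) -> (n <= m)%N -> \sum_(i < n) F i <= \sum_(i < m) F i.
Proof.
move=> F0 /subnK <-; elim: (m - n)%N => // k IH.
by apply: (le_trans IH); rewrite addSn big_ord_recr/= lerDl.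
Qed.

Section Perturbation.
Variables (R : realType) (K : numFieldType) (V : valuation R K).
Variables (X : lmodType K) (P : nat -> X -> R).
Hypothesis GP : graded V P.
Variables (p : X -> R) (k0 : nat).
Hypothesis ps : real_seminorm (abs V) p.
Hypothesis pP : forall x, p x <= P k0 x.
Variables (E F : set X) (e g : nat -> X).
Hypothesis sE : vsubspace E.
Hypothesis sF : vsubspace F.
Hypothesis Ee : E = spanned e.
Hypothesis Fg : F = spanned g.
Hypothesis dE : forall x, adherent P E x.
Hypothesis dF : forall x, adherent P F x.
Hypothesis EF : forall x, p x = 0 -> E x <-> F x.

Record entry := Entry { ent_u : X; ent_v : X; ent_f : X -> K^o; ent_x : X }.
Implicit Types h : nat -> entry.

Definition perturb h (n : nat) (z : X) : X :=
  z + \sum_(i < n) ent_f (h i) z *: ent_x (h i).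

(* Even steps [n] treat the next vector of the basis [e] of [E], odd steps the
   next vector of the basis [g] of [F]. *)
Definition good_entry (n : nat) h : Prop :=
  [/\ E (ent_u (h n)), F (ent_v (h n)),
      linear_map (ent_f (h n)) /\ forall z, abs V (ent_f (h n) z) <= p z,
      P (n + k0)%N (ent_x (h n)) <= 2^-1 ^+ n.+2 &
      [/\ forall j, (j < n)%N -> ent_f (h n) (ent_u (h j)) = 0,
          perturb h n.+1 (ent_u (h n)) = ent_v (h n) &
          if odd n then ent_v (h n) = g n./2 else ent_u (h n) = e n./2]].

Lemma perturbS h n z :
  perturb h n.+1 z = perturb h n z + ent_f (h n) z *: ent_x (h n).
Proof. by rewrite /perturb big_ord_recr/= addrA. Qed.

Lemma perturb_upd h n t z : perturb (upd h n t) n z = perturb h n z.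
Proof.
rewrite /perturb; congr (_ + _); apply: eq_bigr => i _.
by rewrite upd_lt.
Qed.

Lemma perturb_const_ge0 h m : 0 <= \sum_(i < m) P m (ent_x (h i)) + 2^-1.
Proof.
apply: addr_ge0; last by rewrite invr_ge0.
by apply: sumr_ge0 => i _; exact: (sn_ge0 (graded_sn GP _)).
Qed.

Section Finite.
Variables (h : nat -> entry) (n : nat).
Hypothesis H : forall i, (i < n)%N -> good_entry i h.

Lemma perturb_linear : linear_map (perturb h n).
Proof.
move=> a x y; rewrite /perturb scalerDr addrACA; congr (_ + _).
rewrite scaler_sumr -big_split/=; apply: eq_bigr => i _.
have [_ _ [lf _] _ _] := H (ltn_ord i).
by rewrite lf scalerDl -[a *: ent_f _ x]/(a * _) scalerA.
Qed.

Lemma geom_half m : \sum_(i < m) (2^-1 : R) ^+ i.+2 = 2^-1 - 2^-1 ^+ m.+1.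
Proof.
elim: m => [|m IH]; first by rewrite big_ord0 expr1 subrr.
by rewrite big_ord_recr/= IH [_ ^+ m.+2]exprS; lra.
Qed.

Lemma half_exp_ge0 m : 0 <= (2^-1 : R) ^+ m.
Proof. by rewrite exprn_ge0// invr_ge0. Qed.

Lemma perturb_dist (q : X -> R) z : real_seminorm (abs V) q ->
  q (perturb h n z - z) <= (\sum_(i < n) q (ent_x (h i))) * p z.
Proof.
move=> qs; rewrite /perturb addrC addKr mulr_suml.
apply: (le_trans (sn_sum qs n (fun i => ent_f (h i) z *: ent_x (h i)))).
apply: ler_sum => i _; rewrite qs.2 mulrC ler_wpM2l ?(sn_ge0 qs)//.
by have [_ _ [_ ->]] := H (ltn_ord i).
Qed.

(** The bounds [2^-1 ^+ i.+2] add up to less than 1/2; the shift by [k0] in [good_entry] lets [p]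
    use them from the first index on. *)
Lemma perturb_p z : p (perturb h n z - z) <= 2^-1 * p z.
Proof.
apply: (le_trans (perturb_dist z ps)); rewrite ler_wpM2r ?(sn_ge0 ps)//.
apply: (@le_trans _ _ (\sum_(i < n) (2^-1 : R) ^+ i.+2)).
  apply: ler_sum => i _; have [_ _ _ xi _] := H (ltn_ord i).
  apply: le_trans xi; apply: (le_trans (pP _)).
  by apply: (graded_le GP); rewrite leq_addl.
by rewrite geom_half lerBlDr lerDl half_exp_ge0.
Qed.

(** From the index [m] on, [P m] is dominated by the seminorm that controls the entry, so the bound
    is uniform in [n]. *)
Lemma perturb_sum_bound m : \sum_(i < n) P m (ent_x (h i)) <=
  \sum_(i < m) P m (ent_x (h i)) + 2^-1.
Proof.
have ge0 x := sn_ge0 (graded_sn GP m) x.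
suff A : forall j, (j <= n)%N -> \sum_(i < j) P m (ent_x (h i)) <=
    \sum_(i < m) P m (ent_x (h i)) + (2^-1 - 2^-1 ^+ j.+1).
  apply: (le_trans (A n (leqnn n))).
  by rewrite lerD2l lerBlDr lerDl half_exp_ge0.
elim=> [_|j IH jn].
  by rewrite big_ord0 expr1 subrr addr0 sumr_ge0.
have half_le k : (2^-1 : R) ^+ k.+1 <= 2^-1.
  by rewrite exprS; have : (2^-1 : R) ^+ k <= 1 by [apply: exprn_ile1; lra]; lra.
have [jm|mj] := leqP j.+1 m.
  apply: (le_trans (ler_sum_widen (F := fun i => P m (ent_x (h i))) _ jm)) => //.
  by rewrite lerDl subr_ge0.
rewrite big_ord_recr/=.
apply: (le_trans (lerD (IH (ltnW jn)) (lexx _))).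
have [_ _ _ xj _] := H jn.
have : P m (ent_x (h j)) <= 2^-1 ^+ j.+2.
  apply: le_trans xj; apply: (graded_le GP).
  exact: leq_trans (mj : (m <= j)%N) (leq_addr _ _).
by rewrite [_ ^+ j.+2]exprS; lra.
Qed.

Lemma perturb_P m z : P m (perturb h n z - z) <=
  (\sum_(i < m) P m (ent_x (h i)) + 2^-1) * p z.
Proof.
apply: (le_trans (perturb_dist z (graded_sn GP m))).
by rewrite ler_wpM2r ?(sn_ge0 ps)// perturb_sum_bound.
Qed.

Lemma perturb_ker z : p z = 0 -> perturb h n z = z.
Proof.
move=> z0; rewrite /perturb big1 ?addr0// => i _.
have [_ _ [lf bf] _ _] := H (ltn_ord i).
rewrite (@bounded_by_ker _ _ V _ p _ z) ?scale0r//.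
by split=> //; exists 1 => y; rewrite mul1r.
Qed.

Lemma perturb_p_ge z : p z <= 2 * p (perturb h n z).
Proof.
have := sn_dist ps (perturb h n z) z 0.
by rewrite !subr0 (snC ps); have := perturb_p z; lra.
Qed.

(** The lower bound only gives [p z = 0]; but on the kernel of [p] the operator is the identity. *)
Lemma perturb_inj z : perturb h n z = 0 -> z = 0.
Proof.
move=> Tz; rewrite -(perturb_ker (z := z))//; apply/le_anti.
by rewrite (sn_ge0 ps) andbT; have := perturb_p_ge z; rewrite Tz (sn0 ps) mulr0.
Qed.

End Finite.

Lemma perturb_uv h n i : (forall i, (i < n)%N -> good_entry i h) -> (i < n)%N ->
  perturb h n (ent_u (h i)) = ent_v (h i).
Proof.
elim: n => // n IH H; rewrite ltnS leq_eqVlt => /orP[/eqP->|ilt].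
  by have [_ _ _ _ []] := H n (ltnSn n).
rewrite perturbS IH//; last by move=> j jn; apply: H; rewrite ltnW.
by have [_ _ _ _ [-> // _ _]] := H n (ltnSn n); rewrite scale0r addr0.
Qed.

(** One rank-one term at a time. If [y] is a preimage of the new vector, the equation is solved by
    dividing by [1 + f y]; were this zero, [y] would lie in the kernel of the next operator, hence
    vanish. *)
Lemma perturb_surj h n w : (forall i, (i < n)%N -> good_entry i h) ->
  exists z, perturb h n z = w.
Proof.
elim: n w => [|n IH] w H; first by exists w; rewrite /perturb big_ord0 addr0.
have H' i : (i < n)%N -> good_entry i h by move=> ilt; apply: H; rewrite ltnW.
have lT := perturb_linear H'.
have [z zw] := IH w H'; have [y yx] := IH (ent_x (h n)) H'.
have [_ _ [lf _] _ _] := H n (ltnSn n).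
set f := ent_f (h n) in lf *.
have fy : 1 + f y != 0.
  apply/eqP => fy; have y0 : y = 0.
    apply: (perturb_inj H); rewrite perturbS yx -[X in X + _]scale1r -scalerDl.
    by rewrite -/f fy scale0r.
  by move: fy; rewrite y0 (lm0 lf) addr0 => /eqP; rewrite oner_eq0.
pose t : K := f z / (1 + f y).
have tE : - t + (f z - t * f y) = 0.
  by rewrite /t; move: (f z : K) (f y : K) fy => a b b1; field.
exists (z - t *: y); rewrite perturbS (lmB lT) (lmZ lT) zw yx -/f (lmB lf) (lmZ lf).
by rewrite -addrA -scaleNr -scalerDl -[t *: f y]/(t * f y) tE scale0r addr0.
Qed.

(** Rescaled so that the bound has constant 1, at the price of the normalisation at [z]. *)
Lemma separation_le q n (u : nat -> X) z : real_seminorm (abs V) q ->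
  (forall c, q (z - comb u n c) != 0) ->
  exists f : X -> K^o, [/\ linear_map f, forall x, abs V (f x) <= q x,
    forall i, (i < n)%N -> f (u i) = 0 & f z != 0].
Proof.
move=> qs Hz; have [f [[lf [C bf]] fu fz]] := separation qs Hz.
have C0 : 0 < `|C| + 1 by rewrite ltr_wpDl.
pose a := emb V (`|C| + 1)^-1.
have a0 : a != 0 by rewrite fmorph_eq0 invr_eq0 gt_eqF.
exists (fun x => a * f x); split.
- by move=> b x y; rewrite lf -![_ *: _]/(_ * _); ring.
- move=> x; rewrite absM /a abs_emb ?invr_ge0 ?(ltW C0)// ler_pdivrMl//.
  apply: (le_trans (bf x)); rewrite ler_wpM2r ?(sn_ge0 qs)//.
  by rewrite (le_trans (ler_norm C))// lerDl.
- by move=> i ilt; rewrite fu// mulr0.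
- by rewrite fz mulr1.
Qed.

Lemma good_entry_ext h n u v (f : X -> K^o) : (forall i, (i < n)%N -> good_entry i h) ->
  E u -> F v -> linear_map f -> (forall z, abs V (f z) <= p z) ->
  (forall j, (j < n)%N -> f (ent_u (h j)) = 0) ->
  (f u = 0 -> perturb h n u = v) ->
  P (n + k0)%N (v - perturb h n u) <= abs V (f u) * 2^-1 ^+ n.+2 ->
  (if odd n then v = g n./2 else u = e n./2) ->
  exists t, good_entry n (upd h n t).
Proof.
move=> H Eu Fv lf fp fu Tu small task.
(* The only vector that sends [u] to [v]. When [f u = 0], the convention on inverses makes it
   [0]. *)
exists (Entry u v f ((f u)^-1 *: (v - perturb h n u))); rewrite /good_entry updE/=.
split=> //.
- rewrite (graded_sn GP _).2 absV.
  have [->|fu0] := eqVneq (f u) 0; first by rewrite abs0 invr0 mul0r half_exp_ge0.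
  by rewrite ler_pdivrMl ?abs_gt0.
- split=> //; first by move=> j jn; rewrite upd_lt//; exact: fu.
  rewrite perturbS perturb_upd updE/=.
  have [fu0|fu0] := eqVneq (f u) 0; first by rewrite fu0 scale0r addr0 Tu.
  by rewrite scalerA divff// scale1r addrC subrK.
Qed.

Lemma good_entry_loc n h h' : (forall i, (i <= n)%N -> h i = h' i) ->
  good_entry n h -> good_entry n h'.
Proof.
move=> hh' [Eu Fv lf xn [fu Tu task]]; rewrite /good_entry -(hh' n)//.
split=> //; split=> // [j jn|].
  by rewrite -(hh' j) ?(ltnW jn)//; exact: fu.
rewrite -Tu /perturb; congr (_ + _); apply: eq_bigr => i _.
by rewrite (hh' i (ltn_ord i)).
Qed.

Lemma good_entry_step n h : (forall i, (i < n)%N -> good_entry i h) ->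
  exists t, good_entry n (upd h n t).
Proof.
move=> H; have lT := perturb_linear H.
pose us i := ent_u (h i); pose vs i := ent_v (h i).
have Tuv c : perturb h n (comb us n c) = comb vs n c.
  rewrite lm_comb//; apply: eq_bigr => i _.
  by rewrite (perturb_uv H (ltn_ord i)).
have Fvs c : F (comb vs n c).
  by apply: vsubspace_comb => // i ilt; have [] := H i ilt.
have Eus c : E (comb us n c).
  by apply: vsubspace_comb => // i ilt; have [] := H i ilt.
have ext0 u v : E u -> F v -> perturb h n u = v ->
    (if odd n then v = g n./2 else u = e n./2) -> exists t, good_entry n (upd h n t).
  move=> Eu Fv uv task.
  apply: (good_entry_ext (u := u) (v := v) (f := fun=> 0)) => //.
  - exact: (bounded_by0 V p).1.
  - by move=> z; rewrite abs0 (sn_ge0 ps).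
  - by rewrite uv subrr (sn0 (graded_sn GP _)) abs0 mul0r.
have [on|on] := boolP (odd n).
  have Fv : F (g n./2) by rewrite Fg; exact: spanned_mem.
  have [[c Hc]|nc] := pselect (exists c, p (g n./2 - comb vs n c) = 0).
    (* The difference is in [F] and in the kernel of [p], hence in [E] by equality of the traces,
       and the operator fixes it. *)
    have Ez : E (g n./2 - comb vs n c) by apply/EF => //; apply: vsubspaceB.
    apply: (ext0 (comb us n c + (g n./2 - comb vs n c)) (g n./2)); rewrite ?on//.
      exact: vsubspaceD.
    by rewrite (lmD lT) Tuv (perturb_ker H Hc) addrC subrK.
  (* The preimage exists in [X] but may be outside [E]; a nearby [u] in [E] replaces it, and the new
     rank-one term absorbs the error. *)
  have [u' u'v] := perturb_surj (g n./2) H.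
  have [c|f [lf fp fu fu']] := separation_le (n := n) (u := us) (z := u') ps.
    apply/eqP => pc; apply: nc; exists c.
    by rewrite -pc -u'v -Tuv -(lmB lT) (perturb_ker H pc).
  pose C := \sum_(i < n + k0) P (n + k0)%N (ent_x (h i)) + 2^-1.
  have C0 : 0 <= C by exact: perturb_const_ge0.
  have C1 : 0 < 1 + C := ltr_pwDl ltr01 C0.
  pose a := abs V (f u').
  have a0 : 0 < a by exact: abs_gt0.
  pose b : R := 2^-1 ^+ n.+2.
  have b0 : 0 < b by rewrite exprn_gt0// invr_gt0.
  have b1 : b <= 1 by apply: exprn_ile1; lra.
  (* Close enough that [abs V (f u)] stays above [a / 2] and that the error, magnified by at most
     [1 + C], is below [a / 2 * b]. *)
  have eps0 : 0 < a / 2 * b / (1 + C).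
    by rewrite divr_gt0// mulr_gt0// divr_gt0.
  have [u Eu Hu] := dE u' (n + k0)%N eps0.
  have Hu' : (1 + C) * P (n + k0)%N (u' - u) <= a / 2 * b.
    by rewrite mulrC -ler_pdivlMr// ltW.
  have k0n x : P k0 x <= P (n + k0)%N x by apply: (graded_le GP); exact: leq_addl.
  have fu2 : a / 2 <= abs V (f u).
    have : a <= abs V (f u) + abs V (f (u' - u)).
      by apply: le_trans (absD _ _ _); rewrite -(lmD lf) addrC subrK.
    have : abs V (f (u' - u)) <= a / 2.
      apply: (le_trans (fp _)); apply: (le_trans (pP _)); apply: (le_trans (k0n _)).
      have P0 := sn_ge0 (graded_sn GP (n + k0)%N) (u' - u).
      have : a / 2 * b <= a / 2 by rewrite ler_piMr// divr_ge0// ltW.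
      by have := mulr_ge0 C0 P0; lra.
    lra.
  apply: (good_entry_ext (u := u) (v := g n./2) (f := f)); rewrite ?on//.
    by move=> fu0; move: fu2; rewrite fu0 abs0 leNgt divr_gt0.
  rewrite -u'v -(lmB lT).
  apply: (@le_trans _ _ ((1 + C) * P (n + k0)%N (u' - u))); last first.
    by apply: (le_trans Hu'); rewrite ler_wpM2r// ltW.
  have := sn_dist (graded_sn GP (n + k0)%N) (u' - u) (perturb h n (u' - u)) 0.
  rewrite !subr0 => /le_trans; apply; rewrite mulrDl mul1r addrC lerD2l.
  apply: (le_trans (perturb_P H _ _)); rewrite ler_wpM2l//.
  exact: le_trans (pP _) (k0n _).
have Eu : E (e n./2) by rewrite Ee; exact: spanned_mem.
have [[c Hc]|nc] := pselect (exists c, p (e n./2 - comb us n c) = 0).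
  have Fz : F (e n./2 - comb us n c) by apply/EF => //; apply: vsubspaceB.
  apply: (ext0 (e n./2) (comb vs n c + (e n./2 - comb us n c))); rewrite ?(negbTE on)//.
    exact: vsubspaceD.
  by rewrite -Tuv -[X in _ + X](perturb_ker H Hc) -(lmD lT) addrC subrK.
have [c|f [lf fp fu fu']] := separation_le (n := n) (u := us) (z := e n./2) ps.
  by apply/eqP => pc; apply: nc; exists c.
have eps0 : 0 < abs V (f (e n./2)) * 2^-1 ^+ n.+2.
  by rewrite mulr_gt0 ?abs_gt0// exprn_gt0// invr_gt0.
(* Here the vector of [E] is given and its image is the one to be approximated. *)
have [v Fv Hv] := dF (perturb h n (e n./2)) (n + k0)%N eps0.
apply: (good_entry_ext (u := e n./2) (v := v) (f := f)); rewrite ?(negbTE on)//.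
  by move=> fu0; rewrite fu0 eqxx in fu'.
by rewrite (snC (graded_sn GP _)) ltW.
Qed.

Theorem perturbation_isomorphic : isomorphic P E F.
Proof.
have [h Hh] := history_choice (Entry 0 0 (fun=> 0) 0) good_entry_loc good_entry_step.
have H n i : (i < n)%N -> good_entry i h by [].
have ue j : ent_u (h j.*2) = e j.
  by have [_ _ _ _ [_ _]] := Hh j.*2; rewrite odd_double half_double.
have vg j : ent_v (h j.*2.+1) = g j.
  by have [_ _ _ _ [_ _]] := Hh j.*2.+1; rewrite /= odd_double/= uphalf_double.
(* The first [n] basis vectors are treated at even steps below [n.*2], and later functionals kill
   them. So the operators are eventually constant on each vector of [E]. *)
have fE n c m : (n.*2 <= m)%N -> ent_f (h m) (comb e n c) = 0.
  move=> nm; have [_ _ [lf _] _ [fu _ _]] := Hh m.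
  rewrite lm_comb// big1// => i _; rewrite -ue fu ?scaler0//.
  by rewrite (leq_trans _ nm)// ltn_double.
have stable z : E z -> exists N, forall n, (N <= n)%N -> perturb h n z = perturb h N z.
  rewrite Ee => -[N [c ->]]; exists N.*2; elim=> [|n IH].
    by rewrite leqn0 => /eqP->.
  rewrite leq_eqVlt => /orP[/eqP->//|]; rewrite ltnS => Nn.
  by rewrite perturbS IH// fE// scale0r addr0.
have /choice[T HT] : forall z, exists y, E z ->
    exists N, forall n, (N <= n)%N -> perturb h n z = y.
  move=> z; have [Ez|nE] := pselect (E z); last by exists 0.
  by have [N HN] := stable z Ez; exists (perturb h N z) => _; exists N.
have lT : lin_on E T.
  move=> a x y Ex Ey; have [N1 H1] := HT _ Ex; have [N2 H2] := HT _ Ey.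
  have [N3 H3] := HT _ (sE.2 a _ _ Ex Ey).
  pose n := maxn N1 (maxn N2 N3).
  rewrite -(H1 n) ?leq_maxl// -(H2 n); last by rewrite /n maxnCA leq_maxl.
  by rewrite -(H3 n) ?(perturb_linear (H n))// /n maxnA leq_maxr.
have TF z : E z -> F (T z).
  move=> Ez; have [N HN] := HT z Ez; move: Ez HN; rewrite Ee => -[m [c ->]] HN.
  rewrite -(HN (maxn N m.*2)) ?leq_maxl// (lm_comb _ _ _ (perturb_linear (H _))).
  apply: (@vsubspace_comb _ _ F (fun i => perturb h (maxn N m.*2) (e i)) m c sF).
  move=> i im.
  rewrite -ue (perturb_uv (H _)); first by have [] := Hh i.*2.
  by rewrite (@leq_trans m.*2) ?ltn_double// leq_maxr.
have Tonto y : F y -> exists z, E z /\ T z = y.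
  rewrite Fg => -[m [c ->]]; pose u i := ent_u (h i.*2.+1).
  have Ez : E (comb u m c).
    by apply: vsubspace_comb => // i _; have [] := Hh i.*2.+1.
  exists (comb u m c); split=> //; have [N HN] := HT _ Ez.
  rewrite -(HN (maxn N m.*2)) ?leq_maxl// (lm_comb _ _ _ (perturb_linear (H _))).
  apply: eq_bigr => i _; rewrite (perturb_uv (H _)) ?vg//.
  by rewrite (@leq_trans m.*2) ?leq_maxr// -doubleS leq_double.
have Tinj z : E z -> T z = 0 -> z = 0.
  move=> Ez; have [N HN] := HT z Ez; rewrite -(HN N)//.
  exact: (@perturb_inj h N (H N) z).
have /choice[S HS] : forall y, exists z, F y -> E z /\ T z = y.
  move=> y; have [Fy|nF] := pselect (F y); last by exists 0.
  by have [z Hz] := Tonto y Fy; exists z.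
have dist m z : E z -> P m (T z - z) <=
    (\sum_(i < m) P m (ent_x (h i)) + 2^-1) * p z.
  by move=> Ez; have [N HN] := HT z Ez; rewrite -(HN N)//; exact: (@perturb_P h N (H N)).
have pT z : E z -> p z <= 2 * p (T z).
  by move=> Ez; have [N HN] := HT z Ez; rewrite -(HN N)//; exact: (@perturb_p_ge h N (H N)).
have Cge0 := perturb_const_ge0 h.
have pmax m z : p z <= P (maxn m k0) z.
  by apply: (le_trans (pP z)); apply: (graded_le GP); rewrite leq_maxr.
have Pmax m z : P m z <= P (maxn m k0) z by apply: (graded_le GP); rewrite leq_maxl.
exists T, S; split=> //.
- move=> x Ex; split; first exact: TF.
  have [ESx TSx] := HS _ (TF _ Ex).
  apply/eqP; rewrite -subr_eq0; apply/eqP/Tinj; first exact: vsubspaceB.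
  by rewrite -scaleN1r addrC lT// TSx scaleN1r addNr.
- move=> m; exists (maxn m k0), (1 + (\sum_(i < m) P m (ent_x (h i)) + 2^-1)) => x Ex.
  have := sn_dist (graded_sn GP m) x (T x) 0; rewrite !subr0 => /le_trans; apply.
  rewrite mulrDl mul1r addrC lerD//; apply: (le_trans (dist m x Ex)).
  by rewrite ler_wpM2l.
- move=> m; exists (maxn m k0), (1 + (\sum_(i < m) P m (ent_x (h i)) + 2^-1) * 2) => y Fy.
  have [Ez <-] := HS y Fy; have -> : S (T (S y)) = S y by have [_ ->] := HS y Fy.
  set z := S y in Ez *.
  have := sn_dist (graded_sn GP m) (T z) z 0; rewrite !subr0 => /le_trans; apply.
  rewrite mulrDl mul1r addrC lerD// (snC (graded_sn GP m)).
  apply: (le_trans (dist m z Ez)); rewrite -mulrA ler_wpM2l//.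
  by apply: (le_trans (pT z Ez)); rewrite ler_wpM2l.
Qed.

End Perturbation.

(** * Coordinates on kernels isomorphic to a product of lines *)

Lemma enum_infinite (A : set nat) : (forall n, exists2 m, (n <= m)%N & A m) ->
  exists s : nat -> nat, [/\ injective s, forall j, A (s j) &
    forall i, A i -> exists j, s j = i].
Proof.
move=> Ainf.
have infA : infinite_set A.
  move=> /finite_seqP[l Al]; have [m + Am] := Ainf (\max_(i <- l) i).+1.
  rewrite leqNgt => /negP; apply; rewrite ltnS.
  by rewrite leq_bigmax_seq//; move: Am; rewrite Al.
have : ([set: nat] #= A)%card by rewrite card_eq_sym; apply: eq_card_nat.
move=> /card_set_bijP[s [sA sinj ssurj]]; exists s; split.
- by move=> i j ij; apply: sinj => //; rewrite in_setT.
- by move=> j; exact: sA.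
- by move=> i /ssurj[j _ <-]; exists j.
Qed.

Lemma injective_escape (s : nat -> nat) n : injective s ->
  exists J, forall j, (J <= j)%N -> (n <= s j)%N.
Proof.
move=> sinj; elim: n => [|n [J HJ]]; first by exists 0%N.
have [[i si]|nsi] := pselect (exists i, s i = n); last first.
  exists J => j Jj; rewrite ltn_neqAle HJ// andbT.
  by apply/eqP => nj; apply: nsi; exists j.
exists (maxn J i.+1) => j; rewrite geq_max => /andP[Jj ij].
rewrite ltn_neqAle HJ// andbT -si; apply/eqP => /sinj ij'.
by rewrite ij' ltnn in ij.
Qed.

Lemma bounded_preimage (A : set nat) (s : nat -> nat) M :
  (forall i, A i -> exists j, s j = i) ->
  exists J, forall i, (i < M)%N -> A i -> exists2 j, (j < J)%N & s j = i.
Proof.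
move=> surj; elim: M => [|M [J HJ]]; first by exists 0%N.
have [AM|nA] := pselect (A M); last first.
  exists J => i; rewrite ltnS leq_eqVlt => /orP[/eqP->|]; [by []|exact: HJ].
have [j sj] := surj _ AM; exists (maxn J j.+1) => i.
rewrite ltnS leq_eqVlt => /orP[/eqP-> _|iM Ai].
  by exists j => //; rewrite leq_maxr.
by have [l lJ sl] := HJ i iM Ai; exists l => //; rewrite leq_max lJ.
Qed.

Section Series.
Variables (R : realType) (K : numFieldType) (V : valuation R K).
Variables (X : lmodType K) (P : nat -> X -> R).
Hypothesis GP : graded V P.

Definition continuous_form (f : X -> K^o) : Prop :=
  exists k, bounded_by V (P k) f.

Lemma continuous_form_combP a f g : continuous_form f -> continuous_form g ->
  continuous_form (fun x => a * f x + g x).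
Proof.
move=> [k bf] [l bg]; exists (maxn k l); apply: bounded_by_combP.
  apply: (bounded_by_le (graded_sn GP k) _ bf) => x.
  by apply: (graded_le GP); rewrite leq_maxl.
apply: (bounded_by_le (graded_sn GP l) _ bg) => x.
by apply: (graded_le GP); rewrite leq_maxr.
Qed.

Lemma continuous_forms_bound (f : nat -> X -> K^o) n :
  (forall i, (i < n)%N -> continuous_form (f i)) ->
  exists k, forall i, (i < n)%N -> bounded_by V (P k) (f i).
Proof.
elim: n => [|n IH] cf; first by exists 0%N.
have [k Hk] := IH (fun i ilt => cf i (ltnW ilt)).
have [l Hl] := cf n (ltnSn n); exists (maxn k l) => i.
rewrite ltnS leq_eqVlt => /orP[/eqP->|ilt].
  apply: (bounded_by_le (graded_sn GP l) _ Hl) => x.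
  by apply: (graded_le GP); rewrite leq_maxr.
apply: (bounded_by_le (graded_sn GP k) _ (Hk i ilt)) => x.
by apply: (graded_le GP); rewrite leq_maxl.
Qed.

Lemma continuous_form_sum n (c : nat -> K) (f : nat -> X -> K^o) :
  (forall i, (i < n)%N -> continuous_form (f i)) ->
  continuous_form (fun x => \sum_(i < n) c i * f i x).
Proof.
move=> cf; have [k Hk] := continuous_forms_bound cf.
by exists k; exact: bounded_by_sum.
Qed.

Lemma continuous_form0 : continuous_form (fun=> 0).
Proof. by exists 0%N; exact: bounded_by0. Qed.

Lemma continuous_form_adherent (f : X -> K^o) (A : set X) x : continuous_form f ->
  (forall y, A y -> f y = 0) -> adherent P A x -> f x = 0.
Proof.
move=> [k [lf [C HC]]] fA adx; apply/eqP; apply: contraT => fx.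
have C0 : 0 < `|C| + 1 by rewrite ltr_wpDl.
have e0 : 0 < abs V (f x) / (`|C| + 1) by rewrite divr_gt0// abs_gt0.
have [y Ay] := adx k _ e0; rewrite ltr_pdivlMr// => xy.
have := HC (x - y); rewrite lmB// (fA y Ay) subr0.
have := sn_ge0 (graded_sn GP k) (x - y); have := ler_norm C.
by move: (P k (x - y)) (abs V (f x)) xy => a b; nra.
Qed.

(** Far stronger than convergence to zero: series along such a sequence converge for arbitrary
    coefficients, as in a product of lines. *)
Definition null_seq (v : nat -> X) : Prop :=
  forall k, exists J, forall j, (J <= j)%N -> P k (v j) = 0.

Definition sums_to (v : nat -> X) (c : nat -> K) (s : X) : Prop :=
  forall k, exists J, forall n, (J <= n)%N -> P k (s - comb v n c) = 0.

Definition isum (v : nat -> X) (c : nat -> K) : X := xget 0 (sums_to v c).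

Lemma sums_to_unique v c s s' : sums_to v c s -> sums_to v c s' -> s = s'.
Proof.
move=> H H'; apply/eqP; rewrite -subr_eq0; apply/eqP/(graded_sep GP) => k.
have [J HJ] := H k; have [J' HJ'] := H' k; pose n := maxn J J'.
apply/le_anti; rewrite (sn_ge0 (graded_sn GP k)) andbT.
apply: (le_trans (sn_dist (graded_sn GP k) (comb v n c) s s')).
by rewrite (snC (graded_sn GP k) _ s') HJ ?HJ' ?leq_maxr ?leq_maxl// addr0.
Qed.

Lemma null_comb_stable v c k J n : (forall j, (J <= j)%N -> P k (v j) = 0) ->
  (J <= n)%N -> P k (comb v n c - comb v J c) = 0.
Proof.
move=> HJ; elim: n => [|n IH].
  by rewrite leqn0 => /eqP->; rewrite subrr (sn0 (graded_sn GP k)).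
rewrite leq_eqVlt => /orP[/eqP<-|]; first by rewrite subrr (sn0 (graded_sn GP k)).
rewrite ltnS => Jn; rewrite combS addrAC (sn_kerD (graded_sn GP k)) ?IH//.
by rewrite (sn_kerZ (graded_sn GP k))// HJ.
Qed.

Lemma isumP v c : null_seq v -> sums_to v c (isum v c).
Proof.
move=> nv; apply: (@xgetPex _ 0 (sums_to v c)).
have st k : exists J, forall i j, (J <= i)%N -> (J <= j)%N ->
    P k (comb v i c - comb v j c) = 0.
  have [J HJ] := nv k; exists J => i j Ji Jj.
  apply/le_anti; rewrite (sn_ge0 (graded_sn GP k)) andbT.
  apply: (le_trans (sn_dist (graded_sn GP k) (comb v J c) _ _)).
  rewrite (snC (graded_sn GP k) _ (comb v j c)).
  by rewrite (null_comb_stable c HJ Ji) (null_comb_stable c HJ Jj) addr0.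
have [|x Hx] := graded_complete GP (s := fun n => comb v n c).
  move=> k e e0; have [J HJ] := st k; exists J => i j Ji Jj.
  by rewrite HJ.
exists x => k; have [J HJ] := st k; exists J => n Jn.
apply/le_anti; rewrite (sn_ge0 (graded_sn GP k)) andbT.
apply/ler_addgt0Pl => e e0; have [N HN] := Hx k e e0.
apply: (le_trans (sn_dist (graded_sn GP k) (comb v (maxn N J) c) x _)).
rewrite (HJ (maxn N J)) ?leq_maxr// (snC (graded_sn GP k)) addr0 addr0 ltW//.
by rewrite HN// leq_maxl.
Qed.

Lemma isum_eq v c s : sums_to v c s -> isum v c = s.
Proof.
move=> H; apply: (sums_to_unique (v := v) (c := c)) => //.
by apply: (@xgetPex _ 0 (sums_to v c)); exists s.
Qed.

Lemma isum_finite v c n : (forall j, (n <= j)%N -> c j = 0) -> isum v c = comb v n c.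
Proof.
move=> c0; apply: isum_eq => k; exists n => m nm.
rewrite -(comb_widen v c nm) /comb -sumrB big1 ?(sn0 (graded_sn GP k))// => i _.
by case: ltnP => [|ni]; rewrite ?subrr// c0// scale0r subrr.
Qed.

Lemma isumD v a c c' : null_seq v ->
  isum v (fun i => a * c i + c' i) = a *: isum v c + isum v c'.
Proof.
move=> nv; apply: isum_eq => k.
have [J HJ] := isumP c nv k; have [J' HJ'] := isumP c' nv k.
exists (maxn J J') => n; rewrite geq_max => /andP[Jn J'n].
rewrite combP opprD addrACA -scalerBr (sn_kerD (graded_sn GP k)) ?HJ'//.
by rewrite (sn_kerZ (graded_sn GP k))// HJ.
Qed.

Lemma isum_form v c f : null_seq v -> continuous_form f ->
  exists J, forall n, (J <= n)%N -> f (isum v c) = \sum_(i < n) c i *: f (v i).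
Proof.
move=> nv [k bf]; have [J HJ] := isumP c nv k; exists J => n Jn.
rewrite -[isum v c](subrK (comb v n c)) (lmD bf.1) (bounded_by_ker bf) ?HJ// add0r.
exact: (lm_comb _ _ _ bf.1).
Qed.

Lemma isum_ker q k v c : real_seminorm (abs V) q -> (forall x, q x <= P k x) ->
  null_seq v -> (forall j, q (v j) = 0) -> q (isum v c) = 0.
Proof.
move=> qs qP nv qv; have [J HJ] := isumP c nv k.
rewrite -[isum v c](subrK (comb v J c)) (sn_kerD qs).
  by apply/le_anti; rewrite (sn_ge0 qs) andbT -(HJ J (leqnn J)) qP.
by apply: (sn_ker_sum qs (F := fun i => c i *: v i)) => i _; rewrite (sn_kerZ qs).
Qed.

(** [P m] sees only finitely many terms, hence finitely many of the forms, which are bounded by a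
    common seminorm. *)
Lemma isum_bounded v (g : nat -> X -> K^o) : null_seq v ->
  (forall j, continuous_form (g j)) ->
  bounded_on P setT (fun x => isum v (g^~ x)).
Proof.
move=> nv cg m; have [J HJ] := nv m.
have [k Hk] := continuous_forms_bound (n := J) (fun i _ => cg i).
suff [C HC] : exists C, forall x, P m (comb v J (g^~ x)) <= C * P k x.
  exists k, C => x _; have [N HN] := isumP (g^~ x) nv m.
  apply: le_trans (HC x); apply: (le_trans _ (lexx _)).
  have := sn_dist (graded_sn GP m) (comb v (maxn N J) (g^~ x)) (isum v (g^~ x)) 0.
  rewrite !subr0 HN ?leq_maxl// add0r => /le_trans; apply.
  rewrite -[comb v (maxn N J) _](subrK (comb v J (g^~ x))) addrC.
  by rewrite (sn_kerD (graded_sn GP m))// (null_comb_stable _ HJ)// leq_maxr.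
elim: J {HJ} Hk => [|J IH] Hk.
  by exists 0 => x; rewrite comb0 (sn0 (graded_sn GP m)) mul0r.
have [C HC] := IH (fun i ilt => Hk i (ltnW ilt)).
have [_ [D HD]] := Hk J (ltnSn J); exists (C + D * P m (v J)) => x.
rewrite combS; apply: (le_trans ((graded_sn GP m).1 _ _)).
rewrite mulrDl lerD// (graded_sn GP m).2 mulrAC ler_wpM2r//.
exact: sn_ge0 (graded_sn GP m) _.
Qed.

End Series.

Section Frame.
Variables (R : realType) (K : numFieldType) (V : valuation R K).
Variables (X : lmodType K) (P : nat -> X -> R).
Hypothesis GP : graded V P.
Variables (p : X -> R) (k0 : nat).
Hypothesis ps : real_seminorm (abs V) p.
Hypothesis pP : forall x, p x <= P k0 x.

(* On the kernel of [p], the coordinates [g] identify the topology with that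
   of a product of copies of [K]. *)
Definition separates (g : nat -> X -> K^o) : Prop :=
  forall k, exists J, forall x, p x = 0 -> (forall j, (j < J)%N -> g j x = 0) ->
    P k x = 0.

Record frame (v : nat -> X) (g : nat -> X -> K^o) : Prop := Frame {
  frame_ker : forall j, p (v j) = 0;
  frame_form : forall j, continuous_form V P (g j);
  frame_dual : forall i j, g i (v j) = (i == j)%:R;
  frame_sep : separates g }.

Lemma frame_null v g : frame v g -> null_seq P v.
Proof.
move=> fr k; have [J HJ] := frame_sep fr k; exists J => j Jj.
apply: HJ => [|i iJ]; first exact: (frame_ker fr).
by rewrite (frame_dual fr) (ltn_eqF (leq_trans iJ Jj)).
Qed.

Lemma frame_isum_ker v g c : frame v g -> p (isum P v c) = 0.
Proof.
move=> fr; apply: (isum_ker GP c ps pP (frame_null fr)).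
exact: (frame_ker fr).
Qed.

Lemma frame_isum_dual v g c j : frame v g -> g j (isum P v c) = c j.
Proof.
move=> fr; have [J HJ] := isum_form GP c (frame_null fr) (frame_form fr j).
rewrite (HJ (maxn J j.+1)) ?leq_maxl//.
have jn : (j < maxn J j.+1)%N by rewrite leq_maxr.
rewrite (bigD1 (Ordinal jn))//= (frame_dual fr) eqxx.
rewrite big1 ?addr0; first by rewrite -[_ *: _]/(_ * _) mulr1.
by move=> i; rewrite -val_eqE/= eq_sym (frame_dual fr) => /negbTE->; rewrite scaler0.
Qed.

Lemma frame_expand v g x : frame v g -> p x = 0 -> isum P v (g^~ x) = x.
Proof.
move=> fr px; apply/eqP; rewrite -subr_eq0; apply/eqP/(graded_sep GP) => k.
have [J HJ] := frame_sep fr k; apply: HJ => [|j _].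
  by rewrite (sn_kerB ps)// (frame_isum_ker _ fr).
have [_ [lg _]] := frame_form fr j.
by rewrite (lmB lg) (frame_isum_dual _ _ fr) subrr.
Qed.

End Frame.

Section FrameChange.
Variables (R : realType) (K : numFieldType) (V : valuation R K).
Variables (X : lmodType K) (P : nat -> X -> R).
Hypothesis GP : graded V P.
Variables (p : X -> R) (k0 : nat).
Hypothesis ps : real_seminorm (abs V) p.
Hypothesis pP : forall x, p x <= P k0 x.
Variables (v v' : nat -> X) (g g' : nat -> X -> K^o).
Hypothesis fr : frame V P p v g.
Hypothesis fr' : frame V P p v' g'.

(** A continuous projection of [X] onto the kernel of [p], because the forms [g j] live on all of
    [X]. *)
Definition frame_proj x := isum P v (g^~ x).
Definition frame_move x := x - frame_proj x + isum P v' (g^~ x).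
(** The forms [g'] may be nonzero on the complement defined by [g], so they are applied after the
    projection. *)
Definition frame_back x :=
  x - frame_proj x + isum P v (fun j => g' j (frame_proj x)).

Let nv := frame_null fr.
Let nv' := frame_null fr'.

Let lg j : linear_map (g j).
Proof. by have [? []] := frame_form fr j. Qed.

Let lg' j : linear_map (g' j).
Proof. by have [? []] := frame_form fr' j. Qed.

Lemma frame_proj_linear : linear_map frame_proj.
Proof.
move=> a x y; rewrite /frame_proj -(isumD GP _ _ _ nv); congr isum.
by apply/funext => j; rewrite lg.
Qed.

Lemma frame_move_linear : linear_map frame_move.
Proof.
move=> a x y; rewrite /frame_move (frame_proj_linear a).
rewrite (_ : (fun j => g j (a *: x + y)) = fun j => a * g j x + g j y).
  rewrite (isumD GP _ _ _ nv') opprD (addrACA (a *: x)) -scalerBr addrACA -scalerDr//.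
by apply/funext => j; rewrite lg.
Qed.

Lemma frame_back_linear : linear_map frame_back.
Proof.
move=> a x y; rewrite /frame_back (frame_proj_linear a).
rewrite (_ : (fun j => _) =
    fun j => a * g' j (frame_proj x) + g' j (frame_proj y)).
  rewrite (isumD GP _ _ _ nv) opprD (addrACA (a *: x)) -scalerBr addrACA -scalerDr//.
by apply/funext => j; rewrite lg'.
Qed.

Let proj_ker x : p (frame_proj x) = 0.
Proof. exact: (frame_isum_ker GP ps pP _ fr). Qed.

Let proj_id x : p x = 0 -> frame_proj x = x.
Proof. exact: (frame_expand GP ps pP fr). Qed.

Let proj_res x : frame_proj (x - frame_proj x) = 0.
Proof. by rewrite (lmB frame_proj_linear) (proj_id (proj_ker x)) subrr. Qed.

Let g_res j x : g j (x - frame_proj x) = 0.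
Proof. by rewrite (lmB (lg j)) (frame_isum_dual GP _ _ fr) subrr. Qed.

Lemma frame_moveK : cancel frame_move frame_back.
Proof.
move=> x; rewrite /frame_back.
have w0 : p (isum P v' (g^~ x)) = 0 by exact: (frame_isum_ker GP ps pP _ fr').
have -> : frame_proj (frame_move x) = isum P v' (g^~ x).
  by rewrite (lmD frame_proj_linear) proj_res add0r proj_id.
rewrite {1}/frame_move addrK (_ : (fun j => _) = g^~ x) ?subrK//.
by apply/funext => j; rewrite (frame_isum_dual GP _ _ fr').
Qed.

Lemma frame_backK : cancel frame_back frame_move.
Proof.
move=> y; rewrite /frame_move.
set w := isum P v (fun j => g' j (frame_proj y)).
have w0 : p w = 0 by exact: (frame_isum_ker GP ps pP _ fr).
have -> : frame_proj (frame_back y) = w.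
  by rewrite (lmD frame_proj_linear) proj_res add0r proj_id.
rewrite {1}/frame_back addrK (_ : (fun j => _) = g'^~ (frame_proj y)).
  by rewrite (frame_expand GP ps pP fr')// subrK.
by apply/funext => j; rewrite (lmD (lg j)) g_res add0r (frame_isum_dual GP _ _ fr).
Qed.

Lemma frame_move_ker x : p x = 0 -> frame_move x = isum P v' (g^~ x).
Proof. by move=> x0; rewrite /frame_move proj_id// subrr add0r. Qed.

Lemma frame_back_ker x : p x = 0 -> frame_back x = isum P v (g'^~ x).
Proof. by move=> x0; rewrite /frame_back proj_id// subrr add0r. Qed.

Let bounded_id : bounded_on P setT (fun x : X => x).
Proof. by move=> m; exists m, 1 => x _; rewrite mul1r. Qed.

Lemma bounded_onD (S T : X -> X) : bounded_on P setT S -> bounded_on P setT T ->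
  bounded_on P setT (fun x => S x + T x).
Proof.
move=> bS bT m; have [k [C HC]] := bS m; have [l [D HD]] := bT m.
exists (maxn k l), (`|C| + `|D|) => x _.
apply: (le_trans ((graded_sn GP m).1 _ _)); rewrite mulrDl lerD//.
  apply: (le_trans (HC x I)); apply: (@le_trans _ _ (`|C| * P k x)).
    by rewrite ler_wpM2r ?ler_norm// (sn_ge0 (graded_sn GP k)).
  by rewrite ler_wpM2l// (graded_le GP)// leq_maxl.
apply: (le_trans (HD x I)); apply: (@le_trans _ _ (`|D| * P l x)).
  by rewrite ler_wpM2r ?ler_norm// (sn_ge0 (graded_sn GP l)).
by rewrite ler_wpM2l// (graded_le GP)// leq_maxr.
Qed.

Lemma bounded_onN (S : X -> X) : bounded_on P setT S ->
  bounded_on P setT (fun x => - S x).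
Proof.
move=> bS m; have [k [C HC]] := bS m; exists k, C => x _.
by rewrite (snN (graded_sn GP m)) HC.
Qed.

Lemma continuous_form_comp (f : X -> K^o) (S : X -> X) : linear_map S ->
  bounded_on P setT S -> continuous_form V P f ->
  continuous_form V P (fun x => f (S x)).
Proof.
move=> lS bS [k [lf [C HC]]]; have [l [D HD]] := bS k; exists l; split.
  by move=> a x y; rewrite lS lf.
exists (`|C| * D) => x; apply: (le_trans (HC _)).
apply: (@le_trans _ _ (`|C| * P k (S x))).
  by rewrite ler_wpM2r ?ler_norm// (sn_ge0 (graded_sn GP k)).
by rewrite -mulrA ler_wpM2l// HD.
Qed.

Let bounded_proj : bounded_on P setT frame_proj.
Proof. by apply: (isum_bounded GP nv) => j; exact: (frame_form fr j). Qed.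

Lemma frame_move_bounded : bounded_on P setT frame_move.
Proof.
apply: bounded_onD; first by apply: bounded_onD bounded_id _; exact: bounded_onN.
by apply: (isum_bounded GP nv') => j; exact: (frame_form fr j).
Qed.

Lemma frame_back_bounded : bounded_on P setT frame_back.
Proof.
apply: bounded_onD; first by apply: bounded_onD bounded_id _; exact: bounded_onN.
apply: (isum_bounded GP nv) => j.
by apply: continuous_form_comp frame_proj_linear _ (frame_form fr' j).
Qed.

(* [t] marks the coordinates along which [E] sits in the kernel of [p]. *)
Definition adapted (E : set X) (t : nat -> bool) (u : nat -> X)
    (f : nat -> X -> K^o) : Prop :=
  [/\ forall j, t j -> E (u j),
      forall x, E x -> p x = 0 -> forall j, ~~ t j -> f j x = 0 &
      forall x, E x -> p x = 0 -> exists n, forall j, (n <= j)%N -> f j x = 0].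

(** On either side the trace is the span of the frame vectors marked by [t], so [frame_move] carries
    [E] to a subspace [E1] with the trace of [F]. *)
Theorem adapted_isomorphic (E F : set X) (e h : nat -> X) (t : nat -> bool) :
  vsubspace E -> vsubspace F -> E = spanned e -> F = spanned h ->
  (forall x, adherent P E x) -> (forall x, adherent P F x) ->
  adapted E t v g -> adapted F t v' g' -> isomorphic P E F.
Proof.
move=> sE sF Ee Fh dE dF [tE tE0 tEf] [tF tF0 tFf].
pose E1 := [set y | E (frame_back y)].
have sE1 : vsubspace E1.
  split; first by rewrite /E1 /= (lm0 frame_back_linear); case: sE.
  by move=> a x y Ex Ey; rewrite /E1 /= frame_back_linear; exact: sE.2.
have E1e : E1 = spanned (frame_move \o e).
  apply/seteqP; split => y.
    rewrite /E1 /= Ee => -[n [c yE]]; exists n, c.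
    by rewrite -(frame_backK y) yE (lm_comb _ _ _ frame_move_linear).
  move=> [n [c ->]]; rewrite /E1 /= (lm_comb _ _ _ frame_back_linear) Ee.
  by exists n, c; apply: eq_bigr => i _; rewrite /= frame_moveK.
apply: (@isomorphic_trans _ _ V _ P GP _ E1).
  exists frame_move, frame_back; split.
  - by move=> a x y _ _; exact: frame_move_linear.
  - by move=> x Ex; rewrite /E1 /= frame_moveK.
  - by move=> y Ey; rewrite frame_backK.
  - by move=> m; have [k [C HC]] := frame_move_bounded m; exists k, C => x _; exact: HC.
  - by move=> m; have [k [C HC]] := frame_back_bounded m; exists k, C => x _; exact: HC.
have fin_move c u (G : set X) n : vsubspace G -> (forall j, t j -> G (u j)) ->
    (forall j, ~~ t j -> c j = 0) -> (forall j, (n <= j)%N -> c j = 0) ->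
    G (isum P u c).
  move=> sG Gu c0 cn; rewrite (isum_finite GP _ cn).
  have -> : comb u n c = comb (fun j => c j *: u j) n (fun=> 1).
    by apply: eq_comb => i _; rewrite scale1r.
  apply: vsubspace_comb => // i _; have [ti|ti] := boolP (t i).
    by apply: vsubspaceZ => //; exact: Gu.
  by rewrite c0// scale0r; case: sG.
apply: (perturbation_isomorphic GP ps pP sE1 sF E1e Fh) => //.
- move=> x k eps eps0; have [l [C HC]] := frame_move_bounded k.
  have C0 : 0 < `|C| + 1 by rewrite ltr_wpDl.
  have [y Ey xy] := dE (frame_back x) l _ (divr_gt0 eps0 C0).
  exists (frame_move y); first by rewrite /E1 /= frame_moveK.
  rewrite -{1}(frame_backK x) -(lmB frame_move_linear).
  apply: (le_lt_trans (HC _ I)); rewrite ltr_pdivlMr// mulrC in xy.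
  apply: le_lt_trans xy; rewrite ler_wpM2r ?(sn_ge0 (graded_sn GP l))//.
  by rewrite (le_trans (ler_norm C))// lerDl.
- move=> y y0; split.
    rewrite /E1 /= => Ey; rewrite -(frame_backK y).
    have b0 : p (frame_back y) = 0.
      by rewrite frame_back_ker//; exact: (frame_isum_ker GP ps pP _ fr).
    rewrite frame_move_ker//; have [n Hn] := tEf _ Ey b0.
    by apply: (fin_move _ _ _ n) => // j tj; exact: tE0.
  move=> Fy; rewrite /E1 /= frame_back_ker//.
  have [n Hn] := tFf _ Fy y0.
  by apply: (fin_move _ _ _ n) => // j tj; exact: tF0.
Qed.

End FrameChange.

Section SpannedIntersection.
Variables (K : numFieldType) (X : lmodType K).

(** Echelon form: [w n] is a vector of the intersection with leading term [e n] if there is one, and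
    [0] otherwise. Subtracting multiples of [w n] shortens a combination. *)
Lemma spanned_setI (e : nat -> X) (N : set X) : vsubspace N ->
  exists w, spanned w = spanned e `&` N.
Proof.
move=> sN.
have /choice[w Hw] : forall n, exists w,
    (N w /\ exists c, w = e n + comb e n c) \/
    (w = 0 /\ ~ exists2 x, N x & exists c, x = e n + comb e n c).
  move=> n; have [[x Nx xe]|H] :=
      pselect (exists2 x, N x & exists c, x = e n + comb e n c).
    by exists x; left.
  by exists 0; right.
have Nw n : N (w n) by case: (Hw n) => [[]//|[-> _]]; case: sN.
exists w; apply/seteqP; split.
  apply: spanned_min; first exact: vsubspaceI (spanned_subspace e) sN.
  move=> n; split=> //; case: (Hw n) => [[_ [c ->]]|[-> _]].
    exists n.+1, (upd c n 1); by rewrite comb_upd scale1r addrC.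
  by case: (spanned_subspace e).
move=> x [[n [c ->]]]; elim: n c => [|n IH] c.
  by rewrite comb0 => _; case: (spanned_subspace w).
rewrite combS => Nx; have [c0|c0] := eqVneq (c n) 0.
  by move: Nx; rewrite c0 scale0r addr0; exact: IH.
have NX : N (e n + comb e n (fun i => (c n)^-1 * c i)).
  have := vsubspaceZ (c n)^-1 sN Nx; rewrite scalerDr scalerK// addrC.
  by congr (N (_ + _)); rewrite /comb scaler_sumr; apply: eq_bigr => i _; rewrite scalerA.
case: (Hw n) => [[_ [d wE]]|[_ []]]; last first.
  by eexists; [exact: NX|eexists].
have sw := spanned_subspace w.
rewrite -[_ + _](subrK (c n *: w n)); apply: vsubspaceD => //; last first.
  by apply: vsubspaceZ => //; exact: spanned_mem.
have E : comb e n c + c n *: e n - c n *: w n = comb e n (fun i => - c n * d i + c i).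
  rewrite wE scalerDr opprD addrA addrK.
  by rewrite combP scaleNr addrC.
by rewrite E; apply: IH; rewrite -E; apply: vsubspaceB => //; exact: vsubspaceZ.
Qed.

Lemma vsubspace_sum (U : set X) n (F : nat -> X) : vsubspace U ->
  (forall i, (i < n)%N -> U (F i)) -> U (\sum_(i < n) F i).
Proof.
move=> sU H; have -> : \sum_(i < n) F i = comb F n (fun=> 1).
  by apply: eq_bigr => i _; rewrite scale1r.
exact: vsubspace_comb.
Qed.

End SpannedIntersection.

(** * Biorthogonal systems adapted to a trace *)

Section Mackey.
Variables (R : realType) (K : numFieldType) (V : valuation R K).
Variables (X : lmodType K) (P : nat -> X -> R).
Hypothesis GP : graded V P.
Variables (p : X -> R) (k0 : nat).
Hypothesis ps : real_seminorm (abs V) p.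
Hypothesis pP : forall x, p x <= P k0 x.
Variable hh : nat -> X -> K^o.
Hypothesis hh_form : forall j, continuous_form V P (hh j).
Hypothesis hh_sep : separates P p hh.
Variables (W : set X) (w : nat -> X).
Hypothesis Ww : W = spanned w.
Hypothesis Wp : forall x, W x -> p x = 0.

(* [None] marks a step that was void, [Some true] a vector of [W] and
   [Some false] a functional vanishing on [W]. *)
Record mackey_entry := MackeyEntry { mackey_v : X; mackey_g : X -> K^o; mackey_t : option bool }.
Implicit Types h : nat -> mackey_entry.

Definition mackey_good (n : nat) h : Prop :=
  [/\ p (mackey_v (h n)) = 0, continuous_form V P (mackey_g (h n)),
      mackey_g (h n) (mackey_v (h n)) = (mackey_t (h n) != None)%:R,
      mackey_t (h n) = None -> mackey_v (h n) = 0 /\ mackey_g (h n) = (fun=> 0) &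
  [/\ forall i, (i < n)%N -> mackey_g (h i) (mackey_v (h n)) = 0 /\ mackey_g (h n) (mackey_v (h i)) = 0,
      mackey_t (h n) = Some true -> W (mackey_v (h n)),
      mackey_t (h n) != Some true -> forall x, W x -> mackey_g (h n) x = 0 &
      if odd n then forall x, p x = 0 ->
          (forall i, (i <= n)%N -> mackey_g (h i) x = 0) -> hh n./2 x = 0
      else w n./2 = \sum_(i < n.+1) mackey_g (h i) (w n./2) *: mackey_v (h i)]].

Lemma mackey_good_loc n h h' : (forall i, (i <= n)%N -> h i = h' i) ->
  mackey_good n h -> mackey_good n h'.
Proof.
move=> hh' [pv cg gv void [du tW tN task]]; rewrite /mackey_good -(hh' n)//.
split=> //; split=> // [j jn|].
  by rewrite -(hh' j) ?(ltnW jn)//; exact: du.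
case: ifP task => _ task.
  by move=> x px H; apply: task => // i ile; rewrite hh'//; exact: H.
rewrite [LHS]task; apply: eq_bigr => i _.
by rewrite (hh' i (ltn_ord i)).
Qed.

Let sW : vsubspace W.
Proof. by rewrite Ww; exact: spanned_subspace. Qed.

Section Step.
Variables (n : nat) (h : nat -> mackey_entry).
Hypothesis H : forall i, (i < n)%N -> mackey_good i h.

(** The projection onto the common kernel of the functionals chosen so far, along the vectors chosen
    so far. For linear [f], [redf f] is [f] composed with it. *)
Definition red x := x - \sum_(i < n) mackey_g (h i) x *: mackey_v (h i).
Definition redf (f : X -> K^o) : X -> K^o :=
  fun x => f x - \sum_(i < n) f (mackey_v (h i)) * mackey_g (h i) x.

Lemma mackey_g_linear i : (i < n)%N -> linear_map (mackey_g (h i)).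
Proof. by move=> /H[_ [k []]]. Qed.

Lemma mackey_dual i j : (i < n)%N -> (j < n)%N -> i != j ->
  mackey_g (h i) (mackey_v (h j)) = 0.
Proof.
move=> ilt jlt; rewrite neq_ltn => /orP[ij|ji].
  by have [_ _ _ _ [/(_ i ij)[]]] := H jlt.
by have [_ _ _ _ [/(_ j ji)[]]] := H ilt.
Qed.

Lemma mackey_g_red i x : (i < n)%N -> mackey_g (h i) (red x) = 0.
Proof.
move=> ilt; have lg := mackey_g_linear ilt.
rewrite /red (lmB lg) (lm_sum lg n (fun j => mackey_g (h j) x *: mackey_v (h j))).
rewrite (bigD1 (Ordinal ilt))//= big1 => [|j]; last first.
  rewrite -val_eqE/= => ji; rewrite (lmZ lg) mackey_dual ?scaler0//.
  by rewrite eq_sym.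
rewrite addr0 (lmZ lg); have [_ _ gv void _] := H ilt.
case: eqP gv => [/void[_ ->] _|_ ->]; first by rewrite scaler0 subrr.
by rewrite -[_ *: _]/(_ * _) mulr1 subrr.
Qed.

Lemma red_p x : p x = 0 -> p (red x) = 0.
Proof.
move=> px; rewrite (sn_kerB ps)//.
apply: (sn_ker_sum ps (F := fun i => mackey_g (h i) x *: mackey_v (h i))) => i ilt.
by rewrite (sn_kerZ ps)//; case: (H ilt).
Qed.

Lemma red_W x : W x -> W (red x).
Proof.
move=> Wx; apply: vsubspaceB => //.
apply: (vsubspace_sum (F := fun i => mackey_g (h i) x *: mackey_v (h i))) => // i ilt.
have [_ _ _ void [_ tW tN _]] := H ilt.
have [t|t] := eqVneq (mackey_t (h i)) (Some true).
  by apply: vsubspaceZ => //; exact: tW.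
by rewrite tN// scale0r; case: sW.
Qed.

Lemma redf_form f : continuous_form V P f -> continuous_form V P (redf f).
Proof.
move=> cf; have cs : continuous_form V P
    (fun x => \sum_(i < n) f (mackey_v (h i)) * mackey_g (h i) x).
  apply: (continuous_form_sum GP (fun i => f (mackey_v (h i)))
    (f := fun i => mackey_g (h i))) => i ilt; by case: (H ilt).
have -> : redf f = fun x => -1 * (\sum_(i < n) f (mackey_v (h i)) * mackey_g (h i) x) + f x.
  by apply/funext => x; rewrite /redf mulN1r addrC.
exact: continuous_form_combP.
Qed.

Lemma redf_v f i : linear_map f -> (i < n)%N -> redf f (mackey_v (h i)) = 0.
Proof.
move=> lf ilt; rewrite /redf (bigD1 (Ordinal ilt))//= big1 => [|j]; last first.
  by rewrite -val_eqE/= => ji; rewrite mackey_dual ?mulr0.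
rewrite addr0; have [_ _ gv void _] := H ilt.
case: eqP gv => [/void[-> _]|_ ->]; last by rewrite mulr1 subrr.
by rewrite (lm0 lf) mul0r subrr.
Qed.

Lemma redf_red f x : linear_map f -> linear_map (redf f) ->
  redf f (red x) = redf f x.
Proof.
move=> lf lr; rewrite /red (lmB lr).
rewrite (lm_sum lr n (fun i => mackey_g (h i) x *: mackey_v (h i))) big1 ?subr0// => i _.
by rewrite (lmZ lr) redf_v ?scaler0.
Qed.

Lemma redf_eq f x : (forall i, (i < n)%N -> mackey_g (h i) x = 0) -> redf f x = f x.
Proof. by move=> g0; rewrite /redf big1 ?subr0// => i _; rewrite g0 ?mulr0. Qed.

Lemma mackey_good_ext z (f : X -> K^o) (b : bool) :
  p z = 0 -> continuous_form V P f -> f z = 1 ->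
  (forall i, (i < n)%N -> mackey_g (h i) z = 0) ->
  (forall i, (i < n)%N -> f (mackey_v (h i)) = 0) ->
  (b -> W z) -> (~~ b -> forall x, W x -> f x = 0) ->
  (if odd n then forall x, p x = 0 ->
      (forall i, (i < n)%N -> mackey_g (h i) x = 0) -> f x = 0 -> hh n./2 x = 0
    else w n./2 = \sum_(i < n) mackey_g (h i) (w n./2) *: mackey_v (h i) + f (w n./2) *: z) ->
  mackey_good n (upd h n (MackeyEntry z f (Some b))).
Proof.
move=> pz cf fz gz fv bW bN task; rewrite /mackey_good updE/=.
split=> //; split=> [i ilt|[/bW]//|/eqP bt x Wx|].
- by rewrite upd_lt//; split; [exact: gz|exact: fv].
- by case: b bt bN {bW} => [[]//|_ bN]; exact: bN.
- case: ifP task => _ task.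
    move=> x px Hx; apply: task => // [i ilt|].
      by have := Hx i (ltnW ilt); rewrite upd_lt.
    by have := Hx n (leqnn n); rewrite updE.
  rewrite [LHS]task big_ord_recr/= updE; congr (_ + _).
  by apply: eq_bigr => i _; rewrite upd_lt.
Qed.

Lemma mackey_good_void :
  (if odd n then forall x, p x = 0 ->
      (forall i, (i < n)%N -> mackey_g (h i) x = 0) -> hh n./2 x = 0
    else w n./2 = \sum_(i < n) mackey_g (h i) (w n./2) *: mackey_v (h i)) ->
  mackey_good n (upd h n (MackeyEntry 0 (fun=> 0) None)).
Proof.
move=> task; rewrite /mackey_good updE/=; split=> //.
- exact: (sn0 ps).
- exact: continuous_form0.
split=> // [i ilt|].
  by rewrite upd_lt// (lm0 (mackey_g_linear ilt)).
case: ifP task => _ task.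
  move=> x px Hx; apply: task => // i ilt.
  by have := Hx i (ltnW ilt); rewrite upd_lt.
rewrite [LHS]task big_ord_recr/= updE/= scale0r addr0.
by apply: eq_bigr => i _; rewrite upd_lt.
Qed.

Lemma mackey_good_step : exists t, mackey_good n (upd h n t).
Proof.
have [on|on] := boolP (odd n).
  have [_ [lhh _]] := hh_form n./2.
  pose f := redf (hh n./2).
  have cf : continuous_form V P f by exact: redf_form.
  have [_ [lf _]] := cf.
  have fmv i : (i < n)%N -> f (mackey_v (h i)) = 0 by move=> ilt; exact: redf_v.
  (* If the reduced form vanishes on the kernel of [p], the earlier functionals determine [hh n./2]
     there and the step is void. *)
  have [f0|/existsNP[x /not_implyP[px /eqP fx]]] :=
      pselect (forall x, p x = 0 -> f x = 0).
    exists (MackeyEntry 0 (fun=> 0) None); apply: mackey_good_void; rewrite on.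
    by move=> x px Hx; rewrite -(redf_eq (hh n./2) Hx); exact: f0.
  have scaled y (b : bool) : p y = 0 -> f y != 0 -> (b -> W y) ->
      (~~ b -> forall x, W x -> f x = 0) ->
      mackey_good n (upd h n (MackeyEntry ((f y)^-1 *: red y) f (Some b))).
    move=> py fy bW bN; apply: mackey_good_ext => //.
    - by rewrite (sn_kerZ ps)// red_p.
    - by rewrite (lmZ lf) /f redf_red// -[_ *: _]/(_ * _) mulVf.
    - by move=> i ilt; rewrite (lmZ (mackey_g_linear ilt)) mackey_g_red// scaler0.
    - by move=> /bW Wy; apply: vsubspaceZ => //; exact: red_W.
    - by rewrite on => z pz gz fz; rewrite -(redf_eq (hh n./2) gz).
  (* The dual vector is taken in [W] if possible, so that a form marked [Some false] vanishes on
     [W]. *)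
  have [fW|/existsNP[y /not_implyP[Wy /eqP fy]]] :=
      pselect (forall x, W x -> f x = 0).
    by exists (MackeyEntry ((f x)^-1 *: red x) f (Some false)); exact: scaled.
  exists (MackeyEntry ((f y)^-1 *: red y) f (Some true)); apply: scaled => //.
  exact: Wp.
have Ww' : W (w n./2) by rewrite Ww; exact: spanned_mem.
have [r0|r0] := eqVneq (red (w n./2)) 0.
  exists (MackeyEntry 0 (fun=> 0) None); apply: mackey_good_void; rewrite (negbTE on).
  by apply/eqP; rewrite -subr_eq0; apply/eqP.
have pr : p (red (w n./2)) = 0 by rewrite red_p// Wp.
(* The forms [hh] separate the points of the kernel of [p]; a form nonzero at this vector becomes
   dual to it once reduced and normalised. *)
have [j hj] : exists j, hh j (red (w n./2)) != 0.
  apply: contrapT => /forallNP H0; move/eqP: r0; apply.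
  apply: (graded_sep GP) => k; have [J HJ] := hh_sep k; apply: HJ => // j _.
  by apply/eqP; have := H0 j => /negP; rewrite negbK.
set z := red (w n./2) in r0 pr hj.
have [_ [lhh _]] := hh_form j.
have cr := redf_form (hh_form j); have [_ [lr _]] := cr.
have rz : redf (hh j) z = hh j z by apply: redf_eq => i; exact: mackey_g_red.
exists (MackeyEntry z (fun x => (hh j z)^-1 * redf (hh j) x) (Some true)).
apply: mackey_good_ext => //.
- rewrite (_ : (fun x => _) = fun x => (hh j z)^-1 * redf (hh j) x + 0); last first.
    by apply/funext => x; rewrite addr0.
  by apply: continuous_form_combP => //; exact: continuous_form0.
- by rewrite rz mulVf.
- by move=> i; exact: mackey_g_red.
- by move=> i ilt; rewrite redf_v// mulr0.
- by move=> _; exact: red_W.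
- rewrite (negbTE on) -(redf_red (w n./2))// -/z rz mulVf// scale1r.
  by rewrite /z /red addrC subrK.
Qed.

End Step.

Lemma mackey_exists : exists h, forall n, mackey_good n h.
Proof.
exact: (history_choice (MackeyEntry 0 (fun=> 0) None) mackey_good_loc mackey_good_step).
Qed.

End Mackey.

Section AdaptedFrames.
Variables (R : realType) (K : numFieldType) (V : valuation R K).
Variables (X : lmodType K) (P : nat -> X -> R).
Hypothesis GP : graded V P.
Variables (p : X -> R) (k0 : nat).
Hypothesis ps : real_seminorm (abs V) p.
Hypothesis pP : forall x, p x <= P k0 x.
Variable hh : nat -> X -> K^o.
Hypothesis hh_form : forall j, continuous_form V P (hh j).
Hypothesis hh_sep : separates P p hh.
Variables (E : set X) (e : nat -> X).
Hypothesis Ee : E = spanned e.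

Let ker_sub : vsubspace [set x | p x = 0].
Proof.
split=> [|a x y /= px py]; first exact: (sn0 ps).
by rewrite /= (sn_kerD ps)// (sn_kerZ ps).
Qed.

Let sE : vsubspace E.
Proof. by rewrite Ee; exact: spanned_subspace. Qed.

(** Void indices stay, with zero entries, so that indices are steps of the alternation; [mb_reindex]
    removes them. *)
Record mackey_basis (v : nat -> X) (g : nat -> X -> K^o) (t : nat -> option bool)
    : Prop := MackeyBasis {
  mb_ker : forall i, p (v i) = 0;
  mb_form : forall i, continuous_form V P (g i);
  mb_dual : forall i j, g i (v j) = ((i == j) && (t i != None))%:R;
  mb_void : forall i, t i = None -> v i = 0 /\ g i = (fun=> 0);
  mb_sep : separates P p g;
  mb_in : forall i, t i = Some true -> E (v i);
  mb_out : forall i, t i != Some true -> forall x, E x -> p x = 0 -> g i x = 0;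
  mb_fin : forall x, E x -> p x = 0 ->
    exists n, forall i, (n <= i)%N -> g i x = 0 }.

Lemma mackey_basis_exists : exists v g t, mackey_basis v g t.
Proof.
have [w Ww] := spanned_setI e ker_sub.
rewrite -Ee in Ww.
have Wp x : (E `&` [set x | p x = 0]) x -> p x = 0 by case.
have [h Hh] := mackey_exists GP ps hh_form hh_sep (esym Ww) Wp.
have dual i j : i != j -> mackey_g (h i) (mackey_v (h j)) = 0.
  rewrite neq_ltn => /orP[ij|ji].
    by have [_ _ _ _ [/(_ i ij)[]]] := Hh j.
  by have [_ _ _ _ [/(_ j ji)[]]] := Hh i.
have lg i : linear_map (mackey_g (h i)) by have [_ [k []]] := Hh i.
exists (fun i => mackey_v (h i)), (fun i => mackey_g (h i)), (fun i => mackey_t (h i)); split.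
- by move=> i; case: (Hh i).
- by move=> i; case: (Hh i).
- move=> i j; have [->|ij] := eqVneq i j; last by rewrite dual.
  by case: (Hh j).
- by move=> i; case: (Hh i).
(* [hh j] is treated at step [j.*2.+1], so the steps below [J.*2] settle the first [J] forms. *)
- move=> k; have [J HJ] := hh_sep k; exists J.*2 => x px Hx.
  apply: HJ => // j jJ; have [_ _ _ _ [_ _ _]] := Hh j.*2.+1.
  rewrite /= odd_double/= uphalf_double; apply=> // i ij.
  by apply: Hx; rewrite (leq_ltn_trans ij)// -doubleS leq_double.
- by move=> i; have [_ _ _ _ [_ tW _ _]] := Hh i => /tW[].
- by move=> i; have [_ _ _ _ [_ _ tN _]] := Hh i => /tN Hi x Ex px; exact: Hi.
(* Step [j.*2] makes [w j] a combination of the vectors chosen up to then. *)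
- have finw j i : (j.*2 < i)%N -> mackey_g (h i) (w j) = 0.
    move=> ji; have [_ _ _ _ [_ _ _]] := Hh j.*2.
    rewrite odd_double half_double => ->.
    rewrite (lm_sum (lg i) _ (fun l => mackey_g (h l) (w j) *: mackey_v (h l))) big1// => l _.
    rewrite (lmZ (lg i)) dual ?scaler0// neq_ltn.
    by rewrite (leq_trans (ltn_ord l))// orbT.
  move=> x Ex px; have : spanned w x by rewrite Ww.
  move=> [n [c ->]]; exists n.*2 => i ni; rewrite (lm_comb _ _ _ (lg i)) big1// => l _.
  by rewrite finw ?scaler0// (leq_trans _ ni)// ltn_double.
Qed.

Section Basis.
Variables (v : nat -> X) (g : nat -> X -> K^o) (t : nat -> option bool).
Hypothesis mb : mackey_basis v g t.

Let lg i : linear_map (g i).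
Proof. by have [k []] := mb_form mb i. Qed.

Lemma mb_residual n x i : (i < n)%N -> g i (x - comb v n (g^~ x)) = 0.
Proof.
move=> ilt; rewrite (lmB (lg i)) (lm_comb _ _ _ (lg i)).
rewrite (bigD1 (Ordinal ilt))//= big1 => [|j]; last first.
  rewrite -val_eqE/= => ji.
  by rewrite (mb_dual mb) eq_sym (negbTE ji) scaler0.
rewrite addr0 (mb_dual mb) eqxx/=; have [ti|ti] := eqVneq (t i) None.
  by have [_ ->] := mb_void mb ti; rewrite scaler0 subrr.
by rewrite -[_ *: _]/(_ * _) mulr1 subrr.
Qed.

Lemma mb_comb_ker n c : p (comb v n c) = 0.
Proof.
apply: (sn_ker_sum ps (F := fun i => c i *: v i)) => i _.
by rewrite (sn_kerZ ps)// (mb_ker mb).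
Qed.

Lemma mb_approx k : exists M, forall x n, p x = 0 -> (M <= n)%N ->
  P k (x - comb v n (g^~ x)) = 0.
Proof.
have [M HM] := mb_sep mb k; exists M => x n px Mn; apply: HM.
  by rewrite (sn_kerB ps)// mb_comb_ker.
by move=> j jM; apply: mb_residual; exact: leq_trans jM Mn.
Qed.

Lemma mb_comb_in n x : (forall i, t i = Some false -> g i x = 0) ->
  E (comb v n (g^~ x)).
Proof.
move=> H; apply: (vsubspace_sum (F := fun i => g i x *: v i)) => // i _.
case ti: (t i) => [[]|].
- by apply: vsubspaceZ => //; exact: (mb_in mb).
- by rewrite H// scale0r; case: sE.
- by have [-> _] := mb_void mb ti; rewrite scaler0; case: sE.
Qed.

Lemma mb_reindex s : injective s -> (forall j, t (s j) != None) ->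
  (forall i, t i != None -> exists j, s j = i) ->
  frame V P p (v \o s) (fun j => g (s j)) /\
  adapted p E (fun j => t (s j) == Some true) (v \o s) (fun j => g (s j)).
Proof.
move=> sinj sN surj; split.
  split=> [j|j|i j|k] /=; rewrite ?(mb_ker mb)//.
  - exact: (mb_form mb).
  - by rewrite (mb_dual mb) (inj_eq sinj) sN andbT.
  have [M HM] := mb_sep mb k.
  have [J HJ] := bounded_preimage M surj; exists J => x px Hx.
  apply: HM => // i iM; have [ti|ti] := eqVneq (t i) None.
    by have [_ ->] := mb_void mb ti.
  by have [j jJ <-] := HJ i iM ti; exact: Hx.
split=> [j /eqP|x Ex px j|x Ex px] /=.
- exact: (mb_in mb).
- by move=> tj; exact: (mb_out mb).
- have [n Hn] := mb_fin mb Ex px; have [J HJ] := injective_escape n sinj.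
  by exists J => j Jj; apply: Hn; exact: HJ.
Qed.

Lemma mb_out_adherent i x : t i != Some true ->
  adherent P (E `&` [set x | p x = 0]) x -> g i x = 0.
Proof.
move=> ti; apply: (continuous_form_adherent GP (mb_form mb i)) => y [Ey py].
exact: (mb_out mb).
Qed.

End Basis.

(** A form marked [Some false] kills the trace, hence by density the kernel of [p], yet is 1 at its
    dual vector. So only [Some true] remains, infinitely often because finitely many continuous
    forms cannot separate the kernel. *)
Lemma adapted_dense :
  (forall x, p x = 0 -> adherent P (E `&` [set x | p x = 0]) x) ->
  (forall k, exists x, [/\ p x = 0, P k x = 0 & x != 0]) ->
  exists v g, frame V P p v g /\ adapted p E (fun=> true) v g.
Proof.
move=> dW inf; have [v [g [t mb]]] := mackey_basis_exists.
have noF i : t i != Some false.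
  apply/eqP => ti; have tiT : t i != Some true by rewrite ti.
  have := mb_out_adherent mb tiT (dW _ (mb_ker mb i)).
  by rewrite (mb_dual mb) eqxx ti => /eqP; rewrite oner_eq0.
have tN i : (t i != None) = (t i == Some true) by case: (t i) (noF i) => [[]|].
have [s [sinj sT surj]] : exists s : nat -> nat, [/\ injective s,
    forall j, t (s j) == Some true & forall i, t i == Some true -> exists j, s j = i].
  apply: (enum_infinite (A := fun i => t i == Some true)) => n.
  apply: contrapT => H.
  have [k Hk] := continuous_forms_bound GP (n := n) (fun i _ => mb_form mb i).
  have [x [px kx /eqP[]]] := inf k; apply: (graded_sep GP) => l.
  have [M HM] := mb_sep mb l; apply: HM => // j _.
  have [jn|nj] := ltnP j n; first by apply: bounded_by_ker (Hk j jn) kx.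
  have [tj|tj] := eqVneq (t j) (Some true); first by case: H; exists j => //; apply/eqP.
  have tj0 : t j = None by apply/eqP; apply: contraNT tj; rewrite tN.
  by have [_ ->] := mb_void mb tj0.
exists (v \o s), (fun j => g (s j)).
have [fr ad] : frame V P p (v \o s) (fun j => g (s j)) /\
    adapted p E (fun j => t (s j) == Some true) (v \o s) (fun j => g (s j)).
  apply: (mb_reindex mb sinj) => [j|i]; first by rewrite tN.
  by rewrite tN; exact: surj.
split=> //; move: ad; congr adapted; apply/funext => j; exact: sT.
Qed.

(** With finitely many marks [Some true], [E] would meet some kernel trivially; with finitely many
    [Some false], the closure of the trace would contain some kernel. Both being infinite, the marks
    can be rearranged into the alternating pattern, the same for all such subspaces. *)
Lemma adapted_mixed :
  (forall k, exists x, [/\ E x, P k x = 0 & x != 0]) ->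
  (forall k, exists2 x, P k x = 0 & ~ adherent P (E `&` [set x | p x = 0]) x) ->
  exists v g, frame V P p v g /\ adapted p E odd v g.
Proof.
move=> infE infF; have [v [g [t mb]]] := mackey_basis_exists.
have pker k x : (k0 <= k)%N -> P k x = 0 -> p x = 0.
  move=> kk kx; apply/le_anti; rewrite (sn_ge0 ps) andbT.
  by rewrite (le_trans (pP x))// (graded_ker GP kk).
have [s1 [s1inj s1T s1surj]] : exists s : nat -> nat, [/\ injective s,
    forall j, t (s j) == Some true & forall i, t i == Some true -> exists j, s j = i].
  apply: (enum_infinite (A := fun i => t i == Some true)) => n.
  apply: contrapT => H.
  have [k Hk] := continuous_forms_bound GP (n := n) (fun i _ => mb_form mb i).
  have [x [Ex kx /eqP[]]] := infE (maxn k k0).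
  have px := pker _ _ (leq_maxr k k0) kx.
  apply: (graded_sep GP) => l; have [M HM] := mb_sep mb l; apply: HM => // j _.
  have [jn|nj] := ltnP j n.
    by apply: bounded_by_ker (Hk j jn) _; apply: (graded_ker GP) kx; rewrite leq_maxl.
  apply: (mb_out mb) => //; apply/eqP => tj; apply: H; exists j => //; exact/eqP.
have [s2 [s2inj s2T s2surj]] : exists s : nat -> nat, [/\ injective s,
    forall j, t (s j) == Some false & forall i, t i == Some false -> exists j, s j = i].
  apply: (enum_infinite (A := fun i => t i == Some false)) => n.
  apply: contrapT => H.
  have [k Hk] := continuous_forms_bound GP (n := n) (fun i _ => mb_form mb i).
  have [x kx] := infF (maxn k k0); apply => l eps eps0.
  have px := pker _ _ (leq_maxr k k0) kx.
  have [M HM] := mb_approx mb l.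
  exists (comb v M (g^~ x)); last by rewrite HM.
  split; last exact: (mb_comb_ker mb).
  apply: (mb_comb_in mb) => i ti; have [ilt|ni] := ltnP i n.
    by apply: bounded_by_ker (Hk i ilt) _; apply: (graded_ker GP) kx; rewrite leq_maxl.
  by case: H; exists i => //; apply/eqP.
pose s j := if odd j then s1 j./2 else s2 j./2.
have ts j : t (s j) == Some (odd j) by rewrite /s; case: (odd j).
have [fr ad] : frame V P p (v \o s) (fun j => g (s j)) /\
    adapted p E (fun j => t (s j) == Some true) (v \o s) (fun j => g (s j)).
  apply: (mb_reindex mb).
  - move=> i j ij; have := ts i; rewrite ij (eqP (ts j)) => /eqP[oij].
    have ij2 : i./2 = j./2.
      by move: ij; rewrite /s oij; case: (odd i) => /= ss; [exact: s1inj ss|exact: s2inj ss].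
    by rewrite -(odd_double_half i) -oij ij2 odd_double_half.
  - by move=> j; rewrite (eqP (ts j)).
  - move=> i; case ti: (t i) => [[]|//] _.
      have [|j <-] := s1surj i; first by apply/eqP.
      by exists j.*2.+1; rewrite /s /= odd_double/= uphalf_double.
    have [|j <-] := s2surj i; first by apply/eqP.
    by exists j.*2; rewrite /s odd_double half_double.
exists (v \o s), (fun j => g (s j)); split=> //.
move: ad; congr adapted; apply/funext => j.
by rewrite (eqP (ts j)); case: (odd j).
Qed.

(** Adherence makes the coefficients of [x] at [Some false] vanish, so its partial sums are in [E];
    late ones differ from [x] by a vector killed by [P n], and so are killed by [P n] themselves. *)
Lemma adherent_stable k n : (k0 <= n)%N -> (k <= n)%N ->
  (forall x, P k x = 0 -> adherent P (E `&` [set x | p x = 0]) x) ->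
  forall x, P n x = 0 -> adherent P (E `&` [set x | P n x = 0]) x.
Proof.
move=> kn0 kn Hk x nx l eps eps0; have [v [g [t mb]]] := mackey_basis_exists.
have kx := graded_ker GP kn nx.
have px : p x = 0.
  apply/le_anti; rewrite (sn_ge0 ps) andbT.
  by rewrite (le_trans (pP x))// (graded_ker GP kn0).
have [M HM] := mb_approx mb l; have [M' HM'] := mb_approx mb n.
exists (comb v (maxn M M') (g^~ x)); last by rewrite HM ?leq_maxl.
split.
  apply: (mb_comb_in mb) => i ti; apply: (mb_out_adherent mb); first by rewrite ti.
  exact: Hk.
have -> : comb v (maxn M M') (g^~ x) = x - (x - comb v (maxn M M') (g^~ x)).
  by rewrite opprB addrC subrK.
by rewrite /= (sn_kerB (graded_sn GP n)) ?HM' ?leq_maxr.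
Qed.

End AdaptedFrames.

(** * Dense subspaces with a prescribed trace on a closed subspace *)

Section Transversal.
Variables (R : realType) (K : numFieldType) (V : valuation R K).
Variables (X : lmodType K) (P : nat -> X -> R).
Hypothesis GP : graded V P.

Lemma inv_nat_small (eps : R) : 0 < eps ->
  exists N, forall i, (N <= i)%N -> i.+1%:R^-1 < eps.
Proof.
move=> e0; exists (Num.bound eps^-1) => i Ni.
rewrite invf_plt ?posrE ?ltr0n//.
have /archi_boundP/lt_le_trans : 0 <= eps^-1 by rewrite invr_ge0 ltW.
by apply; rewrite ler_nat leqW.
Qed.

Definition dense_seq (d : nat -> X) : Prop :=
  forall x n eps, 0 < eps -> exists i, P n (x - d i) < eps.

Definition independent (e : nat -> X) : Prop :=
  forall n c, comb e n c = 0 -> forall i, (i < n)%N -> c i = 0.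

Definition dense_basis (E : set X) (e : nat -> X) : Prop :=
  [/\ independent e, E = spanned e & forall x, adherent P E x].

Section Sequence.
Variable d : nat -> X.
Hypothesis dd : dense_seq d.
Variable N : set X.
Hypothesis sN : vsubspace N.
Hypothesis infN : infdim setT N.

(** Step [pickle (i, k)] aims at [d i], with [k] serving both as seminorm index and as precision. *)
Definition good_transversal (n : nat) (y : nat -> X) : Prop :=
  ~ sumspan N y n (y n) /\
  forall i k, unpickle n = Some (i, k) -> P k (d i - y n) < k.+1%:R^-1.

Lemma transversal_step n y : (forall i, (i < n)%N -> good_transversal i y) ->
  exists z, good_transversal n (upd y n z).
Proof.
move=> _; have sS := sumspan_subspace y n sN.
have [|z _ Hz] := infdim_sumspan y n (vsubspaceT X) sN infN (n := 0%N) (w := fun=> 0) => //.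
have {}Hz : ~ sumspan N y n z by move=> H; apply: (Hz (fun=> 0)); rewrite comb0 subr0.
have updS x : sumspan N (upd y n x) n = sumspan N y n.
  apply/seteqP; split=> b [c Hc]; exists c; move: Hc;
    congr (N (_ - _)); apply: eq_comb => i ilt; by rewrite upd_lt.
suff [x Hx close] : exists2 x, ~ sumspan N y n x &
    forall i k, unpickle n = Some (i, k) -> P k (d i - x) < k.+1%:R^-1.
  by exists x; split; rewrite updE// updS.
case: (unpickle n) => [[i k]|]; last by exists z.
have [Sd|nSd] := pselect (sumspan N y n (d i)); last first.
  exists (d i) => // i' k' [<- <-]; rewrite subrr (sn0 (graded_sn GP k)).
  by rewrite invr_gt0 ltr0n.
have Pz := sn_ge0 (graded_sn GP k) z.
(* A small multiple of [z] takes [d i] out of the span; the [+ 1] keeps the denominator positive. *)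
pose del : R := k.+1%:R^-1 / (P k z + 1).
have z1 : 0 < P k z + 1 by lra.
have k1 : 0 < k.+1%:R^-1 :> R by rewrite invr_gt0 ltr0n.
have del0 : 0 < del by rewrite divr_gt0.
exists (d i + emb V del *: z).
  move=> S; apply: Hz; rewrite -[z](scalerK (a := emb V del)).
    by apply: vsubspaceZ => //; rewrite -[_ *: z](addKr (d i)) addrC; apply: vsubspaceB.
  by rewrite fmorph_eq0 gt_eqF.
move=> i' k' [<- <-]; rewrite opprD addNKr (snN (graded_sn GP k)).
rewrite (graded_sn GP k).2 abs_emb ?ltW// /del -mulrA gtr_pMr//.
by rewrite mulrC ltr_pdivrMr// mul1r ltrDl.
Qed.

Lemma transversal : exists y : nat -> X,
  (forall n c, N (comb y n c) -> forall i, (i < n)%N -> c i = 0) /\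
  forall x k eps, 0 < eps -> exists j, P k (x - y j) < eps.
Proof.
have [||y Hy] := @history_choice X 0 good_transversal.
- move=> n h h' hh' [nS cl]; rewrite /good_transversal -hh'//; split=> //.
  move=> [c Hc]; apply: nS; exists c; move: Hc; congr (N (_ - _)).
  by apply: eq_comb => i ilt; rewrite hh'// ltnW.
- exact: transversal_step.
exists y; split.
  elim=> // n IH c; rewrite combS => Nc.
  have cn : c n = 0.
    apply/eqP; apply: contraT => cn; have [nS _] := Hy n; case: nS.
    exists (fun i => - (c n)^-1 * c i + 0).
    rewrite (combP y n _ c (fun=> 0)).
    have -> : comb y n (fun=> 0) = 0 by rewrite /comb big1// => i _; rewrite scale0r.
    have := vsubspaceZ (c n)^-1 sN Nc; rewrite scalerDr scalerK// addrC.
    by rewrite addr0 scaleNr opprK.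
  move=> i; rewrite ltnS leq_eqVlt => /orP[/eqP->//|]; apply: IH.
  by move: Nc; rewrite cn scale0r addr0.
move=> x k eps e0; have e2 : 0 < eps / 2 by rewrite divr_gt0.
have [M HM] := inv_nat_small e2; pose l := maxn M k.
have [i Hi] := dd x l e2; exists (pickle (i, l)).
have [_ /(_ i l (pickleK _)) Hl] := Hy (pickle (i, l)).
apply: (le_lt_trans (graded_le GP _ (leq_maxr M k))); rewrite -/l.
apply: (le_lt_trans (sn_dist (graded_sn GP l) (d i) _ _)).
have := lt_trans Hl (HM l (leq_maxl _ _)); lra.
Qed.

Definition interleave (y u : nat -> X) : nat -> X :=
  fun i => if odd i then u i./2 else y i./2.

Lemma comb_interleave y u n c : comb (interleave y u) n.*2 c =
  comb y n (fun i => c i.*2) + comb u n (fun i => c i.*2.+1).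
Proof.
elim: n => [|n IH]; first by rewrite !comb0 addr0.
rewrite doubleS !combS IH /interleave /= odd_double/= half_double uphalf_double.
by rewrite -!addrA; congr (_ + _); rewrite addrCA.
Qed.

Lemma comb_interleave_widen y u n c : exists c' : nat -> K,
  (forall i, (i < n)%N -> c' i = c i) /\
  comb (interleave y u) n c =
  comb y n (fun i => c' i.*2) + comb u n (fun i => c' i.*2.+1).
Proof.
exists (fun i => if (i < n)%N then c i else 0); split=> [i ->//|].
have nn : (n <= n.*2)%N by rewrite -addnn leq_addr.
have <- := comb_widen (interleave y u) c nn.
exact: comb_interleave.
Qed.

(** The vectors [y] are dense and independent modulo [N]; adjoining [u], a combination lies in [N]
    only if its part along [y] vanishes. *)
Lemma transversal_basis u : (forall j, N (u j)) -> independent u ->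
  exists E e, [/\ dense_basis E e, forall j, E (u j) &
    forall x, E x -> N x -> spanned u x].
Proof.
move=> Nu iu; have [y [iy dy]] := transversal.
pose e := interleave y u.
have Ey j : spanned e (y j).
  have := spanned_mem e j.*2; rewrite {2}/e /interleave odd_double half_double.
  exact.
have Eu j : spanned e (u j).
  have := spanned_mem e j.*2.+1.
  by rewrite {2}/e /interleave /= odd_double/= uphalf_double.
have Ncomb n c : N (comb u n c) by apply: vsubspace_comb.
exists (spanned e), e; split=> //.
- split=> // [n c|x k eps e0].
    have [c' [cc' ->]] := comb_interleave_widen y u n c => /eqP.
    rewrite addr_eq0 => /eqP yu.
    have cy i : (i < n)%N -> c' i.*2 = 0.
      apply: (iy n (fun i => c' i.*2)); rewrite yu; exact: vsubspaceN.
    have cu i : (i < n)%N -> c' i.*2.+1 = 0.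
      apply: (iu n (fun i => c' i.*2.+1)); apply/eqP; rewrite -oppr_eq0 -yu.
      by rewrite /comb big1// => j _; rewrite cy// scale0r.
    move=> i ilt; rewrite -cc'//.
    have i2 : (i./2 < n)%N by rewrite (leq_ltn_trans _ ilt)// -divn2 leq_div.
    rewrite -(odd_double_half i); case: (odd i); first exact: cu.
    exact: cy.
  by have [j Hj] := dy x k eps e0; exists (y j).
- move=> x [n [c ->]]; have [c' [_ ->]] := comb_interleave_widen y u n c.
  move=> Nx; have Ny : N (comb y n (fun i => c' i.*2)).
    by rewrite -[comb y _ _](addrK (comb u n (fun i => c' i.*2.+1))); apply: vsubspaceB.
  have -> : comb y n (fun i => c' i.*2) = 0.
    by rewrite /comb big1// => i _; rewrite (iy _ _ Ny)// scale0r.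
  by rewrite add0r; eexists _, _.
Qed.

Lemma transversal_basis0 : exists E e, dense_basis E e /\
  forall x, E x -> N x -> x = 0.
Proof.
have [y [iy dy]] := transversal; exists (spanned y), y; split.
  split=> // [n c y0|x k eps e0].
    by apply: iy; rewrite y0; case: sN.
  have [j Hj] := dy x k eps e0; exists (y j) => //; exact: spanned_mem.
move=> _ [n [c ->]] Ny; rewrite /comb big1// => i _.
by rewrite (iy _ _ Ny)// scale0r.
Qed.

End Sequence.
End Transversal.

(** * The classes F0, F1 and F2 *)

Section Types.
Variables (R : realType) (K : numFieldType) (V : valuation R K).
Variables (X : lmodType K) (P : nat -> X -> R).
Hypothesis GP : graded V P.
Implicit Types E F : set X.

Lemma graded_ker_vsubspace n : vsubspace [set x | P n x = 0].
Proof.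
split=> [|a x y /= px py]; first exact: (sn0 (graded_sn GP n)).
by rewrite /= (sn_kerD (graded_sn GP n))// (sn_kerZ (graded_sn GP n)).
Qed.

Lemma dense_basis_vsubspace E e : dense_basis P E e -> vsubspace E.
Proof. by move=> [_ -> _]; exact: spanned_subspace. Qed.

Lemma norm_isomorphic k E F e f : dense_basis P E e -> dense_basis P F f ->
  (forall x, E x -> P k x = 0 -> x = 0) -> (forall x, F x -> P k x = 0 -> x = 0) ->
  isomorphic P E F.
Proof.
move=> bE bF Ek Fk; have [_ Ee dE] := bE; have [_ Ff dF] := bF.
have sE := dense_basis_vsubspace bE; have sF := dense_basis_vsubspace bF.
apply: (perturbation_isomorphic GP (graded_sn GP k) (fun=> lexx _)
  sE sF Ee Ff dE dF) => x kx.
by split=> [/Ek/(_ kx)|/Fk/(_ kx)] ->; [case: sF|case: sE].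
Qed.

Lemma dense_isomorphic p k hh E F e f :
  real_seminorm (abs V) p -> (forall x, p x <= P k x) ->
  (forall j, continuous_form V P (hh j)) -> separates P p hh ->
  (forall n, exists x, [/\ p x = 0, P n x = 0 & x != 0]) ->
  dense_basis P E e -> dense_basis P F f ->
  (forall x, p x = 0 -> adherent P (E `&` [set x | p x = 0]) x) ->
  (forall x, p x = 0 -> adherent P (F `&` [set x | p x = 0]) x) ->
  isomorphic P E F.
Proof.
move=> ps pP hf hs inf bE bF Ed Fd; have [_ Ee dE] := bE; have [_ Ff dF] := bF.
have sE := dense_basis_vsubspace bE; have sF := dense_basis_vsubspace bF.
have [v [g [fr ad]]] := adapted_dense GP ps hf hs Ee Ed inf.
have [v' [g' [fr' ad']]] := adapted_dense GP ps hf hs Ff Fd inf.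
exact: (adapted_isomorphic GP ps pP fr fr' sE sF Ee Ff dE dF ad ad').
Qed.

(* The image of a point of [X] under the extension of an isomorphism between
   dense subspaces. *)
Lemma graph_closure F (S : X -> X) y : vsubspace F -> lin_on F S ->
  bounded_on P F S -> (forall x, adherent P F x) ->
  exists x, forall l eps, 0 < eps ->
    exists f, [/\ F f, P l (y - f) < eps & P l (x - S f) < eps].
Proof.
move=> sF lS bS dF.
have /choice[f Hf] : forall i, exists f, F f /\ P i (y - f) < i.+1%:R^-1.
  move=> i; have [|f Ff Hf] := dF y i i.+1%:R^-1; first by rewrite invr_gt0 ltr0n.
  by exists f.
have lSB a b : F a -> F b -> S (a - b) = S a - S b.
  by move=> Fa Fb; rewrite addrC -scaleN1r lS// scaleN1r addrC.
have small l eps : 0 < eps -> exists N, forall i, (N <= i)%N -> P l (y - f i) < eps.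
  move=> e0; have [N HN] := inv_nat_small e0; exists (maxn N l) => i.
  rewrite geq_max => /andP[Ni li]; apply: (le_lt_trans (graded_le GP _ li)).
  exact: lt_trans (Hf i).2 (HN i Ni).
have [|x Hx] := graded_complete GP (s := fun i => S (f i)).
  move=> l eps e0; have [m [C HC]] := bS l.
  have C0 : 0 < 2 * (`|C| + 1) by rewrite mulr_gt0// ltr_wpDl.
  have [N HN] := small m _ (divr_gt0 e0 C0); exists N => i j Ni Nj.
  have [Fi _] := Hf i; have [Fj _] := Hf j.
  rewrite -lSB//; apply: (le_lt_trans (HC _ (vsubspaceB sF Fi Fj))).
  have := sn_dist (graded_sn GP m) y (f i) (f j); rewrite (snC (graded_sn GP m) (f i) y).
  have := HN i Ni; have := HN j Nj; rewrite !ltr_pdivlMr//.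
  have := sn_ge0 (graded_sn GP m) (f i - f j); have := ler_norm C; have := normr_ge0 C.
  move: (P m _) (P m _) (P m _) (`|C|) C0 => a b c D D0; nra.
exists x => l eps e0; have [N HN] := small l eps e0; have [M HM] := Hx l eps e0.
exists (f (maxn N M)); split; first by have [] := Hf (maxn N M).
  by rewrite HN// leq_maxl.
by rewrite (snC (graded_sn GP l)) HM// leq_maxr.
Qed.

Definition has_norm E := exists k, forall x, E x -> P k x = 0 -> x = 0.

(** The approximants need only lie in the largest kernel. That they can be found in the smaller ones
    is [has_dense_kernel_stable]. *)
Definition has_dense_kernel E :=
  exists k, forall x, P k x = 0 -> adherent P (E `&` [set x | P 0 x = 0]) x.

Lemma lin_on0 E (T : X -> X) : vsubspace E -> lin_on E T -> T 0 = 0.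
Proof.
move=> [E0 _] lT; have := lT (-1) 0 0 E0 E0.
by rewrite scaler0 addr0 scaleN1r addNr.
Qed.

Lemma has_norm_iso E F : vsubspace E -> isomorphic P E F -> has_norm E -> has_norm F.
Proof.
move=> sE [T [S [lT TS ST bT bS]]] [k Hk]; have [l [C HC]] := bS k.
exists l => y Fy ly; have [ESy <-] := ST y Fy.
rewrite (Hk (S y))// ?(lin_on0 sE lT)//; apply/le_anti.
by rewrite (sn_ge0 (graded_sn GP k)) andbT (le_trans (HC y Fy))// ly mulr0.
Qed.

Section ProductKernel.
Variable hh : nat -> X -> K^o.
Hypothesis hh_form : forall j, continuous_form V P (hh j).
Hypothesis hh_sep : separates P (P 0) hh.
Hypothesis ker_nz : forall n, exists2 x, P n x = 0 & x != 0.

Let Ps0 := graded_sn GP 0.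
Let P0P x : P 0 x <= P 0 x := lexx _.

Lemma has_dense_kernel_stable E e : dense_basis P E e -> has_dense_kernel E ->
  exists k, forall n, (k <= n)%N -> forall x, P n x = 0 ->
    adherent P (E `&` [set x | P n x = 0]) x.
Proof.
move=> [_ Ee _] [k Hk]; exists k => n kn.
exact: (adherent_stable GP Ps0 P0P hh_form hh_sep Ee (leq0n n) kn Hk).
Qed.

(** The points to approximate need not lie in [F], so the isomorphism has to act on limits: a point
    of a small kernel corresponds to some [x] killed by [P n], and [T] carries vectors of [E] killed
    by [P n] and close to [x] into the kernel of [P 0]. *)
Lemma has_dense_kernel_iso E F e f : dense_basis P E e -> dense_basis P F f ->
  isomorphic P E F -> has_dense_kernel E -> has_dense_kernel F.
Proof.
move=> bE bF iEF; have sE := dense_basis_vsubspace bE.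
have sF := dense_basis_vsubspace bF.
have [S [T [lS ST TS bS bT]]] := isomorphic_sym sE iEF.
have lT : lin_on E T.
  move=> a x y Ex Ey; have [FTx STx] := TS x Ex; have [FTy STy] := TS y Ey.
  by rewrite -[in LHS]STx -[in LHS]STy -lS// (ST _ (sF.2 a _ _ FTx FTy)).2.
move=> /(has_dense_kernel_stable bE)[k Hk].
(* Large enough both for the density in [E] and for [T] to map the kernel of [P n] into that of
   [P 0]. *)
have [m [C HC]] := bT 0%N; pose n := maxn k m.
have [k' [D HD]] := bS n; exists k' => y yk l eps e0.
have [_ _ dF] := bF.
have [x Hx] := graph_closure y sF lS bS dF.
have D1 : 0 < `|D| + 2 by rewrite ltr_wpDl.
have nx : P n x = 0.
  apply/le_anti; rewrite (sn_ge0 (graded_sn GP n)) andbT.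
  apply/ler_addgt0Pl => d d0; rewrite addr0.
  have [t0 dt] : 0 < d / (`|D| + 2) /\ d = d / (`|D| + 2) * (`|D| + 2).
    by rewrite divr_gt0// divfK// gt_eqF.
  move: (d / (`|D| + 2)) t0 dt => t t0 dt.
  have [z [Fz yz xz]] := Hx (maxn n k') t t0.
  have := le_lt_trans (graded_le GP _ (leq_maxl n k')) xz.
  have := le_lt_trans (graded_le GP _ (leq_maxr n k')) yz.
  rewrite (snC (graded_sn GP k')) (sn_kerB (graded_sn GP k') _ yk).
  have := HD z Fz; have := sn_dist (graded_sn GP n) (S z) x 0; rewrite !subr0.
  have := sn_ge0 (graded_sn GP k') z.
  have := ler_norm D; have := normr_ge0 D; rewrite dt.
  move: (P n x) (P n (S z)) (P k' z) (P n (x - S z)) (`|D|) => a b c g D'.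
  nra.
have [l' [B HB]] := bT l.
(* With precision [t] everywhere, the total error is at most t + 2|B|t. *)
have B1 : 0 < 4 * (`|B| + 1) by rewrite mulr_gt0// ltr_wpDl.
have [t0 et] : 0 < eps / (4 * (`|B| + 1)) /\
    eps = eps / (4 * (`|B| + 1)) * (4 * (`|B| + 1)).
  by rewrite divr_gt0// divfK// gt_eqF.
move: (eps / (4 * (`|B| + 1))) t0 et => t t0 et.
have [z [Fz yz xz]] := Hx (maxn l l') t t0.
have [w [Ew nw] xw] := Hk n (leq_maxl k m) x nx l' t t0.
have [ESz TSz] := ST z Fz; have [FTw STw] := TS w Ew.
exists (T w).
  split=> //; apply/le_anti; rewrite (sn_ge0 Ps0) andbT.
  by rewrite (le_trans (HC w Ew))// (graded_ker GP (leq_maxr k m) nw) mulr0.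
have TB : z - T w = T (S z - w).
  have -> : S z - w = -1 *: w + S z by rewrite scaleN1r addrC.
  by rewrite lT// scaleN1r [RHS]addrC TSz.
apply: (le_lt_trans (sn_dist (graded_sn GP l) z y (T w))); rewrite TB.
have := HB _ (vsubspaceB sE ESz Ew).
have := sn_dist (graded_sn GP l') x (S z) w; rewrite (snC (graded_sn GP l') (S z) x).
move: xw.
have := le_lt_trans (graded_le GP _ (leq_maxr l l')) xz.
have := le_lt_trans (graded_le GP _ (leq_maxl l l')) yz.
have := sn_ge0 (graded_sn GP l') (S z - w).
have := ler_norm B; have := normr_ge0 B; rewrite et.
move: (P l (y - z)) (P l' (x - S z)) (P l' (x - w)) (P l' (S z - w)) => a1 a2 a3 a4.
move: (P l (T (S z - w))) (`|B|) => a5 B'; nra.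
Qed.

Lemma mixed_isomorphic E F e f : dense_basis P E e -> dense_basis P F f ->
  ~ has_norm E -> ~ has_norm F -> ~ has_dense_kernel E -> ~ has_dense_kernel F ->
  isomorphic P E F.
Proof.
move=> bE bF nE nF dkE dkF; have [_ Ee dE] := bE; have [_ Ff dF] := bF.
have sE := dense_basis_vsubspace bE; have sF := dense_basis_vsubspace bF.
have nn G k : ~ has_norm G -> exists x, [/\ G x, P k x = 0 & x != 0].
  move=> nG; apply: contrapT => H; apply: nG; exists k => x Gx kx.
  by apply/eqP; apply: contraT => x0; case: H; exists x.
have nd G k : ~ has_dense_kernel G ->
    exists2 x, P k x = 0 & ~ adherent P (G `&` [set x | P 0 x = 0]) x.
  move=> dG; apply: contrapT => H; apply: dG; exists k => x kx.
  by apply: contrapT => nx; apply: H; exists x.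
have [v [g [fr ad]]] := adapted_mixed GP Ps0 P0P hh_form hh_sep Ee
  (fun k => nn E k nE) (fun k => nd E k dkE).
have [v' [g' [fr' ad']]] := adapted_mixed GP Ps0 P0P hh_form hh_sep Ff
  (fun k => nn F k nF) (fun k => nd F k dkF).
exact: (adapted_isomorphic GP Ps0 P0P fr fr' sE sF Ee Ff dE dF ad ad').
Qed.

Lemma dense_kernel_isomorphic E F e f : dense_basis P E e -> dense_basis P F f ->
  has_dense_kernel E -> has_dense_kernel F -> isomorphic P E F.
Proof.
move=> bE bF /(has_dense_kernel_stable bE)[k Hk] /(has_dense_kernel_stable bF)[l Hl].
pose n := maxn k l.
apply: (dense_isomorphic (p := P n) (k := n) (hh := hh) (graded_sn GP n) _ hh_form
  _ _ bE bF (Hk n (leq_maxl k l)) (Hl n (leq_maxr k l))) => //.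
- move=> m; have [J HJ] := hh_sep m; exists J => x nx; apply: HJ.
  exact: (graded_ker GP (leq0n n) nx).
- move=> m; have [x xm x0] := ker_nz (maxn n m); exists x; split=> //.
    exact: (graded_ker GP (leq_maxl n m) xm).
  exact: (graded_ker GP (leq_maxr n m) xm).
Qed.

Variable d : nat -> X.
Hypothesis dd : dense_seq P d.
Hypothesis inf0 : infdim setT [set x | P 0 x = 0].

Lemma has_norm_exists : exists E e, dense_basis P E e /\ has_norm E.
Proof.
have [E [e [bE nE]]] := transversal_basis0 GP dd (graded_ker_vsubspace 0) inf0.
by exists E, e; split=> //; exists 0%N.
Qed.

(** The alternation run for the zero subspace: no index is marked [Some true], and the non-void ones
    form a frame. *)
Let frame_exists : exists v g, frame V P (P 0) v g.
Proof.
have [v [g [t mb]]] := mackey_basis_exists GP Ps0 hh_form hh_sep (e := fun=> 0) erefl.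
have E0 x : spanned (fun=> 0 : X) x -> x = 0.
  by move=> [n [c ->]]; rewrite /comb big1// => i _; rewrite scaler0.
have noT i : t i != Some true.
  apply/eqP => ti; have := E0 _ (mb_in mb ti) => vi.
  have := mb_dual mb i i; rewrite vi eqxx ti (lm0 _) => [/eqP|].
    by rewrite eq_sym oner_eq0.
  by have [? []] := mb_form mb i.
have [s [sinj sT surj]] : exists s : nat -> nat, [/\ injective s,
    forall j, t (s j) != None & forall i, t i != None -> exists j, s j = i].
  apply: (enum_infinite (A := fun i => t i != None)) => n.
  apply: contrapT => H.
  have [k Hk] := continuous_forms_bound GP (n := n) (fun i _ => mb_form mb i).
  have [x kx /eqP[]] := ker_nz k; apply: (graded_sep GP) => l.
  have [M HM] := mb_sep mb l; apply: HM => [|j _].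
    exact: (graded_ker GP (leq0n k) kx).
  have [jn|nj] := ltnP j n; first by apply: bounded_by_ker (Hk j jn) kx.
  have [tj|tj] := eqVneq (t j) None; first by have [_ ->] := mb_void mb tj.
  by case: H; exists j.
exists (v \o s), (fun j => g (s j)).
by have [] := mb_reindex mb sinj sT surj.
Qed.

Lemma frame_independent p v g : frame V P p v g -> independent v.
Proof.
move=> fr n c vc i ilt; have [_ [lg _]] := frame_form fr i.
have := congr1 (g i) vc; rewrite (lm0 lg) (lm_comb _ _ _ lg).
rewrite (bigD1 (Ordinal ilt))//= big1 => [|j]; last first.
  rewrite -val_eqE/= => ji.
  by rewrite (frame_dual fr) eq_sym (negbTE ji) scaler0.
by rewrite (frame_dual fr) eqxx addr0 -[_ *: _]/(_ * _) mulr1.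
Qed.

Lemma frame_no_norm (E : set X) v g (s : nat -> nat) : frame V P (P 0) v g -> injective s ->
  (forall j, E (v (s j))) -> ~ has_norm E.
Proof.
move=> fr sinj Ev [k Hk]; have [J HJ] := frame_null fr k.
have [j Hj] := injective_escape J sinj.
have v0 := Hk _ (Ev j) (HJ _ (Hj j (leqnn j))).
have := frame_dual fr (s j) (s j); rewrite v0 eqxx.
have [_ [lg _]] := frame_form fr (s j).
by rewrite (lm0 lg) => /eqP; rewrite eq_sym oner_eq0.
Qed.

Lemma frame_adherent v g x : frame V P (P 0) v g -> P 0 x = 0 ->
  adherent P (spanned v) x.
Proof.
move=> fr x0 l eps e0; have [J HJ] := isumP GP (g^~ x) (frame_null fr) l.
exists (comb v J (g^~ x)); first by exists J, (g^~ x).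
by have := HJ J (leqnn J); rewrite (frame_expand GP Ps0 P0P fr x0) => ->.
Qed.

Lemma has_dense_kernel_exists : exists E e,
  [/\ dense_basis P E e, ~ has_norm E & has_dense_kernel E].
Proof.
have [v [g fr]] := frame_exists.
have [E [e [bE Ev Es]]] := transversal_basis GP dd (graded_ker_vsubspace 0) inf0
  (frame_ker fr) (frame_independent fr).
exists E, e; split=> //; first exact: (frame_no_norm (s := id) fr).
exists 0%N => x x0 l eps e0.
have [y [n [c ->]] xy] := frame_adherent fr x0 l e0.
exists (comb v n c) => //; split; apply: vsubspace_comb => //.
  exact: dense_basis_vsubspace bE.
  exact: graded_ker_vsubspace.
by move=> i _; exact: (frame_ker fr).
Qed.

(** The trace is spanned by the even half of a frame. It meets every kernel, but an odd coordinate
    kills it and not its own dual vector, which lies in any given kernel once its index is large. *)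
Lemma mixed_exists : exists E e,
  [/\ dense_basis P E e, ~ has_norm E & ~ has_dense_kernel E].
Proof.
have [v [g fr]] := frame_exists.
pose u j := v j.*2.
have iu : independent u.
  move=> n c uc i ilt; have [_ [lg _]] := frame_form fr i.*2.
  have := congr1 (g i.*2) uc; rewrite (lm0 lg) (lm_comb _ _ _ lg).
  rewrite (bigD1 (Ordinal ilt))//= big1 => [|j]; last first.
    rewrite -val_eqE/= => ji; rewrite /u (frame_dual fr).
    by rewrite (inj_eq double_inj) eq_sym (negbTE ji) scaler0.
  by rewrite (frame_dual fr) eqxx addr0 -[_ *: _]/(_ * _) mulr1.
have [E [e [bE Ev Es]]] := transversal_basis GP dd (graded_ker_vsubspace 0) inf0
  (fun j => frame_ker fr j.*2) iu.
exists E, e; split=> //.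
  exact: (frame_no_norm fr double_inj).
move=> [k Hk]; have [J HJ] := frame_null fr k.
have Jk : P k (v J.*2.+1) = 0 by apply: HJ; rewrite -addnn -addSn leq_addl.
suff : g J.*2.+1 (v J.*2.+1) = 0.
  by rewrite (frame_dual fr) eqxx => /eqP; rewrite oner_eq0.
apply: (continuous_form_adherent GP (frame_form fr _) _ (Hk _ Jk)) => y [Ey y0].
have [n [c ->]] := Es y Ey y0.
have [_ [lg _]] := frame_form fr J.*2.+1.
rewrite (lm_comb _ _ _ lg) big1// => i _; rewrite /u (frame_dual fr).
have -> : (J.*2.+1 == i.*2) = false; last by rewrite scaler0.
by apply/negbTE/eqP => /(congr1 odd)/=; rewrite !odd_double.
Qed.

End ProductKernel.
End Types.

(** * Bernstein widths and the class F3 *)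

Section Bernstein.
Variables (R : realType) (K : numFieldType) (V : valuation R K).
Variables (X : lmodType K) (P : nat -> X -> R).
Hypothesis GP : graded V P.
Implicit Types (E F : set X) (a : nat -> R).

(* Bernstein widths: on every [i + 1]-dimensional subspace of [E] in the kernel
   of [P n], the quotient [P k / P l] takes a value at most [C / a i]. *)
Definition small_widths a E : Prop :=
  exists n, forall k, exists l C, forall i w,
    (forall j, (j <= i)%N -> E (w j) /\ P n (w j) = 0) ->
    exists c, (exists2 j, (j <= i)%N & c j != 0) /\
      a i * P k (comb w i.+1 c) <= C * P l (comb w i.+1 c).

(** Keeps [small_widths] from holding trivially through combinations that [P k] kills; it supplies
    the test spaces of [widths_diagonal]. *)
Definition wide_kernels E : Prop :=
  forall n, exists k, forall i, exists w,
    (forall j, E (w j) /\ P n (w j) = 0) /\ independent_mod (P k) w i.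

Lemma lin_on_comb E (T : X -> X) w n c : vsubspace E -> lin_on E T ->
  (forall j, (j < n)%N -> E (w j)) -> T (comb w n c) = comb (T \o w) n c.
Proof.
move=> sE lT; elim: n => [|n IH] Ew; first by rewrite !comb0 (lin_on0 sE lT).
have Ec : E (comb w n c) by apply: vsubspace_comb => // i ilt; apply/Ew/ltnW.
have -> : comb w n.+1 c = c n *: w n + comb w n c by rewrite combS addrC.
rewrite (lT _ _ _ (Ew n (ltnSn n)) Ec) IH; first by rewrite combS addrC.
by move=> j jn; apply/Ew/ltnW.
Qed.

Lemma graded_bound_norm n C x y : x <= C * P n y -> x <= `|C| * P n y.
Proof.
move=> /le_trans; apply; rewrite ler_wpM2r ?ler_norm//.
exact: (sn_ge0 (graded_sn GP n)).
Qed.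

Lemma small_widths_iso a E F : (forall i, 0 <= a i) -> vsubspace E -> vsubspace F ->
  isomorphic P E F -> small_widths a E -> small_widths a F.
Proof.
move=> a0 sE sF iEF [n Hn].
have [S [T [lS ST TS bS bT]]] := isomorphic_sym sE iEF.
have [n' [C HC]] := bS n; exists n' => k.
have [k1 [B HB]] := bT k; have [l [C' HC']] := Hn k1.
have [l1 [D HD]] := bS l; exists l1, (`|B| * (`|C'| * `|D|)) => i w Fw.
have [|c [cn Hc]] := HC' i (S \o w).
  move=> j ji /=; have [Fj nj] := Fw j ji; have [ESw _] := ST _ Fj; split=> //.
  apply/le_anti; rewrite (sn_ge0 (graded_sn GP n)) andbT.
  by rewrite (le_trans (HC _ Fj))// nj mulr0.
exists c; split=> //.
have Fz : F (comb w i.+1 c) by apply: vsubspace_comb => // j /Fw[].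
rewrite -(lin_on_comb c sF lS) in Hc; last by move=> j /Fw[].
set z := comb w i.+1 c in Fz Hc *.
have [ESz TSz] := ST z Fz.
have h1 := graded_bound_norm (HB _ ESz); rewrite TSz in h1.
have h2 := graded_bound_norm Hc; have h3 := graded_bound_norm (HD z Fz).
apply: (le_trans (ler_wpM2l (a0 i) h1)); rewrite mulrCA -[leRHS]mulrA ler_wpM2l//.
by apply: (le_trans h2); rewrite -mulrA ler_wpM2l.
Qed.

Lemma wide_kernels_iso E F : vsubspace E -> isomorphic P E F ->
  wide_kernels E -> wide_kernels F.
Proof.
move=> sE [T [S [lT TS ST bT bS]]] wE n'.
have [n [C HC]] := bT n'; have [k Hk] := wE n; have [k' [D HD]] := bS k.
exists k' => i; have [w [Ew iw]] := Hk i; exists (T \o w).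
have Ew' j : E (w j) by case: (Ew j).
split=> [j /=|c].
  have [Ej nj] := Ew j; split; first by case: (TS _ Ej).
  apply/le_anti; rewrite (sn_ge0 (graded_sn GP n')) andbT.
  by rewrite (le_trans (HC _ Ej))// nj mulr0.
rewrite -(lin_on_comb c sE lT)// => kz; apply: iw.
have Ez : E (comb w i c) by apply: vsubspace_comb.
have [FTz STz] := TS _ Ez; apply/le_anti; rewrite (sn_ge0 (graded_sn GP k)) andbT.
by have := HD _ FTz; rewrite STz kz mulr0.
Qed.

(** Biorthogonal functionals bound the coefficients by [P k]. *)
Lemma norm_equivalence k w n l : independent_mod (P k) w n ->
  exists C, forall c, P l (comb w n c) <= C * P k (comb w n c).
Proof.
move=> iw; suff H m : (m <= n)%N ->
    exists C, forall c, P l (comb w m c) <= C * P k (comb w n c) by exact: H.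
elim: m => [|m IH] mn.
  by exists 0 => c; rewrite comb0 (sn0 (graded_sn GP l)) mul0r.
have [C HC] := IH (ltnW mn).
have [f [lf [D HD]] fw] := biorthogonal (graded_sn GP k) iw mn.
exists (C + D * P l (w m)) => c; rewrite combS.
apply: (le_trans ((graded_sn GP l).1 _ _)); rewrite mulrDl lerD//.
rewrite (graded_sn GP l).2 mulrAC ler_wpM2r ?(sn_ge0 (graded_sn GP l))//.
have <- : f (comb w n c) = c m; last exact: HD.
rewrite (lm_comb _ _ _ lf) (bigD1 (Ordinal mn))//= big1 => [|j]; last first.
  by rewrite -val_eqE/= => jm; rewrite fw// (negbTE jm) scaler0.
by rewrite fw// eqxx addr0 -[_ *: _]/(_ * _) mulr1.
Qed.

Lemma dominating_seq (b : nat -> nat -> R) : exists a : nat -> R,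
  [/\ forall i, 0 < a i, forall i, a i <= a i.+1 &
      forall s i, (s <= i)%N -> b s i <= a i].
Proof.
pose B i := 1 + \sum_(s < i.+1) `|b s i|.
have B1 i : 1 <= B i by rewrite /B lerDl sumr_ge0.
pose a i := \sum_(j < i.+1) B j.
have aB i : B i <= a i.
  by rewrite /a big_ord_recr/= lerDr sumr_ge0// => j _; have := B1 j; lra.
exists a; split=> [i|i|s i si].
- by have := B1 i; have := aB i; lra.
- by rewrite /a [leRHS]big_ord_recr/= lerDl; have := B1 i.+1; lra.
- apply: le_trans (aB i); apply: (le_trans (ler_norm _)).
  rewrite /B -ltnS in si *; rewrite (bigD1 (Ordinal si))//= addrCA lerDl.
  by rewrite addr_ge0// sumr_ge0.
Qed.

(** All data of a possible bound, namely the subspace, the indices [n] and [l] and an integer [q]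
    above the constant, are coded by one number [s], and the bound is refuted at [i = s]. *)
Lemma widths_diagonal (E : nat -> set X) : exists a : nat -> R,
  [/\ forall i, 0 < a i, forall i, a i <= a i.+1 &
      forall j, wide_kernels (E j) -> ~ small_widths a (E j)].
Proof.
have /choice[k Hk] : forall jn : nat * nat, exists k, wide_kernels (E jn.1) ->
    forall i, exists w, (forall j, E jn.1 (w j) /\ P jn.2 (w j) = 0) /\
      independent_mod (P k) w i.
  move=> [j n] /=; have [wE|nE] := pselect (wide_kernels (E j)).
    by have [k Hk] := wE n; exists k.
  by exists 0%N.
have /choice[D HD] : forall t : (nat * nat) * (nat * nat), exists D,
    wide_kernels (E t.1.1) -> exists w,
      [/\ forall j, E t.1.1 (w j) /\ P t.1.2 (w j) = 0,
          independent_mod (P (k t.1)) w t.2.2.+1 &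
          forall c, P t.2.1 (comb w t.2.2.+1 c) <= D * P (k t.1) (comb w t.2.2.+1 c)].
  move=> [jn [l i]] /=; have [wE|nE] := pselect (wide_kernels (E jn.1)); last first.
    by exists 0.
  have [w [Ew iw]] := Hk jn wE i.+1; have [D HD] := norm_equivalence l iw.
  by exists D => _; exists w.
(* On the test space [P l] is at most [D] times [P k], so a bound with constant at most [q] would
   force [a i] below [q * |D|]. *)
pose b s i : R := if unpickle s is Some (jn, (l, q)) then
  q%:R * `|D (jn, (l, i))| + 1 else 0.
have [a [a0 aS ab]] := dominating_seq b; exists a; split=> // j wE [n Hn].
have [l [C HC]] := Hn (k (j, n)).
pose q := Num.bound `|C|; pose s := pickle ((j, n), (l, q)) : nat.
have [w [Ew iw Dw]] := HD ((j, n), (l, s)) wE.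
have [c [[i ile ci] Hc]] := HC s w (fun i _ => Ew i).
have {Dw} := Dw c; have := ab s s (leqnn s); rewrite /b pickleK/=.
set x := comb w s.+1 c in Hc *; move: (D _) => D' Das xD.
have x0 : P (k (j, n)) x != 0.
  by apply/eqP => x0; move: ci; rewrite (iw c x0 i ile) eqxx.
have xp : 0 < P (k (j, n)) x.
  by rewrite lt_neqAle eq_sym x0 (sn_ge0 (graded_sn GP _)).
have Cq : C <= q%:R by exact: le_trans (ler_norm C) (ltW (archi_boundP (normr_ge0 C))).
have ll := sn_ge0 (graded_sn GP l) x.
have : a s * P (k (j, n)) x <= q%:R * (`|D'| * P (k (j, n)) x).
  apply: (le_trans Hc); apply: (@le_trans _ _ (q%:R * P l x)).
    exact: ler_wpM2r.
  by rewrite ler_wpM2l//; exact: graded_bound_norm xD.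
by rewrite mulrA ler_pM2r//; lra.
Qed.

End Bernstein.

(** * Dense subspaces with thin traces *)

Section ThinSubspace.
Variables (R : realType) (K : numFieldType) (V : valuation R K).
Variables (X : lmodType K) (P : nat -> X -> R).
Hypothesis GP : graded V P.
Variable m : nat -> nat.
Hypothesis mS : forall l, (m l < m l.+1)%N.
Hypothesis minf : forall l,
  infdim [set x | P (m l) x = 0] [set x | P (m l).+1 x = 0].

Lemma m_mono l l' : (l <= l')%N -> (m l <= m l')%N.
Proof.
move=> /subnK <-; elim: (l' - l)%N => // k IH.
by rewrite addSn (leq_trans IH)// ltnW.
Qed.

Lemma m_ge l : (l <= m l)%N.
Proof. by elim: l => // l IH; exact: leq_ltn_trans IH (mS l). Qed.

(** Pairs are treated in the order of [pickle]. The infinite-dimensional step leaves room for a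
    vector killed by all earlier functionals yet outside the span of the earlier vectors modulo the
    next kernel; [separation] gives its functional. *)
Lemma biorthogonal_array : exists (v : nat -> nat -> X) (f : nat -> nat -> X -> K^o),
  [/\ forall l s, P (m l) (v l s) = 0,
      forall l s, bounded_by V (P (m l).+1) (f l s) &
      forall l s l' s', f l s (v l' s') = ((l == l') && (s == s'))%:R].
Proof.
pose lev t := if unpickle t is Some (l, s) then (l : nat, s : nat).1 else 0%N.
pose good t (h : nat -> X * (X -> K^o)) :=
  [/\ P (m (lev t)) (h t).1 = 0, bounded_by V (P (m (lev t)).+1) (h t).2,
      (h t).2 (h t).1 = 1 &
      forall i, (i < t)%N -> (h t).2 (h i).1 = 0 /\ (h i).2 (h t).1 = 0].
have [||h Hh] := @history_choice _ (0, fun=> 0) good.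
- move=> t h h' hh' [h1 h2 h3 h4]; rewrite /good -(hh' t)//; split=> // i it.
  by rewrite -(hh' i) ?(ltnW it)//; exact: h4.
- move=> t h H; have lf i : (i < t)%N -> linear_map (h i).2.
    by move=> /H[_ []].
  have sU := graded_ker_vsubspace GP (m (lev t)).
  have sW := graded_ker_vsubspace GP (m (lev t)).+1.
  have inf := infdim_kers sU sW lf (@minf (lev t)).
  have sk : vsubspace ([set x | P (m (lev t)) x = 0] `&`
      [set x | forall i, (i < t)%N -> (h i).2 x = 0]).
    apply: vsubspaceI => //; split=> [i it|b x y Hx Hy i it] /=.
      by rewrite (lm0 (lf i it)).
    by rewrite (lf i it) Hx// Hy// scaler0 addr0.
  have [|x [xU xk] Hx] := infdim_sumspan (fun i => (h i).1) t sk sW inf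
    (n := 0%N) (w := fun=> 0) => //.
  have [c|f [bf fv fx]] := separation (n := t) (u := fun i => (h i).1) (e := x)
      (graded_sn GP (m (lev t)).+1).
    apply/eqP => xc; apply: (Hx (fun=> 0)); exists c.
    by rewrite comb0 subr0.
  exists (x, f); rewrite /good eqxx/=; split=> // i it.
  by rewrite (ltn_eqF it); split; [exact: fv|exact: xk].
pose c l s := pickle (l : nat, s : nat).
have levc l s : lev (c l s) = l by rewrite /lev /c pickleK.
exists (fun l s => (h (c l s)).1), (fun l s => (h (c l s)).2); split.
- by move=> l s; have [+ _ _ _] := Hh (c l s); rewrite levc.
- by move=> l s; have [_ + _ _] := Hh (c l s); rewrite levc.
- move=> l s l' s'; have [cc|] := eqVneq (c l s) (c l' s').
    have /(pcan_inj pickleK)[-> ->] := cc; rewrite !eqxx.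
    by have [_ _ -> _] := Hh (c l' s').
  move=> cc; rewrite (_ : _ && _ = false); last first.
    by apply: contraNF cc => /andP[/eqP-> /eqP->].
  move: cc; rewrite neq_ltn => /orP[cc|cc].
    by have [_ _ _ /(_ _ cc)[]] := Hh (c l' s').
  by have [_ _ _ /(_ _ cc)[]] := Hh (c l s).
Qed.

(** Each positive level is taken infinitely often. Level 0 is left out: the step at [m 0] gives
    infinite codimension to the kernel on which the trace is prescribed. *)
Definition level (s : nat) : nat :=
  if unpickle s is Some (n, i) then (n : nat, i : nat).1.+1 else 1%N.

Lemma level_pickle n i : level (pickle (n : nat, i : nat)) = n.+1.
Proof. by rewrite /level pickleK. Qed.

Lemma level_gt0 s : (0 < level s)%N.
Proof. by rewrite /level; case: (unpickle s) => [[]|]. Qed.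

Variable a : nat -> R.
Hypothesis a_gt0 : forall i, 0 < a i.
Hypothesis a_leS : forall i, a i <= a i.+1.

Lemma a_le i j : (i <= j)%N -> a i <= a j.
Proof.
move=> /subnK <-; elim: (j - i)%N => // k IH.
exact: le_trans IH (a_leS _).
Qed.

(* Coefficients growing so fast that [P k] of the [s]-th vector is negligible
   against its [k]-th coefficient. *)
Lemma weights_exist (v : nat -> nat -> X) (M : nat -> nat -> R) :
  (forall l s, 0 < M l s) ->
  exists eps : nat -> nat -> R, forall s,
    [/\ forall l, 0 <= eps s l,
        forall l, (l < level s)%N -> eps s l = 0 &
        forall l, (level s <= l)%N -> 1 <= eps s l /\
          M l s * 2 ^+ s.+2 * a s * \sum_(i < l) eps s i * P l (v i s) <= eps s l].
Proof.
move=> M0; suff /choice[eps H] : forall s, exists e : nat -> R,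
    [/\ forall l, 0 <= e l, forall l, (l < level s)%N -> e l = 0 &
        forall l, (level s <= l)%N -> 1 <= e l /\
          M l s * 2 ^+ s.+2 * a s * \sum_(i < l) e i * P l (v i s) <= e l].
  by exists eps.
move=> s.
pose S l (e : nat -> R) := M l s * 2 ^+ s.+2 * a s * \sum_(i < l) e i * P l (v i s).
pose good l (e : nat -> R) :=
  e l = if (l < level s)%N then 0 else 1 + `|S l e|.
have [||e He] := @history_choice R 0 good.
- move=> l e e' ee'; rewrite /good -ee'// => ->; case: ifP => // _.
  congr (1 + `|_ * _|); apply: eq_bigr => i _.
  by rewrite (ee' i (ltnW (ltn_ord i))).
- move=> l e _; exists (if (l < level s)%N then 0 else 1 + `|S l e|).
  rewrite /good eqxx; case: ifP => // _; congr (1 + `|_ * _|).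
  by apply: eq_bigr => i _; rewrite (ltn_eqF (ltn_ord i)).
exists e; split=> l; rewrite He.
- by case: ifP => // _; rewrite addr_ge0.
- by move=> ->.
- rewrite ltnNge => ->; split; first by rewrite lerDl.
  by apply: (le_trans (ler_norm _)); rewrite lerDr.
Qed.

(** [u s] is the sum over [l] of the [v l s] weighted by [eps s l]. Since [P l] kills the terms from
    [l] on, [P l (u s)] depends on the earlier weights only, and [eps s l] dominates it. *)
Lemma thin_vectors : exists (u : nat -> X) (g : nat -> nat -> X -> K^o)
    (eps M : nat -> nat -> R),
  [/\ forall s, P (m (level s)) (u s) = 0,
      forall l s, [/\ bounded_by V (P (m l).+1) (g l s),
        forall x, abs V (g l s x) <= M l s * P (m l).+1 x & 0 < M l s],
      forall l s s', g l s (u s') = (s == s')%:R * emb V (eps s l),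
      forall l s, (level s <= l)%N -> 1 <= eps s l &
      forall l s, (level s <= l)%N ->
        M l s * 2 ^+ s.+2 * a s * P l (u s) <= eps s l].
Proof.
have [v [f [vU bf fv]]] := biorthogonal_array.
have /choice[M' HM'] : forall ls : nat * nat, exists M,
    forall x, abs V (f ls.1 ls.2 x) <= M * P (m ls.1).+1 x.
  by move=> [l s]; have [_ [C HC]] := bf l s; exists C.
pose M l s : R := `|M' (l, s)| + 1.
have M0 l s : 0 < M l s by rewrite ltr_wpDl.
have fM l s x : abs V (f l s x) <= M l s * P (m l).+1 x.
  apply: (le_trans (HM' (l, s) x)); rewrite ler_wpM2r ?(sn_ge0 (graded_sn GP _))//.
  by rewrite (le_trans (ler_norm _))// lerDl.
have [eps Heps] := weights_exist v M0.
pose term s l := emb V (eps s l) *: v l s.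
have termP k s l : (k <= l)%N -> P (m k) (term s l) = 0.
  move=> kl; rewrite (sn_kerZ (graded_sn GP _))//.
  exact: (graded_ker GP (m_mono kl) (vU l s)).
have nt s : null_seq P (term s).
  move=> k; exists k => l kl.
  exact: (graded_ker GP (m_ge k) (termP k s l kl)).
exists (fun s => isum P (term s) (fun=> 1)), f, eps, M; split.
- move=> s; apply: (isum_ker GP _ (graded_sn GP _) (fun=> lexx _) (nt s)) => l.
  have [ls|sl] := ltnP l (level s); last exact: termP.
  have [_ e0 _] := Heps s; rewrite /term e0// rmorph0 scale0r.
  exact: (sn0 (graded_sn GP _)).
- by move=> l s; split.
- move=> l s s'; have cf : continuous_form V P (f l s) by exists (m l).+1.
  have [J HJ] := isum_form GP (fun=> 1) (nt s') cf.
  rewrite (HJ (maxn J l.+1)) ?leq_maxl//.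
  have ln : (l < maxn J l.+1)%N by rewrite leq_maxr.
  have lf := (bf l s).1.
  rewrite (bigD1 (Ordinal ln))//= big1 => [|i].
    rewrite addr0 scale1r /term (lmZ lf) fv eqxx -[_ *: _]/(_ * _) mulrC.
    by have [->|] := eqVneq s s'; rewrite // !mul0r.
  rewrite -val_eqE/= eq_sym => /negbTE li.
  by rewrite /term (lmZ lf) fv li !scaler0.
- by move=> l s ls; have [_ _ /(_ l ls)[]] := Heps s.
- move=> l s ls; have [e0 _ /(_ l ls)[_]] := Heps s; apply: le_trans.
  rewrite ler_wpM2l//.
    by rewrite mulr_ge0 ?(ltW (a_gt0 s))// mulr_ge0 ?exprn_ge0// ltW.
  have [J HJ] := isumP GP (fun=> 1) (nt s) l.
  pose u := isum P (term s) (fun=> 1); rewrite -/u.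
  pose n := maxn J l.
  have -> : P l u = P l (comb (term s) l (fun=> 1)).
    have tl j : (l <= j)%N -> P l (term s j) = 0.
      by move=> lj; exact: (graded_ker GP (m_ge l) (termP l s j lj)).
    rewrite -[u](subrK (comb (term s) n (fun=> 1))) addrC.
    rewrite (sn_kerD (graded_sn GP l)); last by rewrite HJ// leq_maxl.
    rewrite -[comb _ n _](subrK (comb (term s) l (fun=> 1))) addrC.
    by rewrite (sn_kerD (graded_sn GP l))// (null_comb_stable GP _ tl)// leq_maxr.
  apply: (le_trans (sn_sum (graded_sn GP l) l (fun i => 1 *: term s i))).
  apply: ler_sum => i _; rewrite scale1r (graded_sn GP l).2 abs_emb//.
Qed.

Variable d : nat -> X.
Hypothesis dd : dense_seq P d.

Lemma thin_subspace_exists : exists E e,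
  [/\ dense_basis P E e, wide_kernels P E & small_widths P a E].
Proof.
have [u [g [eps [M [uU gM gu eps1 epsM]]]]] := thin_vectors.
pose n0 := (m 0).+1.
have lg l s : linear_map (g l s) by have [[]] := gM l s.
have uN s : P n0 (u s) = 0.
  apply: (graded_ker GP _ (uU s)).
  exact: leq_trans (mS 0) (m_mono (level_gt0 s)).
have gcomb l s n c : (s < n)%N -> g l s (comb u n c) = c s * emb V (eps s l).
  move=> sn; rewrite (lm_comb _ _ _ (lg l s)) (bigD1 (Ordinal sn))//= big1 => [|i].
    by rewrite addr0 gu eqxx mul1r.
  by rewrite -val_eqE/= eq_sym => /negbTE si; rewrite gu si mul0r scaler0.
have eps_nz s l : (level s <= l)%N -> emb V (eps s l) != 0.
  by move=> sl; rewrite fmorph_eq0 gt_eqF// (lt_le_trans ltr01 (eps1 l s sl)).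
have iu : independent u.
  move=> n c c0 s sn; have := gcomb (level s) s n c sn.
  rewrite c0 (lm0 (lg _ _)) => /esym/eqP; rewrite mulf_eq0.
  by rewrite (negbTE (eps_nz _ _ (leqnn _))) orbF => /eqP.
have infN : infdim setT [set x | P n0 x = 0].
  apply: (infdim_sub (graded_ker_vsubspace GP (m 0)) _ _ (@minf 0%N)) => //.
  exact: (graded_ker_vsubspace GP (m 0).+1).
have [E [e [bE Eu EN]]] := transversal_basis GP dd (graded_ker_vsubspace GP n0) infN uN iu.
exists E, e; split=> //.
  (* These vectors all have level [n.+1], so [P n] kills them, while the functionals [g n.+1] show
     them independent modulo the seminorm chosen here. *)
  move=> n; exists (m n.+1).+1 => i; exists (fun j => u (pickle (n, j))); split.
    move=> j; split; first exact: Eu.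
    apply: (graded_ker GP _ (uU _)); rewrite level_pickle.
    exact: leq_trans (leqnSn n) (m_ge n.+1).
  move=> c c0 j ji.
  have [bgj _ _] := gM n.+1 (pickle (n, j)).
  have := bounded_by_ker bgj c0; rewrite (lm_comb _ _ _ (lg _ _)).
  rewrite (bigD1 (Ordinal ji))//= big1 => [|k]; last first.
    rewrite -val_eqE/= => kj; rewrite gu (_ : (_ == _) = false) ?mul0r ?scaler0//.
    by apply: contraNF kj => /eqP/(pcan_inj pickleK)[->].
  rewrite addr0 gu eqxx mul1r => /eqP; rewrite -[_ *: _]/(_ * _) mulf_eq0.
  by rewrite (negbTE (eps_nz _ _ _)) ?level_pickle// orbF => /eqP.
exists n0 => k; exists (m k).+1, 1 => i w Ew.
have /choice[nb Hnb] : forall j, exists nb : nat * (nat -> K), (j <= i)%N ->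
    w j = comb u nb.1 nb.2.
  move=> j; have [ji|ij] := leqP j i; last by exists (0%N, fun=> 0).
  by have [Ej nj] := Ew j ji; have [n [b ->]] := EN _ Ej nj; exists (n, b).
pose n := (\max_(j < i.+1) (nb j).1)%N.
pose B j s := if (s < (nb j).1)%N then (nb j).2 s else 0.
have wB j : (j <= i)%N -> w j = comb u n (B j).
  move=> ji; rewrite Hnb// comb_widen//.
  by have := @leq_bigmax _ (fun j : 'I_i.+1 => (nb j).1) (Ordinal (ji : (j < i.+1)%N)).
(* Some combination of the [i.+1] vectors has no component along the first [i] vectors [u s]; for
   the others, [a i <= a s]. *)
have [c [cn cB]] := kernel_vector i B.
exists c; split=> //; rewrite mul1r.
pose gam s := \sum_(j < i.+1) c j * B j s.
have -> : comb w i.+1 c = comb u n gam.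
  rewrite /comb; under eq_bigr => j _ do rewrite (wB j (ltn_ord j)) /comb scaler_sumr.
  rewrite exchange_big/=; apply: eq_bigr => s _.
  by rewrite /gam scaler_suml; apply: eq_bigr => j _; rewrite scalerA.
set x := comb u n gam.
have x0 := sn_ge0 (graded_sn GP (m k).+1) x.
have bound s : (s < n)%N ->
    a i * P k (gam s *: u s) <= 2^-1 ^+ s.+2 * P (m k).+1 x.
  move=> sn; have rhs0 : 0 <= 2^-1 ^+ s.+2 * P (m k).+1 x.
    by rewrite mulr_ge0// half_exp_ge0.
  have [si|is_] := ltnP s i.
    by rewrite /gam cB// scale0r (sn0 (graded_sn GP k)) mulr0.
  (* Either [P k] kills [u s], or [g k s] reads the coefficient off [x] and the weight at [k]
     outgrows [P k (u s)]. *)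
  have [ks|sk] := ltnP k (level s).
    rewrite (sn_kerZ (graded_sn GP k)) ?mulr0//.
    apply: (graded_ker GP _ (uU s)).
    exact: leq_trans (m_ge k) (m_mono (ltnW ks)).
  have [_ gx M0] := gM k s.
  have := gx x; rewrite gcomb// absM abs_emb; last first.
    exact: le_trans ler01 (eps1 k s sk).
  have := epsM k s sk; have := a_le is_; have ai := a_gt0 i.
  have g0 := abs_ge0 V (gam s); have u0 := sn_ge0 (graded_sn GP k) (u s).
  have t0 : 0 < 2 ^+ s.+2 :> R by rewrite exprn_gt0.
  rewrite (graded_sn GP k).2 exprVn ler_pdivlMl//.
  move: (abs V _) (P k _) (M k s) (eps s k) (a i) (a s) (2 ^+ _) (P _ x) g0 u0 M0 ai t0.
  move=> G U N e0 ai' as' t Px g0 u0 N0 ai0 t0 aa h1 h2.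
  rewrite -(ler_pM2l N0); apply: le_trans h2.
  apply: le_trans (ler_wpM2l g0 h1).
  have -> : N * (t * (ai' * (G * U))) = G * (N * t * ai' * U) by ring.
  rewrite ler_wpM2l// ler_wpM2r// ler_wpM2l// ltW// mulr_gt0//.
apply: (le_trans (ler_wpM2l (ltW (a_gt0 i))
  (sn_sum (graded_sn GP k) n (fun s => gam s *: u s)))).
rewrite mulr_sumr; apply: (@le_trans _ _ (\sum_(s < n) 2^-1 ^+ s.+2 * P (m k).+1 x)).
  by apply: ler_sum => s _; exact: bound.
rewrite -mulr_suml geom_half ler_piMl//.
by have := half_exp_ge0 R n.+1; lra.
Qed.

End ThinSubspace.

(** * From topological vector spaces to sequences of seminorms *)

Section Counting.
Variables (K : numFieldType) (X : tvsType K).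

Lemma card_isomorphism_classes (t : set X -> nat) n :
  (forall E, dense_countable_subspace E -> (t E < n)%N) ->
  (forall E F, dense_countable_subspace E -> dense_countable_subspace F ->
     subspace_isomorphic E F <-> t E = t F) ->
  (forall i, (i < n)%N -> exists2 E, dense_countable_subspace E & t E = i) ->
  (isomorphism_classes X #= `I_n)%card.
Proof.
move=> tn tiso tsurj.
pose phi i : set (set X) := [set F | dense_countable_subspace F /\ t F = i].
have -> : isomorphism_classes X = phi @` `I_n.
  apply/seteqP; split=> C.
    move=> [E dE ->]; exists (t E); first exact: tn.
    apply/seteqP; split=> F [dF EF]; split=> //.
      by apply/(tiso E F).
    by symmetry; apply/(tiso E F).
  move=> [i /= ilt <-]; have [E dE tE] := tsurj i ilt; exists E => //.
  apply/seteqP; split=> F [dF]; split=> //.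
    by apply/(tiso E F) => //; rewrite tE.
  by rewrite -tE; symmetry; apply/(tiso E F).
apply: inj_card_eq => i j; rewrite !inE /= => ilt _ ij.
have [E dE tE] := tsurj i ilt.
have : phi i E by [].
by rewrite ij => -[_ <-].
Qed.

End Counting.

Section Bridge.
Variables (R : realType) (K : numFieldType) (V : valuation R K) (X : tvsType K).

Lemma ltr_emb r s : (emb V r < emb V s) = (r < s).
Proof. by rewrite !lt_neqAle ler_emb (inj_eq (@emb_inj _ _ V)). Qed.

Definition topologized (P : nat -> X -> R) : Prop :=
  forall (x : X) (U : set X), nbhs x U <->
    exists n r, 0 < r /\ [set y | P n (y - x) < r] `<=` U.

(** The values are nonnegative in [K], hence come from [R]. Separation of points is taken from the
    metric, completeness from the filter of tails of a Cauchy sequence. *)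
Lemma defining_graded (p : nat -> X -> K) : frechet X -> defining_sequence p ->
  exists P : nat -> X -> R, [/\ forall n x, p n x = emb V (P n x),
    graded V P & topologized P].
Proof.
move=> [[d [d0 deq dC dt dtop]] comp] [psn pS ptop].
have /choice[P0 HP0] : forall nx : nat * X, exists r, p nx.1 nx.2 = emb V r.
  by move=> [n x]; apply: emb_real; have [] := psn n.
pose P n x := P0 (n, x).
have PE n x : p n x = emb V (P n x) by exact: (HP0 (n, x)).
have Pge0 n x : 0 <= P n x.
  by rewrite -(ler_emb V) rmorph0 -PE; have [] := psn n.
have Pmono n N x : (n <= N)%N -> P n x <= P N x.
  move=> /subnK <-; elim: (N - n)%N => // k IH.
  by apply: (le_trans IH); rewrite addSn -(ler_emb V) -!PE.
have Ptop : topologized P.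
  move=> x U; rewrite ptop; split=> [[N [e [e0 HU]]]|[n [r [r0 HU]]]].
    have [r er] := emb_real V (ltW e0); exists N, r.
    rewrite er -(rmorph0 (emb V)) ltr_emb in e0; split=> // y /= yr.
    by apply: HU => n nN; rewrite PE er ltr_emb (le_lt_trans (Pmono _ _ _ nN)).
  exists n, (emb V r); split; first by rewrite -(rmorph0 (emb V)) ltr_emb.
  by move=> y /(_ n (leqnn n)); rewrite PE ltr_emb => /HU.
exists P; split=> //; split.
- move=> n; have [_ pD pZ] := psn n; split=> [x y|a x].
    by rewrite -(ler_emb V) rmorphD -!PE.
  by apply: (@emb_inj _ _ V); rewrite rmorphM emb_abs -!PE pZ.
- by move=> n x; exact: Pmono.
- move=> x x0; apply/eqP; apply: contraT => xn.
  have dx : 0 < d 0 x.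
    by rewrite lt0r d0 andbT; apply: contra xn => /eqP/deq ->.
  have : nbhs (0 : X) [set y | d 0 y < d 0 x] by apply/dtop; exists (d 0 x).
  move=> /Ptop[n [r [r0 /(_ x)]]].
  by rewrite /= subr0 x0 ltxx => /(_ r0).
- move=> s sC; pose F : set_system X := s @ \oo.
  have [|x Fx] := comp F.
    move=> U /Ptop[n [r [r0 HU]]]; have [N HN] := sC n r r0.
    exists [set y | exists2 i, (N <= i)%N & y = s i].
      by exists N => // i /= Ni; exists i.
    move=> _ _ [i Ni ->] [j Nj ->]; apply: HU; rewrite /= subr0; exact: HN.
  exists x => n e e0; have : nbhs x [set y | P n (y - x) < e].
    by apply/Ptop; exists n, e; split.
  by move=> /Fx[N _ HN]; exists N => i Ni; exact: HN.
Qed.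

Variable P : nat -> X -> R.
Hypothesis GP : graded V P.
Hypothesis PT : topologized P.

Lemma dense_adherent (E : set X) : dense E <-> forall x, adherent P E x.
Proof.
split=> [dE x n e e0|dE O [x Ox] oO].
  have : nbhs x [set y | P n (y - x) < e] by apply/PT; exists n, e; split.
  rewrite nbhsE => -[O [oO Ox] OU].
  have [|y [Oy Ey]] := dE O _ oO; first by exists x.
  by exists y => //; rewrite (snC (graded_sn GP n)); exact: OU.
have /PT[n [r [r0 HU]]] : nbhs x O by exact: open_nbhs_nbhs.
have [y Ey xy] := dE x n r r0; exists y; split=> //; apply: HU.
by rewrite /= (snC (graded_sn GP n)).
Qed.

Lemma separable_dense_seq : separable X -> exists d, dense_seq P d.
Proof.
move=> [D /countable_injP[f finj] /dense_adherent dD].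
have /choice[d Hd] : forall n, exists x, (exists2 y, D y & f y = n) -> D x /\ f x = n.
  move=> n; have [[y Dy fy]|H] := pselect (exists2 y, D y & f y = n).
    by exists y.
  by exists 0.
exists d => x n e e0; have [y Dy xy] := dD x n e e0; exists (f y).
have [|Dd fd] := Hd (f y); first by exists y.
by have <- : y = d (f y) by apply: finj; rewrite ?inE.
Qed.

Lemma dense_countableP (E : set X) :
  dense_countable_subspace E <-> exists e, dense_basis P E e.
Proof.
split=> [[_ /dense_adherent dE [e [ie Ee]]]|[e [ie Ee dE]]]; first by exists e.
split; last by exists e.
  by rewrite Ee; exact: spanned_subspace.
exact/dense_adherent.
Qed.

Lemma continuous_bounded_on (E : set X) (f : X -> X) : vsubspace E ->
  lin_on E f -> {within E, continuous f} <-> bounded_on P E f.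
Proof.
move=> sE lf; have f0 := lin_on0 sE lf.
have fZ a x : E x -> f (a *: x) = a *: f x.
  by move=> Ex; have := lf a x 0 Ex sE.1; rewrite f0 !addr0.
split.
  move=> /subspace_continuousP cf n.
  have /(cf 0 sE.1) : nbhs (f 0) [set y | P n (y - f 0) < 1].
    by apply/PT; exists n, 1; split.
  rewrite f0 => /PT[k [r [r0 Hr]]]; exists k, (2 / r) => x Ex.
  have small t : 0 <= t -> t * P k x < r -> t * P n (f x) < 1.
    move=> t0 tr; have := Hr (emb V t *: x).
    rewrite /= subr0 (graded_sn GP k).2 abs_emb// => /(_ tr (vsubspaceZ _ sE Ex)).
    by rewrite /= subr0 /from_subspace fZ// (graded_sn GP n).2 abs_emb.
  have k0 := sn_ge0 (graded_sn GP k) x; have n0 := sn_ge0 (graded_sn GP n) (f x).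
  (* If [P k x = 0], all multiples of [x] are in the ball, so [f x] is scaled up to contradict the
     bound. *)
  have [kx|kx] := eqVneq (P k x) 0.
    rewrite kx mulr0 leNgt; apply/negP => nx.
    have := small (P n (f x))^-1; rewrite invr_ge0 kx mulr0 => /(_ n0 r0).
    by rewrite mulVf ?gt_eqF// ltxx.
  have kp : 0 < P k x by rewrite lt_neqAle eq_sym kx.
  have t0 : 0 < r / (2 * P k x) by rewrite divr_gt0// mulr_gt0.
  have tk : r / (2 * P k x) * P k x < r.
    have -> : r / (2 * P k x) * P k x = r / 2 by field.
    lra.
  have := small _ (ltW t0) tk.
  rewrite mulrAC ltr_pdivrMr ?mulr_gt0// mul1r => H.
  by rewrite mulrAC ler_pdivlMr// mulrC ltW.
move=> bf; apply/subspace_continuousP => x Ex U /PT[n [r [r0 HU]]].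
have [k [C HC]] := bf n; have C0 : 0 < `|C| + 1 by rewrite ltr_wpDl.
apply/PT; exists k, (r / (`|C| + 1)); split; first by rewrite divr_gt0.
move=> y /= yx Ey; apply: HU; rewrite /=.
have -> : f y - f x = f (y - x).
  by rewrite -scaleN1r addrC -lf// scaleN1r addrC.
apply: (le_lt_trans (graded_bound_norm GP (HC _ (vsubspaceB sE Ey Ex)))).
rewrite ltr_pdivlMr// in yx; have := sn_ge0 (graded_sn GP k) (y - x).
by move: yx; move: (P k _) => b; nra.
Qed.

Lemma subspace_isomorphicP (E F : set X) : vsubspace E -> vsubspace F ->
  subspace_isomorphic E F <-> isomorphic P E F.
Proof.
move=> sE sF; have lS (T S : X -> X) : lin_on E T ->
    (forall x, E x -> F (T x) /\ S (T x) = x) ->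
    (forall y, F y -> E (S y) /\ T (S y) = y) -> lin_on F S.
  move=> lT TS ST a x y Fx Fy; have [Ex Tx] := ST _ Fx; have [Ey Ty] := ST _ Fy.
  have Exy := sE.2 a _ _ Ex Ey.
  by have [_ <-] := TS _ Exy; rewrite lT// Tx Ty.
split=> [[T [S [lT TS ST cT cS]]]|[T [S [lT TS ST bT bS]]]]; exists T, S; split=> //.
- exact/(continuous_bounded_on sE lT).
- exact/(continuous_bounded_on sF (lS _ _ lT TS ST)).
- exact/(continuous_bounded_on sE lT).
- exact/(continuous_bounded_on sF (lS _ _ lT TS ST)).
Qed.

Lemma isomorphic_refl (E : set X) : isomorphic P E E.
Proof.
by exists id, id; split=> // n; exists n, 1 => x _; rewrite mul1r.
Qed.

Lemma infdim_of_not_findim (U W : set X) : ~ findim_quotient U W -> infdim U W.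
Proof.
move=> nf n w Uw; apply: contrapT => H; apply: nf.
exists n, (fun i => w i); split=> [i|x Ux]; first exact: Uw.
apply: contrapT => nc; apply: H; exists x => // c Wc; apply: nc.
by exists (fun i => c i).
Qed.

(** Each spanning vector that is new modulo the kernel contributes a form dual to it, whose
    vanishing removes its coefficient. *)
Lemma findim_forms k (U : set X) : findim_quotient U [set x | P k x = 0] ->
  exists n (f : nat -> X -> K^o), (forall i, (i < n)%N -> continuous_form V P (f i)) /\
    forall x, U x -> (forall i, (i < n)%N -> f i x = 0) -> P k x = 0.
Proof.
move=> [n [w [_ Hw]]]; pose v i : X := if insub i is Some j then w j else 0.
suff [N [f [cf Hf]]] : exists N (f : nat -> X -> K^o),
    (forall i, (i < N)%N -> continuous_form V P (f i)) /\
    forall x, (exists c, P k (x - comb v n c) = 0) ->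
      (forall i, (i < N)%N -> f i x = 0) -> P k x = 0.
  exists N, f; split=> // x Ux; apply: Hf; have [c Hc] := Hw x Ux.
  exists (fun i => if insub i is Some j then c j else 0); rewrite -[RHS]Hc.
  by congr (P k (_ - _)); apply: eq_bigr => i _; rewrite /v valK.
move: (v) => {w Hw v} v; elim: n v => [|n IH] v.
  by exists 0%N, (fun _ _ => 0); split=> // x [c]; rewrite comb0 subr0.
have [N [f [cf Hf]]] := IH v.
have [[b Hb]|nb] := pselect (exists b, P k (v n - comb v n b) = 0).
  exists N, f; split=> // x [c Hc]; apply: Hf.
  exists (fun i => c n * b i + c i); rewrite combP.
  have -> : x - (c n *: comb v n b + comb v n c) =
      (x - comb v n.+1 c) + c n *: (v n - comb v n b).
    by rewrite combS scalerBr !opprD !addrA subrK addrAC.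
  by rewrite (sn_kerD (graded_sn GP k))// (sn_kerZ (graded_sn GP k)).
have [c|g [bg gv gn]] := separation (n := n) (u := v) (e := v n) (graded_sn GP k).
  by apply/eqP => Hc; apply: nb; exists c.
exists N.+1, (upd f N g); split=> [i|x [c Hc] Hx].
  rewrite ltnS leq_eqVlt => /orP[/eqP->|iN]; first by rewrite updE; exists k.
  by rewrite upd_lt//; exact: cf.
have gx : g x = 0 by have := Hx N (ltnSn N); rewrite updE.
have cn : c n = 0.
  have := bounded_by_ker bg Hc; rewrite (lmB bg.1) gx sub0r combS (lmD bg.1).
  rewrite (lmZ bg.1) gn (lm_comb _ _ _ bg.1) big1 => [|i _]; last first.
    by rewrite gv// scaler0.
  by rewrite add0r -[_ *: 1]/(_ * 1) mulr1 => /eqP; rewrite oppr_eq0 => /eqP.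
apply: Hf => [|i iN]; first by exists c; move: Hc; rewrite combS cn scale0r addr0.
by have := Hx i (ltnW iN); rewrite upd_lt.
Qed.

(** The finite families of the single steps are merged into one sequence by [pickle]. For a chain of
    kernels this yields separating forms. *)
Lemma chain_forms (C : nat -> set X) :
  (forall k, exists n (f : nat -> X -> K^o),
     (forall i, (i < n)%N -> continuous_form V P (f i)) /\
     forall x, C k x -> (forall i, (i < n)%N -> f i x = 0) -> C k.+1 x) ->
  exists hh : nat -> X -> K^o, (forall j, continuous_form V P (hh j)) /\
    forall k, exists J, forall x, C 0%N x -> (forall j, (j < J)%N -> hh j x = 0) ->
      C k x.
Proof.
move=> /choice[n /choice[f Hf]].
pose hh t : X -> K^o := if unpickle t is Some (k, i) then
  if (i < n k)%N then f k i else fun=> 0 else fun=> 0.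
have hhE k i : (i < n k)%N -> hh (pickle (k : nat, i : nat)) = f k i.
  by move=> ik; rewrite /hh pickleK ik.
exists hh; split=> [t|k].
  rewrite /hh; case: (unpickle t) => [[k i]|]; last exact: continuous_form0.
  by case: ifP => ik; [exact: (Hf k).1|exact: continuous_form0].
elim: k => [|k [J HJ]]; first by exists 0%N.
exists (maxn J (\max_(i < n k) pickle (k, i : nat)).+1) => x Cx Hx.
apply: (Hf k).2 => [|i ik].
  by apply: HJ => // j jJ; apply: Hx; rewrite leq_max jJ.
rewrite -hhE//; apply: Hx; rewrite leq_max ltnS orbC.
by rewrite (leq_bigmax (F := fun i : 'I_(n k) => pickle (k, i : nat)) (Ordinal ik)).
Qed.

End Bridge.

(** * Counting the isomorphism classes *)

Section Classes.
Variables (R : realType) (K : numFieldType) (V : valuation R K) (X : tvsType K).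
Hypothesis hX : separable_infdim_frechet X.

Let frX : frechet X. Proof. by case: hX. Qed.

Let infX : infdim [set: X] [set 0].
Proof. by apply: infdim_of_not_findim; case: hX. Qed.

Let zero_sub : vsubspace [set (0 : X)].
Proof. by split=> // a x y -> ->; rewrite scaler0 addr0. Qed.

Section WithTopology.
Variable P : nat -> X -> R.
Hypothesis GP : graded V P.
Hypothesis PT : topologized P.

Lemma dense_countable_exists : exists E : set X, dense_countable_subspace E.
Proof.
have [_ sX _] := hX; have [d dd] := separable_dense_seq GP PT sX.
have [E [e [bE _]]] := transversal_basis0 GP dd zero_sub infX.
by exists E; apply/(dense_countableP GP PT); exists e.
Qed.

Lemma isoP (E F : set X) :
  dense_countable_subspace E -> dense_countable_subspace F ->
  subspace_isomorphic E F <-> isomorphic P E F.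
Proof. by move=> [sE _ _] [sF _ _]; exact: (subspace_isomorphicP GP PT). Qed.

Lemma one_class :
  (forall (E F : set X) e f, dense_basis P E e -> dense_basis P F f ->
     isomorphic P E F) -> (isomorphism_classes X #= `I_1)%card.
Proof.
move=> all_iso; apply: (card_isomorphism_classes (t := fun=> 0%N)) => //.
  move=> E F dE dF; split=> // _; apply/isoP => //.
  have /(dense_countableP GP PT)[e be] := dE.
  have /(dense_countableP GP PT)[f bf] := dF.
  exact: all_iso be bf.
move=> i; rewrite ltnS leqn0 => /eqP->.
by have [E dE] := dense_countable_exists; exists E.
Qed.

Lemma continuous_forms_kernel n (f : nat -> X -> K^o) :
  (forall i, (i < n)%N -> continuous_form V P (f i)) ->
  exists2 x, x != 0 & forall i, (i < n)%N -> f i x = 0.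
Proof.
move=> cf; have lf i : (i < n)%N -> linear_map (f i) by move=> /cf[k []].
have inf := infdim_kers (vsubspaceT X) zero_sub lf infX.
have [|x [_ fx] x0] := inf 0%N (fun=> 0) => //.
exists x => //; apply/eqP => xE; apply: (x0 (fun=> 0)).
by rewrite xE comb0 subr0.
Qed.

End WithTopology.

Let ker_emb (p : nat -> X -> K) (P : nat -> X -> R) n :
  (forall n x, p n x = emb V (P n x)) -> ker (p n) = [set x | P n x = 0].
Proof.
move=> pP; apply/seteqP; split=> x; rewrite /ker /= pP.
  by move=> /eqP; rewrite fmorph_eq0 => /eqP.
by move=> ->; rewrite rmorph0.
Qed.

Lemma classes_F1 : F1 X -> (isomorphism_classes X #= `I_1)%card.
Proof.
move=> [p dp [n kn]]; have [P [pP GP PT]] := defining_graded V frX dp.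
apply: (one_class GP PT) => E F e f bE bF.
have Pn x : P n x = 0 -> x = 0.
  by move=> x0; have : ker (p n) x; [rewrite (ker_emb n pP)|rewrite kn].
by apply: (norm_isomorphic GP (k := n) bE bF) => x _; exact: Pn.
Qed.

Lemma step_forms (p : nat -> X -> K) (P : nat -> X -> R) k U : graded V P ->
  (forall n x, p n x = emb V (P n x)) -> findim_quotient U (ker (p k)) ->
  exists n (f : nat -> X -> K^o), (forall i, (i < n)%N -> continuous_form V P (f i)) /\
    forall x, U x -> (forall i, (i < n)%N -> f i x = 0) -> P k x = 0.
Proof. by move=> GP pP; rewrite (ker_emb k pP); exact: findim_forms. Qed.

Lemma classes_F0 : F0 X -> (isomorphism_classes X #= `I_1)%card.
Proof.
move=> [p dp [f0 fS]]; have [P [pP GP PT]] := defining_graded V frX dp.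
(* The kernel of the zero seminorm comes first, so the other kernels are shifted by one. *)
pose C k : set X := if k is k'.+1 then [set x | P k' x = 0] else setT.
have [|hh [hf hs]] := chain_forms (V := V) (P := P) (C := C).
  case=> [|k]; first exact: (step_forms GP pP f0).
  have := step_forms GP pP (fS k); by rewrite (ker_emb k pP).
have hsep : separates P (fun=> 0) hh.
  by move=> k; have [J HJ] := hs k.+1; exists J => x _; exact: HJ.
apply: (one_class GP PT) => E F e f bE bF.
have sn_0 : real_seminorm (abs V) (fun _ : X => 0 : R).
  by split=> [x y|a x]; rewrite ?addr0 ?mulr0.
apply: (dense_isomorphic GP sn_0 (k := 0%N) _ hf hsep _ bE bF).
- by move=> x; exact: (sn_ge0 (graded_sn GP 0)).
- move=> n; have [J HJ] := hsep n.
  have [x x0 Hx] := continuous_forms_kernel (n := J) (fun i _ => hf i).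
  by exists x; split=> //; exact: HJ.
- move=> x _ k eps e0; have [_ _ dE] := bE.
  by have [y Ey xy] := dE x k eps e0; exists y.
- move=> x _ k eps e0; have [_ _ dF] := bF.
  by have [y Fy xy] := dF x k eps e0; exists y.
Qed.

Lemma classes_F2 : F2 X -> (isomorphism_classes X #= `I_3)%card.
Proof.
move=> [p dp [inf0 fS nz]]; have [P [pP GP PT]] := defining_graded V frX dp.
have [|hh [hf hs]] := chain_forms (V := V) (P := P)
    (C := fun k => [set x | P k x = 0]).
  by move=> k; have := step_forms GP pP (fS k); rewrite (ker_emb k pP).
have ker_nz n : exists2 x, P n x = 0 & x != 0.
  have [k nk] := nz n; rewrite !(ker_emb _ pP) => /existsNP[x /not_implyP[kx nx]].
  exists x; first exact: (graded_ker GP nk kx).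
  by apply/eqP => x0; apply: nx; rewrite x0 /= (sn0 (graded_sn GP _)).
have {}inf0 : infdim setT [set x | P 0 x = 0].
  by apply: infdim_of_not_findim; rewrite -(ker_emb 0 pP).
have [_ sX _] := hX; have [d dd] := separable_dense_seq GP PT sX.
pose t E := if `[< has_norm P E >] then 0%N
            else if `[< has_dense_kernel P E >] then 1%N else 2%N.
apply: (card_isomorphism_classes (t := t)).
- by move=> E _; rewrite /t; do 2?case: ifP.
- move=> E F dE dF.
  have /(dense_countableP GP PT)[e be] := dE.
  have /(dense_countableP GP PT)[f bf] := dF.
  have sE := dense_basis_vsubspace be; have sF := dense_basis_vsubspace bf.
  rewrite (isoP GP PT dE dF); split=> [iEF|].
    have iFE := isomorphic_sym sE iEF.
    rewrite /t (_ : `[< has_norm P E >] = `[< has_norm P F >]); last first.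
      by apply: asbool_equiv_eq; split; exact: (has_norm_iso GP).
    rewrite (_ : `[< has_dense_kernel P E >] = `[< has_dense_kernel P F >])//.
    apply: asbool_equiv_eq; split.
      exact: (has_dense_kernel_iso GP hf hs be bf iEF).
    exact: (has_dense_kernel_iso GP hf hs bf be iFE).
  rewrite /t; case: (asboolP (has_norm P E)) => [[k Hk]|nE];
    case: (asboolP (has_norm P F)) => [[l Hl]|nF] //.
  - move=> _; apply: (norm_isomorphic GP (k := maxn k l) be bf) => x Ex x0.
      by apply: Hk => //; apply: (graded_ker GP) x0; rewrite leq_maxl.
    by apply: Hl => //; apply: (graded_ker GP) x0; rewrite leq_maxr.
  - by case: ifP.
  - by case: ifP.
  - case: (asboolP (has_dense_kernel P E)) => [kE|nkE];
      case: (asboolP (has_dense_kernel P F)) => [kF|nkF] // _.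
      exact: (dense_kernel_isomorphic GP hf hs ker_nz be bf).
    exact: (mixed_isomorphic GP hf hs be bf).
- case=> [|[|[|//]]] _.
  + have [E [e [bE nE]]] := has_norm_exists GP dd inf0.
    exists E; first by apply/(dense_countableP GP PT); exists e.
    by rewrite /t asboolT.
  + have [E [e [bE nE kE]]] := has_dense_kernel_exists GP hf hs ker_nz dd inf0.
    exists E; first by apply/(dense_countableP GP PT); exists e.
    by rewrite /t asboolF// asboolT.
  + have [E [e [bE nE kE]]] := mixed_exists GP hf hs ker_nz dd inf0.
    exists E; first by apply/(dense_countableP GP PT); exists e.
    by rewrite /t asboolF// asboolF.
Qed.

Lemma classes_F3 : F3 X -> ~ countable (isomorphism_classes X).
Proof.
move=> [p dp inf3]; have [P [pP GP PT]] := defining_graded V frX dp.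
have [next Hnext] : exists next : nat -> nat,
    forall N, (N <= next N)%N /\ ~ findim_step p (next N).
  have /choice[next Hn] : forall N, exists n, (N <= n)%N /\ ~ findim_step p n.
    by move=> N; have [n Nn fn] := inf3 N; exists n.
  by exists next.
pose m := fix m l := if l is l'.+1 then next (m l').+1 else next 0%N.
have mS l : (m l < m l.+1)%N by have [] := Hnext (m l).+1.
have minf l : infdim [set x | P (m l) x = 0] [set x | P (m l).+1 x = 0].
  rewrite -!(ker_emb _ pP); apply: infdim_of_not_findim.
  by case: l => [|l]; [have [] := Hnext 0%N|have [] := Hnext (m l).+1].
have [_ sX _] := hX; have [d dd] := separable_dense_seq GP PT sX.
move=> /countable_injP[f finj].
have cls E : dense_countable_subspace E ->
    isomorphism_classes X [set F | dense_countable_subspace F /\ subspace_isomorphic E F].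
  by move=> dE; exists E.
(* [rep j] represents the class numbered [j]; numbers that are not attained get the empty set. *)
have /choice[rep Hrep] : forall j, exists E, forall F,
    dense_countable_subspace F ->
    f [set G | dense_countable_subspace G /\ subspace_isomorphic F G] = j ->
    dense_countable_subspace E /\ subspace_isomorphic E F.
  move=> j; have [[E [dE fE]]|nE] := pselect (exists E, dense_countable_subspace E /\
      f [set G | dense_countable_subspace G /\ subspace_isomorphic E G] = j); last first.
    by exists set0 => F dF fF; case: nE; exists F.
  exists E => F dF fF; split=> //.
  have EF : [set G | dense_countable_subspace G /\ subspace_isomorphic E G] =
      [set G | dense_countable_subspace G /\ subspace_isomorphic F G].
    by apply: finj; rewrite ?inE ?fE ?fF//; exact: cls.
  have : [set G | dense_countable_subspace G /\ subspace_isomorphic F G] F.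
    by split=> //; apply/(isoP GP PT) => //; exact: isomorphic_refl.
  by rewrite -EF => -[].
(* No representative with wide kernels has small widths for [a], but the thin subspace built for [a]
   has both properties and is isomorphic to a representative. *)
have [a [a0 aS aE]] := widths_diagonal GP rep.
have [E [e [bE wE sE]]] := thin_subspace_exists GP mS minf a0 aS dd.
have dE : dense_countable_subspace E by apply/(dense_countableP GP PT); exists e.
have [dR /(isoP GP PT dR dE) iRE] := Hrep _ E dE erefl.
have [sR _ _] := dR; have [sE' _ _] := dE.
have iER := isomorphic_sym sR iRE.
apply: (aE _ (wide_kernels_iso GP sE' iER wE)).
exact: (small_widths_iso GP (fun i => ltW (a0 i)) sE' sR iER sE).
Qed.

End Classes.

Local Open Scope card_scope.

Theorem corollary1p12 (R : realType) (K : numFieldType) (hK : RorC R K)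
    (X : tvsType K) (hX : separable_infdim_frechet X) :
  [/\ F0 X \/ F1 X -> isomorphism_classes X #= `I_1,
      F2 X -> isomorphism_classes X #= `I_3 &
      F3 X -> ~ countable (isomorphism_classes X)].
Proof.
have [V] := valuation_RorC hK; split.
- by move=> [/(classes_F0 V hX)|/(classes_F1 V hX)].
- exact: (classes_F2 V hX).
- exact: (classes_F3 V hX).
Qed.
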